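(* Let $\phi:A^M\to N^2$ be a smooth submersive harmonic morphism from an open subset $A^M$ of Minkowski $4$-space $\mathbb{M}^4$ to a Riemann surface. Then there is an open dense set of points $A^M_0$ of $A^M$ and a shear-free ray congruence $\ell$ on $A^M_0$ such that each fibre component of $\phi|_{A^M_0}$ is the union of parallel null lines of $\ell$. Further, for any $p\in A^M_0$, there is a neighbourhood $A^M_1$ of $p$ in $A^M_0$ and a holomorphic map $\rho:V\to\mathbb{C}\cup\{\infty\}$ from an open subset $V$ of $N^2$ such that $\mu=\rho\circ\phi$ represents $\ell$ (on $A^M_1$).
   Context: $\mathbb{M}^4=\{(t,x_1,x_2,x_3)\}$ with metric $-dt^2+dx_1^2+dx_2^2+dx_3^2$ and Levi-Civita connection $\nabla$. A smooth map $\phi$ to a Riemann surface is a harmonic morphism if, in any local complex coordinate of the target, $-\phi_{tt}+\sum_{i=1}^3\phi_{x_ix_i}=0$ and $-\phi_t^2+\sum_{i=1}^3\phi_{x_i}^2=0$ (equivalently, it pulls back local harmonic functions to harmonic functions). A fibre component is a connected component of a fibre. A shear-free ray congruence is a smooth foliation $\ell$ by (open pieces of) affine null lines, called the null lines of $\ell$, with tangent field $w=\partial/\partial t+U$, $U$ unit and tangent to the slices $t=$ const, such that, with $W=\mathrm{span}\{w\}$, $\Sigma$ the space of vectors tangent to the slices $t=$ const and orthogonal to $U$ (oriented by $U$ and the orientation of $\mathbb{R}^3$), $J^\perp$ rotation through $+\pi/2$ on $\Sigma$, and $\{\ \}^\Sigma$ projection $W^\perp\to\Sigma$ along $W$, one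 has $\{\nabla_{J^\perp X}w\}^\Sigma=J^\perp\{\nabla_Xw\}^\Sigma$ for all $X\in\Sigma$. A function $\mu$ with values in $\mathbb{C}\cup\{\infty\}$ represents $\ell$ on its domain if $U=\sigma^{-1}(i\mu)$ there, where $\sigma^{-1}(u)=\frac{1}{1+|u|^2}(1-|u|^2,2\,\mathrm{Re}\,u,2\,\mathrm{Im}\,u)$ and $\sigma^{-1}(\infty)=(-1,0,0)$.
   Formalization: ''Holomorphic map ρ'' is read up to the orientation of N²: near each p, either dφ is complex linear on (Σ, J⊥) and ρ is holomorphic, or dφ is antilinear there and ρ is antiholomorphic; with N²'s complex structure fixed, the printed claim fails for φ or for its conjugate. *)

(* Defs.v *)
From HB Require Import structures.
From mathcomp Require Import all_boot all_order all_algebra.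
From mathcomp Require Import complex.
From mathcomp Require Import all_classical all_reals all_analysis.
From mathcomp Require Import ring.

Set Implicit Arguments.
Unset Strict Implicit.
Unset Printing Implicit Defensive.

Import Order.TTheory GRing.Theory Num.Theory.
Import numFieldNormedType.Exports.

Local Open Scope classical_set_scope.
Local Open Scope ring_scope.

(* R[i] carries its topology and its normed R[i]-module structure only through
   the alias R[i]^o.  For f : Cplx R -> Cplx R, [derivable f z 1] is complex
   differentiability at z. *)
Notation Cplx R := ((complex R)^o) (only parsing).
Notation sphere R := (one_point_compactification (Cplx R)) (only parsing).

(** * Riemann surfaces *)

Record chart (R : realType) (N : topologicalType) := Chart {
  cdom : set N ;
  cmap : N -> Cplx R ;
  cinv : Cplx R -> N ;
  cdom_open : open cdom ;
  cimg_open : open (cmap @` cdom) ;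
  cmapK : forall q, cdom q -> cinv (cmap q) = q ;
  cmap_cont : forall q, cdom q -> {for q, continuous cmap} ;
  cinv_cont : forall z, (cmap @` cdom) z -> {for z, continuous cinv}
}.

Definition chart_compatible (R : realType) (N : topologicalType)
    (c d : chart R N) : Prop :=
  forall q, cdom c q -> cdom d q ->
    derivable (cmap d \o cinv c) (cmap c q) 1 /\
    derivable (cmap c \o cinv d) (cmap d q) 1.

(* Second countability is not required: it is automatic by Rado's theorem.
   As the atlas is maximal, its members are all the local complex coordinates
   of the surface. *)
Record riemann_surface (R : realType) := RiemannSurface {
  rs_carrier :> topologicalType ;
  rs_hausdorff : hausdorff_space rs_carrier ;
  rs_connected : connected [set: rs_carrier] ;
  rs_atlas : set (chart R rs_carrier) ;
  rs_cover : forall q, exists2 c, rs_atlas c & cdom c q ;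
  rs_compatible :
    forall c d, rs_atlas c -> rs_atlas d -> chart_compatible c d ;
  rs_maximal : forall c,
    (forall d, rs_atlas d -> chart_compatible c d) -> rs_atlas c
}.

(* Meaningful for open S. *)
Definition holomorphic_on (R : realType) (N : riemann_surface R)
    (S : set N) (g : N -> Cplx R) : Prop :=
  forall c, rs_atlas c -> forall q, S q -> cdom c q ->
    derivable (g \o cinv c) (cmap c q) 1.

(* [None] is the point at infinity; [sphere_fin] and [sphere_inv] are the two
   standard coordinates z and 1/z, on the complements of infinity and of 0. *)
Definition sphere_fin (R : realType) (u : sphere R) : Cplx R := odflt 0 u.

Definition sphere_inv (R : realType) (u : sphere R) : Cplx R :=
  if u is Some z then z^-1 else 0.

Definition sphere_mulI (R : realType) (u : sphere R) : sphere R :=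
  omap (fun z : complex R => Complex 0 1 * z) u.

Definition sphere_conj (R : realType) (u : sphere R) : sphere R :=
  omap (fun z : complex R => conjc z) u.

Definition holomorphic_to_sphere (R : realType) (N : riemann_surface R)
    (V : set N) (rho : N -> sphere R) : Prop :=
  [/\ forall q, V q -> {for q, continuous rho},
      holomorphic_on (V `&` [set q | rho q <> None]) (@sphere_fin R \o rho) &
      holomorphic_on (V `&` [set q | rho q <> Some 0]) (@sphere_inv R \o rho)].

Definition antiholomorphic_to_sphere (R : realType) (N : riemann_surface R)
    (V : set N) (rho : N -> sphere R) : Prop :=
  holomorphic_to_sphere V (@sphere_conj R \o rho).

(** * Minkowski space: coordinate 0 is t, coordinates 1, 2, 3 are spatial *)

Notation M4 R := ('rV[R]_4) (only parsing).

Definition row4 (R : realType) (t x y z : R) : M4 R :=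
  \row_(j < 4) [:: t; x; y; z]`_j.

Definition tcoord (R : realType) (X : M4 R) : R := X 0 0.

Definition xcoord (R : realType) (i : 'I_3) (X : M4 R) : R :=
  X 0 (lift ord0 i).

Definition minkowski (R : realType) (X Y : M4 R) : R :=
  - (tcoord X * tcoord Y) + \sum_(i < 3) xcoord i X * xcoord i Y.

(* The metric has constant coefficients, so its Levi-Civita connection is the
   flat one: the covariant derivative is the directional derivative. *)
Definition nabla (R : realType) (X : M4 R) (w : M4 R -> M4 R) (p : M4 R) :
    M4 R := 'D_X w p.

Definition partial (R : realType) (i : 'I_4) (f : M4 R -> R) : M4 R -> R :=
  fun p => 'D_(delta_mx 0 i) f p.

(* Meaningful for open A: all iterated partial derivatives of f, indexed by the
   sequences of directions, exist and are continuous at the points of A. *)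
Definition smooth_on (R : realType) (A : set (M4 R)) (f : M4 R -> R) : Prop :=
  forall (s : seq 'I_4) p, A p ->
    {for p, continuous (foldr (@partial R) f s)} /\
    forall i : 'I_4, derivable (foldr (@partial R) f s) p (delta_mx 0 i).

Definition smooth_field_on (R : realType) (A : set (M4 R))
    (w : M4 R -> M4 R) : Prop :=
  forall j : 'I_4, smooth_on A (fun p => w p 0 j).

Definition smooth_cplx_on (R : realType) (A : set (M4 R))
    (f : M4 R -> Cplx R) : Prop :=
  smooth_on A (fun p => complex.Re (f p)) /\
  smooth_on A (fun p => complex.Im (f p)).

Definition cderive (R : realType) (X : M4 R) (f : M4 R -> Cplx R) (p : M4 R) :
    Cplx R :=
  Complex ('D_X (fun q => complex.Re (f q)) p)
          ('D_X (fun q => complex.Im (f q)) p).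

Definition cpartial (R : realType) (i : 'I_4) (f : M4 R -> Cplx R) :
    M4 R -> Cplx R :=
  cderive (delta_mx 0 i) f.

(** * Maps from an open subset A of Minkowski space to a Riemann surface

   Such a map is given by a total function, whose values outside A are
   irrelevant. *)

Definition smooth_map_on (R : realType) (N : riemann_surface R)
    (A : set (M4 R)) (phi : M4 R -> N) : Prop :=
  (forall p, A p -> {for p, continuous phi}) /\
  forall c, rs_atlas c ->
    smooth_cplx_on (A `&` phi @^-1` cdom c) (cmap c \o phi).

Definition submersive_on (R : realType) (N : riemann_surface R)
    (A : set (M4 R)) (phi : M4 R -> N) : Prop :=
  forall p, A p -> forall c, rs_atlas c -> cdom c (phi p) ->
    forall z : Cplx R, exists X : M4 R, cderive X (cmap c \o phi) p = z.

Definition harmonic_morphism_on (R : realType) (N : riemann_surface R)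
    (A : set (M4 R)) (phi : M4 R -> N) : Prop :=
  forall p, A p -> forall c, rs_atlas c -> cdom c (phi p) ->
    let f := cmap c \o phi in
    - cpartial 0 (cpartial 0 f) p
      + \sum_(i < 3) cpartial (lift ord0 i) (cpartial (lift ord0 i) f) p = 0
    /\
    - cpartial 0 f p ^+ 2 + \sum_(i < 3) cpartial (lift ord0 i) f p ^+ 2 = 0.

Definition fibre_component (R : realType) (N : riemann_surface R)
    (A : set (M4 R)) (phi : M4 R -> N) (p : M4 R) : set (M4 R) :=
  connected_component (A `&` phi @^-1` [set phi p]) p.

(** * Shear-free ray congruences *)

(* An open connected piece of the affine null line with direction v. *)
Definition open_null_piece (R : realType) (v : M4 R) (L : set (M4 R)) : Prop :=
  [/\ v != 0, minkowski v v = 0 &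
      exists (a : M4 R) (I : set R),
        [/\ open I, is_interval I, I !=set0 &
            L = [set a + s *: v | s in I]]].

(* [leaves] are the null lines of the congruence; [ray_dir] is the vector field
   U. *)
Record ray_foliation (R : realType) := RayFoliation {
  leaves : set (set (M4 R)) ;
  ray_dir : M4 R -> M4 R
}.

Definition tangent_field (R : realType) (ell : ray_foliation R) (p : M4 R) :
    M4 R := delta_mx 0 0 + ray_dir ell p.

Definition null_foliation_on (R : realType) (A : set (M4 R))
    (ell : ray_foliation R) : Prop :=
  [/\ forall p, A p ->
        tcoord (ray_dir ell p) = 0 /\
        minkowski (ray_dir ell p) (ray_dir ell p) = 1,
      smooth_field_on A (ray_dir ell),
      \bigcup_(L in leaves ell) L = A,
      forall L L', leaves ell L -> leaves ell L' ->
        L `&` L' !=set0 -> L = L' &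
      forall L, leaves ell L -> exists v, open_null_piece v L /\
        forall p, L p -> exists k : R, tangent_field ell p = k *: v].

Definition in_Sigma (R : realType) (ell : ray_foliation R) (p X : M4 R) :
    Prop :=
  tcoord X = 0 /\ minkowski X (ray_dir ell p) = 0.

(* X |-> U x X in the oriented Euclidean slice: as (U, X, U x X) is a direct
   frame, on Sigma this is the rotation through +pi/2. *)
Definition Jperp (R : realType) (ell : ray_foliation R) (p X : M4 R) : M4 R :=
  let u (i : 'I_3) := xcoord i (ray_dir ell p) in
  let x (i : 'I_3) := xcoord i X in
  row4 0 (u 1 * x 2%:R - u 2%:R * x 1)
         (u 2%:R * x 0 - u 0 * x 2%:R)
         (u 0 * x 1 - u 1 * x 0).

(* The projection of the orthogonal complement of W = span w onto Sigma along
   W: subtract the multiple of w that kills the time component. *)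
Definition Sigma_proj (R : realType) (ell : ray_foliation R) (p v : M4 R) :
    M4 R :=
  v - tcoord v *: tangent_field ell p.

Lemma Sigma_projP (R : realType) (ell : ray_foliation R) (p v : M4 R) :
    tcoord (ray_dir ell p) = 0 ->
    minkowski (ray_dir ell p) (ray_dir ell p) = 1 ->
    minkowski v (tangent_field ell p) = 0 ->
  in_Sigma ell p (Sigma_proj ell p v) /\
  exists k : R, v = Sigma_proj ell p v + k *: tangent_field ell p.
Proof.
move=> U0 UU vw; split; last by exists (tcoord v); rewrite subrK.
move: vw UU; rewrite /in_Sigma /minkowski /Sigma_proj /tangent_field.
move: U0; rewrite /tcoord /xcoord !big_ord_recl !big_ord0 !mxE /= => ->.
set a := v _ _; set b := v _ _; set c := v _ _; set d := v _ _.
move: (ray_dir _ _) => U.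
set x := U _ _; set y := U _ _; set z := U _ _ => vw UU.
split; first by ring.
transitivity ((- (a * (1 + 0)) + (b * x + (c * y + (d * z + 0))))
   + a * (1 - (x * x + (y * y + (z * z + 0))))); first by ring.
move: vw UU; rewrite !(mulr0, oppr0, add0r) => -> ->.
by rewrite subrr mulr0 addr0.
Qed.

Definition shear_free_ray_congruence (R : realType) (A : set (M4 R))
    (ell : ray_foliation R) : Prop :=
  null_foliation_on A ell /\
  forall p X, A p -> in_Sigma ell p X ->
    Sigma_proj ell p (nabla (Jperp ell p X) (tangent_field ell) p) =
    Jperp ell p (Sigma_proj ell p (nabla X (tangent_field ell) p)).

Definition parallel_leaves (R : realType) (S : set (set (M4 R))) : Prop :=
  exists v, forall L, S L -> open_null_piece v L.

(** * Representation of the direction field by stereographic projection *)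

Definition sigma_inv (R : realType) (u : sphere R) : M4 R :=
  if u is Some z then
    let n := complex.Re z ^+ 2 + complex.Im z ^+ 2 in
    (1 + n)^-1 *: row4 0 (1 - n) (2 * complex.Re z) (2 * complex.Im z)
  else row4 0 (- 1) 0 0.

Definition represents_on (R : realType) (A : set (M4 R))
    (ell : ray_foliation R) (mu : M4 R -> sphere R) : Prop :=
  forall p, A p -> ray_dir ell p = sigma_inv (sphere_mulI (mu p)).

(** * Orientation of the target

   The harmonic morphism equations do not distinguish N from N with the
   conjugate complex structure, whereas [represents_on] depends on the
   orientation of the slices.  The complex structure of N for which the
   differential of phi is complex linear on (Sigma, Jperp) is N itself when
   [Sigma_linear] holds, and the conjugate one when [Sigma_antilinear] holds. *)

Definition Sigma_linear (R : realType) (N : riemann_surface R)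
    (A : set (M4 R)) (phi : M4 R -> N) (ell : ray_foliation R) : Prop :=
  forall p, A p -> forall c, rs_atlas c -> cdom c (phi p) ->
  forall X, in_Sigma ell p X ->
    cderive (Jperp ell p X) (cmap c \o phi) p =
    Complex 0 1 * cderive X (cmap c \o phi) p.

Definition Sigma_antilinear (R : realType) (N : riemann_surface R)
    (A : set (M4 R)) (phi : M4 R -> N) (ell : ray_foliation R) : Prop :=
  forall p, A p -> forall c, rs_atlas c -> cdom c (phi p) ->
  forall X, in_Sigma ell p X ->
    cderive (Jperp ell p X) (cmap c \o phi) p =
    - (Complex 0 1 * cderive X (cmap c \o phi) p).

(* Main.v *)
(** Let f be phi in a complex coordinate of N, and a = f_t + f_1,
    b = f_2 - i f_3, c = f_2 + i f_3, d = f_t - f_1. The conformality equation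
    ad = bc says that the matrix of the entries a, b, c, d has rank one, and its
    two ratios u = - c/d and v = - b/d give the two null directions killed by df:
    d/dt + sigma^-1(u), and d/dt + sigma^-1(conj v), which is the direction
    of the first kind for the conjugate of f.

    The wave equation makes u constant along two of the four complex null fields
    that kill f (they span the kernel of df), and v along the other two. Taking
    the commutator of the two fields that kill u shows that the product of the
    remaining derivatives of u and v vanishes. Hence, on an open dense set, u or v
    is locally constant along the whole kernel of df, that is du = r df or
    dv = r df, and so it is locally a holomorphic function of f. Since
    stereographic projection is conformal and df is conformal on the screen
    spaces, the corresponding null direction is shear-free. It is constant on
    the fibres, which are therefore unions of parallel null lines. *)

(* Smoothness is given by iterated coordinate derivatives only, so linearity of directional
   derivatives and symmetry of mixed ones must first be derived; both rest on a first-order estimate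
   between two moving points. Conjugating f exchanges u and conj v, so everything after the
   dichotomy is proved for u alone and applied either to a chart of N or to its conjugate, selected
   by a Boolean. Locally u is either finite, with du = r df, or identically infinite; the two cases
   run through the proof. Two gaps remain after the pointwise computation. The field w is killed
   along itself, yet a leaf must be a straight line, so constancy along the fixed vector w(p) needs
   a Gronwall estimate. And du = r df gives a function of f only after f has been straightened by a
   contraction; the coefficient r then is the complex derivative of that function. For gluing, the
   direction does not depend on the chart, because a change of chart rescales df, but the choice
   between u and v is not canonical: u is preferred, and v is used only in the interior of the set
   where u fails. This loses no density. *)
From HB Require Import structures.
From mathcomp Require Import all_boot all_order all_algebra.
From mathcomp Require Import all_classical all_reals all_analysis.
From mathcomp Require Import complex ring lra.
Require Import Defs.
Import Order.TTheory GRing.Theory Num.Theory.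
Import numFieldNormedType.Exports.

Set Implicit Arguments.
Unset Strict Implicit.
Unset Printing Implicit Defensive.

Local Open Scope classical_set_scope.
Local Open Scope ring_scope.

(** * Real calculus on four-space: closure properties of smooth functions *)

Section RealCalculus.
Variable R : realType.
Implicit Types (f g : 'rV[R]_4 -> R) (B : set 'rV[R]_4) (p X : 'rV[R]_4).

Lemma is_derive_line (W : normedModType R) (V : normedModType R) (f : V -> W)
    (p v : V) (s : R) : derivable f (p + s *: v) v ->
  is_derive s 1 (fun t => f (p + t *: v)) ('D_v f (p + s *: v)).
Proof.
move=> df.
have E : (fun h : R => h^-1 *: (((fun t => f (p + t *: v)) \o shift s)
           (h *: (1 : R)) - f (p + s *: v))) =
  (fun h => h^-1 *: ((f \o shift (p + s *: v)) (h *: v) - f (p + s *: v))).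
  apply/funext => h /=; congr (_ *: (f _ - _)).
  by rewrite [h *: 1]mulr1 scalerDl addrCA.
split; first by rewrite /derivable E.
by rewrite /derive E.
Qed.

(** Taking the parameter in [0, 1] instead of between 0 and h treats all signs of h at once. *)
Lemma MVT_line (V : normedModType R) (f : V -> R) (p v : V) (h : R) :
  (forall s : R, 0 <= s <= 1 -> derivable f (p + (s * h) *: v) v) ->
  exists2 s : R, 0 <= s <= 1 &
    f (p + h *: v) - f p = h * 'D_v f (p + (s * h) *: v).
Proof.
move=> df.
have dg (s : R) : 0 <= s <= 1 ->
    is_derive s 1 (fun t => f (p + (t * h) *: v))
      ('D_v f (p + (s * h) *: v) * h).
  move=> s01.
  have := is_derive_line (df _ s01).
  have d2 : is_derive s (1 : R) (fun t : R => t * h) h.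
    have -> : (fun t : R => t * h) = h \*: (id : R -> R).
      by apply/funext => t /=; rewrite mulrC.
    by apply: is_derive_eq; rewrite [_ *: _]mulr1.
  move=> d1.
  exact: (@is_derive1_comp _ (fun t => f (p + t *: v)) (fun t => t * h)
    s _ _ d1 d2).
have [||s s01] := @MVT R (fun t => f (p + (t * h) *: v))
    (fun s => 'D_v f (p + (s * h) *: v) * h) 0 1 ltr01.
- by move=> s; rewrite in_itv /= => /andP[? ?]; apply: dg; rewrite !ltW.
- apply: derivable_within_continuous => s; rewrite in_itv /= => /dg.
  by move=> ?; exact: ex_derive.
- rewrite mul1r mul0r scale0r addr0 subr0 mulr1 mulrC => ->.
  by exists s => //; move: s01; rewrite in_itv /= => /andP[? ?]; rewrite !ltW.
Qed.

Lemma is_derive_continuous (f : R -> R) (s df : R) :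
  is_derive s 1 f df -> {for s, continuous f}.
Proof. by move=> [/derivable1_diffP /differentiable_continuous]. Qed.

(** [smooth_on] speaks of one list of directions at a time, which does not survive the Leibniz rule:
    a derivative of a product is a sum of products. Counting orders instead gives a class that is
    stable under sums, products and inverses by induction on n. *)
Fixpoint Ck n B f : Prop :=
  (forall p, B p -> {for p, continuous f}) /\
  if n is m.+1 then
    forall i, (forall p, B p -> derivable f p (delta_mx 0 i)) /\
              Ck m B (partial i f)
  else True.

Lemma smooth_on_partial B f (i : 'I_4) : smooth_on B f -> smooth_on B (partial i f).
Proof. by move=> sf s p Bp; rewrite -foldr_rcons; exact: sf. Qed.

Lemma smooth_onP B f : smooth_on B f <-> forall n, Ck n B f.
Proof.
split=> [sf n|sf s].
  elim: n f sf => [|n IH] f sf /=; split.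
  - by move=> p Bp; case: (sf [::] p Bp).
  - by [].
  - by move=> p Bp; case: (sf [::] p Bp).
  - move=> i; split; first by move=> p Bp; case: (sf [::] p Bp).
    exact/IH/smooth_on_partial.
(* The last direction of the list is applied first, so induction from the right peels off the
   innermost derivative. *)
elim/last_ind: s f sf => [|s i IH] f sf p Bp.
  split; first by have [+ _] := sf 0%N; apply.
  by move=> i; have [_ /(_ i)[+ _]] := sf 1%N; apply.
by rewrite foldr_rcons; apply: IH => // n; have [_ /(_ i)[_]] := sf n.+1.
Qed.

Lemma open_near B p : open B -> B p -> \near p, B p.
Proof. by move=> oB Bp; apply: open_nbhs_nbhs. Qed.

Lemma near_eq_continuous (T U : topologicalType) (f g : T -> U) (p : T) :
  {near p, f =1 g} -> {for p, continuous f} -> {for p, continuous g}.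
Proof.
move=> fg cf; have fgp := nbhs_singleton fg.
suff : g @ p --> f p by rewrite fgp.
by apply: cvg_trans cf; exact: near_eq_cvg.
Qed.

Lemma Ck_ext n B f g : open B -> (forall p, B p -> f p = g p) ->
  Ck n B f -> Ck n B g.
Proof.
move=> oB; elim: n f g => [|n IH] f g fg /= [cf df].
  split=> // p Bp; apply: near_eq_continuous (cf _ Bp).
  by near=> q; apply: fg; near: q; exact: open_near.
have fgp p : B p -> {near p, f =1 g}.
  by move=> Bp; near=> q; apply: fg; near: q; exact: open_near.
split.
  by move=> p Bp; apply: near_eq_continuous (cf _ Bp); exact: fgp.
move=> i; have [dfi cfi] := df i; split.
  by move=> p Bp; apply: near_eq_derivable (dfi _ Bp); exact: fgp.
by apply: IH cfi => p Bp; apply: near_eq_derive; exact: fgp.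
Unshelve. all: by end_near. Qed.

Lemma CkS n B f : Ck n.+1 B f -> Ck n B f.
Proof.
elim: n f => [|n IH] f; first by case.
by move=> [cf df]; split=> // i; have [? /IH] := df i.
Qed.

Lemma Ck_cst n B (k : R) : open B -> Ck n B (fun=> k).
Proof.
move=> oB; elim: n k => [|n IH] k; first by split=> // p _; exact: cst_continuous.
split=> [p _|i]; first exact: cst_continuous.
split; first by move=> p _; exact: derivable_cst.
apply: (Ck_ext oB) (IH 0) => p _.
by rewrite /partial derive_cst.
Qed.

Lemma CkD n B f g : open B -> Ck n B f -> Ck n B g ->
  Ck n B (fun p => f p + g p).
Proof.
move=> oB; elim: n f g => [|n IH] f g [cf df] [cg dg] /=.
  by split=> // p Bp; apply: continuousD; [exact: cf|exact: cg].
split=> [p Bp|i]; first by apply: continuousD; [exact: cf|exact: cg].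
have [dfi cfi] := df i; have [dgi cgi] := dg i.
split=> [p Bp|].
  by apply: (@derivableD _ _ _ f g); [exact: dfi|exact: dgi].
apply: (Ck_ext oB) (IH _ _ cfi cgi) => p Bp.
by rewrite /partial -deriveD //; [exact: dfi|exact: dgi].
Qed.

Lemma CkM n B f g : open B -> Ck n B f -> Ck n B g ->
  Ck n B (fun p => f p * g p).
Proof.
move=> oB; elim: n f g => [|n IH] f g /[dup] Cf [cf df] /[dup] Cg [cg dg] /=.
  by split=> // p Bp; apply: continuousM; [exact: cf|exact: cg].
split=> [p Bp|i].
  by apply: continuousM; [exact: cf|exact: cg].
have [dfi cfi] := df i; have [dgi cgi] := dg i.
split=> [p Bp|].
  by apply: (@derivableM _ _ f g); [exact: dfi|exact: dgi].
apply: (Ck_ext oB) (CkD oB (IH _ _ (CkS Cf) cgi) (IH _ _ (CkS Cg) cfi)) => p Bp.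
by rewrite /partial (deriveM (dfi _ Bp) (dgi _ Bp)).
Qed.

(** The derivative of 1/f is - (1/f)^2 f', whose factor 1/f is covered one order lower by the
    induction hypothesis. *)
Lemma CkV n B f : open B -> (forall p, B p -> f p != 0) -> Ck n B f ->
  Ck n B (fun p => (f p)^-1).
Proof.
move=> oB f0; elim: n f f0 => [|n IH] f f0 /[dup] Cf [cf df] /=.
  split=> // p Bp; apply: continuousV; [exact: f0|exact: cf].
split=> [p Bp|i]; first by apply: continuousV; [exact: f0|exact: cf].
have [dfi cfi] := df i.
split=> [p Bp|]; first by apply: derivableV; [exact: f0|exact: dfi].
have Vf := IH f f0 (CkS Cf).
apply: (Ck_ext oB)
  (CkM oB (CkM oB (Ck_cst n (-1) oB) (CkM oB Vf Vf)) cfi) => p Bp.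
rewrite /partial deriveV //; [|exact: f0|exact: dfi].
by rewrite mulN1r -invfM -expr2.
Qed.

Lemma smooth_on_ext B f g : open B -> (forall p, B p -> f p = g p) ->
  smooth_on B f -> smooth_on B g.
Proof.
by move=> oB fg /smooth_onP sf; apply/smooth_onP => n; exact: Ck_ext (sf n).
Qed.

Lemma smooth_on_cst B (k : R) : open B -> smooth_on B (fun=> k).
Proof. by move=> oB; apply/smooth_onP => n; exact: Ck_cst. Qed.

Lemma smooth_onD B f g : open B -> smooth_on B f -> smooth_on B g ->
  smooth_on B (fun p => f p + g p).
Proof.
by move=> oB /smooth_onP sf /smooth_onP sg; apply/smooth_onP => n; exact: CkD.
Qed.

Lemma smooth_onM B f g : open B -> smooth_on B f -> smooth_on B g ->
  smooth_on B (fun p => f p * g p).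
Proof.
by move=> oB /smooth_onP sf /smooth_onP sg; apply/smooth_onP => n; exact: CkM.
Qed.

Lemma smooth_onV B f : open B -> (forall p, B p -> f p != 0) ->
  smooth_on B f -> smooth_on B (fun p => (f p)^-1).
Proof.
by move=> oB f0 /smooth_onP sf; apply/smooth_onP => n; exact: CkV.
Qed.

Lemma smooth_onN B f : open B -> smooth_on B f -> smooth_on B (fun p => - f p).
Proof.
move=> oB sf; apply: (smooth_on_ext oB) (smooth_onM oB (smooth_on_cst (-1) oB) sf).
by move=> p _; rewrite mulN1r.
Qed.

Lemma smooth_onB B f g : open B -> smooth_on B f -> smooth_on B g ->
  smooth_on B (fun p => f p - g p).
Proof. by move=> oB sf sg; apply: smooth_onD => //; exact: smooth_onN. Qed.

Lemma smooth_on_sub B B' f : B' `<=` B -> smooth_on B f -> smooth_on B' f.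
Proof. by move=> BB' sf s p /BB'; exact: sf. Qed.

Lemma smooth_on_local B f :
  (forall p, B p -> exists B', [/\ open B', B' p & smooth_on B' f]) ->
  smooth_on B f.
Proof. by move=> H s p /H[B' [_ B'p sf]]; exact: sf. Qed.

End RealCalculus.

(** * Strict differentiability, directional derivatives and symmetry of mixed derivatives *)

Section StrictDifferentiability.
Variable R : realType.
Implicit Types (f g : 'rV[R]_4 -> R) (B : set 'rV[R]_4) (p X : 'rV[R]_4).

Lemma rV4_norm_le X (e : R) : (forall j, `|X 0 j| <= e) -> `|X| <= e.
Proof.
move=> Xe; rewrite /Num.norm /= mx_normrE; apply/bigmax_leP; split.
  by apply: le_trans (Xe 0).
by move=> [i j] _ /=; rewrite ord1.
Qed.

Lemma rV4_coord_le X j : `|X 0 j| <= `|X|.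
Proof.
rewrite [leRHS]/Num.norm /= mx_normrE.
exact: (le_bigmax _ (fun ij : 'I_1 * 'I_4 => `|X ij.1 ij.2|) (0, j)).
Qed.

Lemma rV4_ball p q (r : R) : ball p r q <-> `|p - q| < r.
Proof. by rewrite -ball_normE. Qed.

Lemma rV4_nbhs_ball p (P : set 'rV[R]_4) : (\near p, P p) ->
  exists2 r : R, 0 < r & forall q, `|p - q| < r -> P q.
Proof.
move=> /nbhs_ballP [r r0 Pr]; exists r => // q pq; apply: Pr.
by rewrite rV4_ball.
Qed.

Lemma normr_between (a b c s r : R) : 0 <= s <= 1 ->
  `|c - a| < r -> `|c - b| < r -> `|c - (a + s * (b - a))| < r.
Proof.
move=> /andP[s0 s1] ca cb.
have -> : c - (a + s * (b - a)) = (1 - s) * (c - a) + s * (c - b) by ring.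
apply: le_lt_trans (ler_normD _ _) _; rewrite !normrM.
rewrite (ger0_norm s0) ger0_norm ?subr_ge0 //.
set x := `|_|; set y := `|_| in cb *.
apply: le_lt_trans (_ : Num.max x y < r); last by rewrite gt_max ca cb.
have xm : x <= Num.max x y by rewrite le_max lexx.
have ym : y <= Num.max x y by rewrite le_max lexx orbT.
have -> : Num.max x y = (1 - s) * Num.max x y + s * Num.max x y by ring.
by apply: lerD; rewrite ler_wpM2l // subr_ge0.
Qed.

(** Go from x to y by changing one coordinate at a time and use the mean value theorem on each of
    the four edges, each with error e/4. The norm is the maximum of the coordinates, so the edges
    stay in the ball. Both points move: this is what the mixed difference and the contraction below
    require. *)
Lemma strict_differentiability f p :
  (\near p, forall i, derivable f p (delta_mx 0 i)) ->
  (forall i, {for p, continuous (partial i f)}) ->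
  forall e : R, 0 < e -> exists2 r : R, 0 < r & forall x y,
    `|p - x| < r -> `|p - y| < r ->
    `|f y - f x - \sum_i (y - x) 0 i * partial i f p| <= e * `|y - x|.
Proof.
move=> df cf e e0.
have e4 : 0 < e / 4%:R by rewrite divr_gt0.
have nearp : \forall q \near p, (forall i, derivable f q (delta_mx 0 i)) /\
    forall i, `|partial i f p - partial i f q| <= e / 4%:R.
  have H i : \forall q \near p, `|partial i f p - partial i f q| <= e / 4%:R.
    by have /cvgrPdist_le /(_ _ e4) := cf i.
  near=> q; split; first by near: q.
  by move=> i; move: i; near: q; apply: filter_forall => i; exact: H.
have [r r0 Hr] := rV4_nbhs_ball nearp.
exists r => // x y px py.
pose z (k : nat) : 'rV[R]_4 := \row_j (if (j < k)%N then y 0 j else x 0 j).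
have zS (k : 'I_4) : z k.+1 = z k + (y 0 k - x 0 k) *: delta_mx 0 k.
  apply/rowP => j; rewrite !mxE eqxx /= ltnS leq_eqVlt.
  case: (eqVneq j k) => [->|jk]; first by rewrite eqxx ltnn /=; ring.
  by rewrite (negPf (jk : (j : nat) != k)) /= mulr0 addr0.
have zin (k : 'I_4) (s : R) : 0 <= s <= 1 ->
    `|p - (z k + (s * (y 0 k - x 0 k)) *: delta_mx 0 k)| < r.
  move=> s01; rewrite [ltLHS]/Num.norm /= mx_normrE; apply/bigmax_ltP; split => //.
  move=> [i j] _ /=; rewrite ord1 !mxE eqxx /=.
  have pxj : `|p 0 j - x 0 j| < r.
    by apply: le_lt_trans px; have := rV4_coord_le (p - x) j; rewrite !mxE.
  have pyj : `|p 0 j - y 0 j| < r.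
    by apply: le_lt_trans py; have := rV4_coord_le (p - y) j; rewrite !mxE.
  case: (eqVneq j k) => [jk|jk]; rewrite ?mulr1 ?mulr0 ?addr0.
    by subst j; rewrite ltnn; exact: normr_between.
  by case: ifP.
have step (k : 'I_4) : `|f (z k.+1) - f (z k) - (y - x) 0 k * partial k f p|
    <= e / 4%:R * `|y - x|.
  have [s s01|s s01] := @MVT_line R _ f (z k) (delta_mx 0 k) (y 0 k - x 0 k).
    by have [/(_ k)] := Hr _ (zin k s s01).
  rewrite zS => ->; rewrite !mxE -mulrBr normrM mulrC ler_pM //.
    rewrite distrC; have [_ /(_ k)] := Hr _ (zin k s s01); exact.
  by have := rV4_coord_le (y - x) k; rewrite !mxE.
have z0 : z 0%N = x by apply/rowP => j; rewrite mxE.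
have z4 : z 4%N = y by apply/rowP => j; rewrite mxE ltn_ord.
have -> : f y - f x = \sum_(k < 4) (f (z k.+1) - f (z k)).
  rewrite -z0 -{1}z4 -(big_mkord xpredT (fun k => f (z k.+1) - f (z k))).
  by rewrite telescope_sumr.
rewrite -sumrB.
apply: le_trans (ler_norm_sum _ _ _) _.
apply: le_trans (ler_sum _ (fun k _ => step k)) _.
rewrite sumr_const card_ord le_eqVlt; apply/orP; left; apply/eqP; field.
Unshelve. all: by end_near. Qed.

Lemma smooth_strict B f p : open B -> smooth_on B f -> B p ->
  forall e : R, 0 < e -> exists2 r : R, 0 < r & forall x y,
    `|p - x| < r -> `|p - y| < r ->
    `|f y - f x - \sum_i (y - x) 0 i * partial i f p| <= e * `|y - x|.
Proof.
move=> oB sf Bp; apply: strict_differentiability.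
  by near=> q; have [] := sf [::] q; [near: q; exact: open_near|].
by move=> i; have [] := sf [:: i] _ Bp.
Unshelve. all: by end_near. Qed.

Lemma smooth_is_derive B f p X : open B -> smooth_on B f -> B p ->
  is_derive p X f (\sum_i X 0 i * partial i f p).
Proof.
move=> oB sf Bp; set L := \sum_i _.
suff H : (fun h : R => h^-1 *: ((f \o shift p) (h *: X) - f p)) @ 0^' --> L.
  by split; [apply/cvg_ex; exists L|exact: cvg_lim].
apply/cvgrPdist_le => e e0.
have e1 : 0 < e / (1 + `|X|) by rewrite divr_gt0 // ltr_pwDl.
have [r r0 Hr] := smooth_strict oB sf Bp e1.
have r1 : 0 < r / (1 + `|X|) by rewrite divr_gt0 // ltr_pwDl.
have X1 : 0 < 1 + `|X| by rewrite ltr_pwDl.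
near=> h.
have h0 : h != 0 by near: h; exact: nbhs_dnbhs_neq.
have hr : `|h| < r / (1 + `|X|).
  by near: h; apply: dnbhs0_lt.
have := Hr p (h *: X + p); rewrite subrr normr0 => /(_ r0).
have -> : p - (h *: X + p) = - (h *: X) by rewrite opprD addrCA subrr addr0.
have hX : `|h *: X| < r.
  rewrite normrZ; apply: le_lt_trans (_ : `|h| * (1 + `|X|) < r).
    by rewrite ler_wpM2l // lerDr.
  by rewrite -ltr_pdivlMr.
rewrite normrN => /(_ hX); rewrite addrK.
have -> : \sum_i (h *: X) 0 i * partial i f p = h * L.
  by rewrite mulr_sumr; apply: eq_bigr => i _; rewrite !mxE mulrA.
rewrite distrC /= => H.
have -> : L - h^-1 *: (f (h *: X + p) - f p) =
   h^-1 * (h * L - (f (h *: X + p) - f p)).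
  by rewrite mulrBr mulKf.
rewrite normrM normfV mulrC ler_pdivrMr ?normr_gt0 //.
apply: le_trans H _; rewrite normrZ.
rewrite mulrAC ler_pdivrMr // mulrA ler_wpM2l ?lerDr //.
by rewrite mulr_ge0 // ltW.
Unshelve. all: by end_near. Qed.

Lemma smooth_derive B f p X : open B -> smooth_on B f -> B p ->
  'D_X f p = \sum_i X 0 i * partial i f p.
Proof. by move=> oB sf /(smooth_is_derive X oB sf) ?; rewrite derive_val. Qed.

Lemma smooth_derivable B f p X : open B -> smooth_on B f -> B p ->
  derivable f p X.
Proof. by move=> oB sf /(smooth_is_derive X oB sf) []. Qed.

(** The second difference over a square of side h is the increment along j of g(q) = f(q + h e_i) -
    f(q). The mean value theorem makes it h times a difference of [partial j f] at two points h e_i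
    apart; as their position along j is unknown, strict differentiability of [partial j f] at p is
    needed to compare it with h times [partial i (partial j f) p]. *)
Lemma partialC_half B f p (i j : 'I_4) (e : R) :
  open B -> smooth_on B f -> B p -> 0 < e ->
  exists2 r : R, 0 < r & forall h : R, 0 < h < r ->
    `|f (p + h *: delta_mx 0 i + h *: delta_mx 0 j) - f (p + h *: delta_mx 0 i)
      - f (p + h *: delta_mx 0 j) + f p
      - h * h * partial i (partial j f) p| <= e * h * h.
Proof.
move=> oB sf Bp e0.
have sjf := smooth_on_partial j sf.
have [r r0 Hr] := smooth_strict oB sjf Bp e0.
have [r' r'0 Hr'] := rV4_nbhs_ball (open_near oB Bp).
have dn (k : 'I_4) (a : R) : `|a *: delta_mx 0 k : 'rV[R]_4| <= `|a|.
  apply: rV4_norm_le => l; rewrite !mxE eqxx /= normrM.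
  by case: (l == k); rewrite ?normr1 ?normr0 ?mulr1 ?mulr0.
(* Points of the square are at distance at most 2 h from p, hence the half. *)
have m0 : 0 < Num.min r r' / 2%:R by rewrite divr_gt0 // lt_min r0 r'0.
exists (Num.min r r' / 2%:R) => // h /andP[h0 hr].
(* The Boolean [c] tells whether the step along i has been made. *)
have near2 (s : R) : 0 <= s <= 1 -> forall c : bool,
    `|p - (p + (c%:R * h) *: delta_mx 0 i + (s * h) *: delta_mx 0 j)| <
    Num.min r r'.
  move=> /andP[s0 s1] c.
  rewrite !opprD !addrA subrr sub0r.
  apply: le_lt_trans (ler_normB _ _) _; rewrite normrN.
  apply: le_lt_trans (lerD (dn _ _) (dn _ _)) _.
  rewrite !normrM (ger0_norm s0) (gtr0_norm h0).
  apply: le_lt_trans (_ : h + h < _).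
    apply: lerD; last by nra.
    by case: c; rewrite ?normr1 ?normr0 ?mul1r ?mul0r // ltW.
  by rewrite [ltRHS]splitr ltrD.
have inB (s : R) : 0 <= s <= 1 -> forall c : bool,
    B (p + (c%:R * h) *: delta_mx 0 i + (s * h) *: delta_mx 0 j).
  move=> s01 c; apply: Hr'; apply: lt_le_trans (near2 _ s01 c) _.
  by rewrite ge_min lexx orbT.
pose g q := f (q + h *: delta_mx 0 i) - f q.
have dsh q X : derivable f (q + h *: delta_mx 0 i) X ->
    is_derive q X (fun q => f (q + h *: delta_mx 0 i))
      ('D_X f (q + h *: delta_mx 0 i)).
  move=> d.
  have E : (fun k : R => k^-1 *: (((fun q => f (q + h *: delta_mx 0 i)) \o shift q)
             (k *: X) - f (q + h *: delta_mx 0 i))) =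
    (fun k => k^-1 *: ((f \o shift (q + h *: delta_mx 0 i)) (k *: X)
             - f (q + h *: delta_mx 0 i))).
    by apply/funext => k /=; rewrite addrA.
  by split; [rewrite /derivable E|rewrite /derive E].
have dg (s : R) : 0 <= s <= 1 ->
    is_derive (p + (s * h) *: delta_mx 0 j) (delta_mx 0 j) g
     (partial j f (p + (1%:R * h) *: delta_mx 0 i + (s * h) *: delta_mx 0 j) -
      partial j f (p + (0%:R * h) *: delta_mx 0 i + (s * h) *: delta_mx 0 j)).
  move=> s01.
  have B1 := inB _ s01 true; have B0 := inB _ s01 false.
  rewrite /= mul1r in B1 *; rewrite /= mul0r scale0r addr0 in B0 *.
  rewrite [p + _ + _]addrAC in B1 *.
  apply: (@is_deriveB _ _ _ (fun q => f (q + h *: delta_mx 0 i)) f).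
    by apply: dsh; case: (sf [::] _ B1).
  by apply: derivableP; case: (sf [::] _ B0).
have [s s01|s s01 E] := @MVT_line R _ g p (delta_mx 0 j) h.
  by have [] := dg s s01.
have [_ Dg] := dg s s01.
have -> : f (p + h *: delta_mx 0 i + h *: delta_mx 0 j) - f (p + h *: delta_mx 0 i)
    - f (p + h *: delta_mx 0 j) + f p = g (p + h *: delta_mx 0 j) - g p.
  by rewrite /g [p + h *: delta_mx 0 j + _]addrAC; ring.
rewrite E Dg.
have := Hr (p + (0%:R * h) *: delta_mx 0 i + (s * h) *: delta_mx 0 j)
           (p + (1%:R * h) *: delta_mx 0 i + (s * h) *: delta_mx 0 j).
have lmin c : `|p - (p + (nat_of_bool c)%:R * h *: delta_mx 0 i + (s * h) *: delta_mx 0 j)| < r.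
  by apply: lt_le_trans (near2 _ s01 c) _; rewrite ge_min lexx.
move=> /(_ (lmin false) (lmin true)).
set P1 := partial _ _ _; set P0 := partial _ _ _.
have -> : p + (1%:R * h) *: delta_mx 0 i + (s * h) *: delta_mx 0 j -
  (p + (0%:R * h) *: delta_mx 0 i + (s * h) *: delta_mx 0 j) = h *: delta_mx 0 i.
  by apply/rowP => k; rewrite !mxE; ring.
rewrite (bigD1 i) //= big1 ?addr0; last first.
  by move=> k ki; rewrite !mxE (negPf ki) andbF mulr0 mul0r.
rewrite !mxE !eqxx /= mulr1 => H.
rewrite -mulrA -mulrBr normrM (gtr0_norm h0) [leRHS]mulrC ler_pM2l //.
apply: le_trans H _; rewrite ler_pM2l //.
by apply: le_trans (dn _ _) _; rewrite gtr0_norm.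
Qed.

Let mixed_diff_le (A1 A2 A3 F h e D1 D2 : R) :
  `|A1 - A2 - A3 + F - h * h * D1| <= e / 2%:R * h * h ->
  `|A1 - A3 - A2 + F - h * h * D2| <= e / 2%:R * h * h ->
  `|h * h * (D2 - D1)| <= e * h * h.
Proof.
have -> : h * h * (D2 - D1) =
  (A1 - A2 - A3 + F - h * h * D1) - (A1 - A3 - A2 + F - h * h * D2) by ring.
move=> H1 H2; apply: le_trans (ler_normB _ _) _.
apply: le_trans (lerD H1 H2) _.
by rewrite le_eqVlt; apply/orP; left; apply/eqP; field.
Qed.

(** The second difference is symmetric in i and j, and h^2 times either mixed derivative
    approximates it up to e h^2 / 2. *)
Lemma partialC B f p (i j : 'I_4) : open B -> smooth_on B f -> B p ->
  partial i (partial j f) p = partial j (partial i f) p.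
Proof.
move=> oB sf Bp; apply/eqP; rewrite -subr_eq0 -normr_le0.
apply/ler_addgt0Pr => e e0; rewrite add0r.
have e2 : 0 < e / 2%:R by rewrite divr_gt0.
have [r r0 Hr] := partialC_half i j oB sf Bp e2.
have [r' r'0 Hr'] := partialC_half j i oB sf Bp e2.
pose h := Num.min r r' / 2%:R.
have m0 : 0 < Num.min r r' by rewrite lt_min r0 r'0.
have h0 : 0 < h by rewrite divr_gt0.
have hm : h < Num.min r r' by rewrite ltr_pdivrMr // ltr_pMr // ltr1n.
have h1 : 0 < h < r by rewrite h0 (lt_le_trans hm) // ge_min lexx.
have h2 : 0 < h < r' by rewrite h0 (lt_le_trans hm) // ge_min lexx orbT.
have := Hr _ h1; have := Hr' _ h2.
rewrite [p + h *: delta_mx 0 j + _]addrAC.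
move=> H1 H2; have := mixed_diff_le H1 H2.
rewrite normrM (gtr0_norm (mulr_gt0 h0 h0)) -[leRHS]mulrA [leRHS]mulrC.
by rewrite ler_pM2l // mulr_gt0.
Qed.

End StrictDifferentiability.

Local Open Scope complex_scope.
Local Notation normc := ComplexField.Normc.normc.

(** * Real-valued modulus and complex differentiability *)

Section ComplexNorm.
Variable R : realType.
Implicit Types (z w : R[i]).

Lemma cReD z w : complex.Re (z + w) = complex.Re z + complex.Re w.
Proof. by case: z w => [? ?] [? ?]. Qed.
Lemma cImD z w : complex.Im (z + w) = complex.Im z + complex.Im w.
Proof. by case: z w => [? ?] [? ?]. Qed.
Lemma cReN z : complex.Re (- z) = - complex.Re z.
Proof. by case: z. Qed.
Lemma cImN z : complex.Im (- z) = - complex.Im z.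
Proof. by case: z. Qed.
Lemma cReM z w : complex.Re (z * w) =
  complex.Re z * complex.Re w - complex.Im z * complex.Im w.
Proof. by case: z w => [? ?] [? ?]. Qed.
Lemma cImM z w : complex.Im (z * w) =
  complex.Re z * complex.Im w + complex.Im z * complex.Re w.
Proof. by case: z w => [? ?] [? ?]. Qed.
Lemma cReV z : complex.Re z^-1 =
  complex.Re z * (complex.Re z * complex.Re z + complex.Im z * complex.Im z)^-1.
Proof. by case: z => [? ?]; rewrite /= !expr2. Qed.
Lemma cImV z : complex.Im z^-1 =
  - (complex.Im z * (complex.Re z * complex.Re z + complex.Im z * complex.Im z)^-1).
Proof. by case: z => [? ?]; rewrite /= !expr2. Qed.
Lemma cReJ z : complex.Re z^*%C = complex.Re z. Proof. by case: z. Qed.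
Lemma cImJ z : complex.Im z^*%C = - complex.Im z. Proof. by case: z. Qed.

Lemma eq_ReIm z w : complex.Re z = complex.Re w -> complex.Im z = complex.Im w ->
  z = w.
Proof. by case: z w => [? ?] [? ?] /= -> ->. Qed.

Lemma sqr_ReIm_neq0 z : z != 0 ->
  complex.Re z * complex.Re z + complex.Im z * complex.Im z != 0.
Proof.
case: z => a b /=; apply: contra; rewrite -!expr2 paddr_eq0 ?sqr_ge0 //.
by rewrite !sqrf_eq0 eq_complex.
Qed.

Lemma normc_ge0 z : 0 <= normc z.
Proof. by case: z => a b; exact: sqrtr_ge0. Qed.

Lemma normc_le_ReIm z : normc z <= `|complex.Re z| + `|complex.Im z|.
Proof.
have -> : z = (complex.Re z)%:C + Complex 0 (complex.Im z).
  by case: z => a b; simpc.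
apply: le_trans (le_normcD _ _) _.
by rewrite /= !expr0n /= addr0 add0r !sqrtr_sqr addr0 add0r.
Qed.

Lemma Re_le_normc z : `|complex.Re z| <= normc z.
Proof. by case: z => a b; rewrite -sqrtr_sqr ler_wsqrtr // lerDl sqr_ge0. Qed.

Lemma Im_le_normc z : `|complex.Im z| <= normc z.
Proof. by case: z => a b; rewrite -sqrtr_sqr ler_wsqrtr // lerDr sqr_ge0. Qed.

Lemma normc_real (h : R) : normc h%:C = `|h|.
Proof. by rewrite /= expr0n addr0 sqrtr_sqr. Qed.

Lemma ler_normcB z w : normc (z - w) <= normc z + normc w.
Proof. by apply: le_trans (le_normcD _ _) _; rewrite normcN. Qed.

Lemma normc_distC z w : normc (z - w) = normc (w - z).
Proof. by rewrite -normcN opprB. Qed.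

Lemma normc_le0_eq0 z : normc z <= 0 -> z = 0.
Proof.
move=> z0; apply: ComplexField.Normc.eq0_normc; apply/eqP.
by rewrite eq_le z0 normc_ge0.
Qed.

Lemma normc_conj z : normc z^*%C = normc z.
Proof. by case: z => a b; rewrite /= sqrrN. Qed.

(** The norm of [Cplx R] takes values in R[i], where a positive radius is a complex number with zero
    imaginary part. All later estimates use real radii instead. *)
Lemma Cplx_nbhs_normc (z : Cplx R) (P : set (Cplx R)) :
  nbhs z P <-> exists2 r : R, 0 < r & forall w, normc (z - w) < r -> P w.
Proof.
split=> [/nbhs_ballP [e /= e0 eP]|[r r0 rP]].
  have [er ei] : 0 < complex.Re e /\ complex.Im e = 0.
    by move: e0; rewrite ltcE /= => /andP[/eqP -> ->].
  exists (complex.Re e) => // w zw; apply: eP.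
  rewrite -ball_normE /= /ball_ /= /Num.norm /=.
  by case: e er ei zw {e0} => [a b] /= a0 -> ?; rewrite ltcR.
apply/nbhs_ballP; exists r%:C; first by rewrite /= ltcR.
move=> w; rewrite -ball_normE /= => zw; apply: rP.
by rewrite -ltcR.
Qed.

Let slope_rem (a b L : R[i]) : a != 0 -> b - L * a = - (a * (L - a^-1 * b)).
Proof. by move=> a0; field. Qed.

Let slope_rem' (a b L : R[i]) : a != 0 -> L - a^-1 * b = - (a^-1 * (b - L * a)).
Proof. by move=> a0; field. Qed.

(** A division-free form: w = z is allowed, and chain rules become sums of estimates. *)
Lemma Cplx_derive_epsP (g : Cplx R -> Cplx R) (z l : Cplx R) :
  is_derive z 1 g l <->
  forall e : R, 0 < e -> exists2 r : R, 0 < r & forall w, normc (w - z) < r ->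
    normc (g w - g z - l * (w - z)) <= e * normc (w - z).
Proof.
split.
  move=> [dg <-] e e0.
  have /cvgrPdist_le /(_ e%:C) := dg.
  rewrite ltcR => /(_ e0); rewrite near_withinE => /Cplx_nbhs_normc [r r0 Hr].
  exists r => // w wr.
  have [->|wz] := eqVneq w z; first by rewrite !subrr mulr0 subr0 /= expr0n /=
    addr0 sqrtr0 mulr0.
  have wz0 : w - z != 0 by rewrite subr_eq0.
  have := Hr (w - z); rewrite sub0r normcN => /(_ wr wz0).
  have -> : (g \o shift z) ((w - z) *: 1) = g w.
    by rewrite /= [_ *: _]mulr1 subrK.
  rewrite -['D_1 g z]/(lim _) /=.
  set L := lim _; rewrite -[`|_|]/((normc _)%:C) lecR => H.
  have -> : g w - g z - L * (w - z) = - ((w - z) * (L - (w - z)^-1 * (g w - g z))).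
    exact: slope_rem.
  rewrite normcN ComplexField.Normc.normcM mulrC.
  by rewrite ler_wpM2r ?normc_ge0.
move=> H.
suff D : (fun h : Cplx R => h^-1 *: ((g \o shift z) (h *: 1) - g z)) @ 0^' --> l.
  by split; [apply/cvg_ex; exists l|exact: cvg_lim].
apply/cvgrPdist_le => e e0.
have [er ei] : 0 < complex.Re e /\ complex.Im e = 0.
  by move: e0; rewrite ltcE /= => /andP[/eqP -> ->].
have [r r0 Hr] := H _ er.
rewrite near_withinE; apply/Cplx_nbhs_normc; exists r => // h.
rewrite sub0r normcN => hr h0.
have -> : (g \o shift z) (h *: 1) = g (h + z) by rewrite /= [_ *: _]mulr1.
have := Hr (h + z); rewrite addrK => /(_ hr) {}H.
have -> : l - h^-1 *: (g (h + z) - g z) = - (h^-1 * (g (h + z) - g z - l * h)).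
  exact: slope_rem'.
have -> : e = (complex.Re e)%:C by case: e ei {e0 er Hr H} => a b /= ->.
rewrite -[`|_|]/((normc _)%:C) lecR normcN ComplexField.Normc.normcM
  ComplexField.Normc.normcV mulrC ler_pdivrMr //.
rewrite lt_def normc_ge0 andbT; apply/eqP => /ComplexField.Normc.eq0_normc h00.
by move: h0; rewrite h00 eqxx.
Qed.

End ComplexNorm.

(** * Calculus of complex-valued functions on four-space *)

Section ComplexCalculus.
Variable R : realType.
Implicit Types (f g : 'rV[R]_4 -> R[i]) (B : set 'rV[R]_4) (p X : 'rV[R]_4).
Implicit Types (z w : R[i]).

Lemma smooth_cplx_ext B f g : open B -> (forall p, B p -> f p = g p) ->
  smooth_cplx_on B f -> smooth_cplx_on B g.
Proof.
move=> oB fg [sr si]; split.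
  by apply: (smooth_on_ext oB) sr => p /fg ->.
by apply: (smooth_on_ext oB) si => p /fg ->.
Qed.

Lemma smooth_cplx_sub B B' f : B' `<=` B -> smooth_cplx_on B f ->
  smooth_cplx_on B' f.
Proof. by move=> BB' [sr si]; split; [exact: smooth_on_sub sr|exact: smooth_on_sub si]. Qed.

Lemma smooth_cplx_cst B z : open B -> smooth_cplx_on B (fun=> z).
Proof. by move=> oB; split; exact: smooth_on_cst. Qed.

Lemma smooth_cplxD B f g : open B -> smooth_cplx_on B f -> smooth_cplx_on B g ->
  smooth_cplx_on B (fun p => f p + g p).
Proof.
move=> oB [fr fi] [gr gi]; split.
  by apply: (smooth_on_ext oB) (smooth_onD oB fr gr) => p _; rewrite cReD.
by apply: (smooth_on_ext oB) (smooth_onD oB fi gi) => p _; rewrite cImD.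
Qed.

Lemma smooth_cplxN B f : open B -> smooth_cplx_on B f ->
  smooth_cplx_on B (fun p => - f p).
Proof.
move=> oB [fr fi]; split.
  by apply: (smooth_on_ext oB) (smooth_onN oB fr) => p _; rewrite cReN.
by apply: (smooth_on_ext oB) (smooth_onN oB fi) => p _; rewrite cImN.
Qed.

Lemma smooth_cplxJ B f : open B -> smooth_cplx_on B f ->
  smooth_cplx_on B (fun p => (f p)^*).
Proof.
move=> oB [fr fi]; split.
  by apply: (smooth_on_ext oB) fr => p _; rewrite cReJ.
by apply: (smooth_on_ext oB) (smooth_onN oB fi) => p _; rewrite cImJ.
Qed.

Lemma smooth_cplxM B f g : open B -> smooth_cplx_on B f -> smooth_cplx_on B g ->
  smooth_cplx_on B (fun p => f p * g p).
Proof.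
move=> oB [fr fi] [gr gi]; split.
  apply: (smooth_on_ext oB)
    (smooth_onB oB (smooth_onM oB fr gr) (smooth_onM oB fi gi)) => p _.
  by rewrite cReM.
apply: (smooth_on_ext oB)
    (smooth_onD oB (smooth_onM oB fr gi) (smooth_onM oB fi gr)) => p _.
by rewrite cImM.
Qed.

Lemma smooth_cplxV B f : open B -> (forall p, B p -> f p != 0) ->
  smooth_cplx_on B f -> smooth_cplx_on B (fun p => (f p)^-1).
Proof.
move=> oB f0 [fr fi].
have sn := smooth_onV oB (fun p Bp => sqr_ReIm_neq0 (f0 p Bp))
  (smooth_onD oB (smooth_onM oB fr fr) (smooth_onM oB fi fi)).
split.
  by apply: (smooth_on_ext oB) (smooth_onM oB fr sn) => p _; rewrite cReV.
apply: (smooth_on_ext oB) (smooth_onN oB (smooth_onM oB fi sn)) => p _.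
by rewrite cImV.
Qed.

Lemma smooth_cpartial B f i : smooth_cplx_on B f ->
  smooth_cplx_on B (cpartial i f).
Proof. by move=> [fr fi]; split; [exact: smooth_on_partial fr|exact: smooth_on_partial fi]. Qed.

Lemma cderive_ext B f g p X : open B -> B p -> (forall p, B p -> f p = g p) ->
  cderive X f p = cderive X g p.
Proof.
move=> oB Bp fg; have nB := open_near oB Bp.
by congr Complex; apply: near_eq_derive; near=> q; rewrite fg //; near: q.
Unshelve. all: by end_near. Qed.

Lemma cderiveJ f p X B : open B -> smooth_cplx_on B f -> B p ->
  cderive X (fun q => (f q)^*) p = (cderive X f p)^*.
Proof.
move=> oB [fr fi] Bp; apply: eq_ReIm => /=.
  by congr ('D_X _ p); apply/funext => q; rewrite cReJ.
rewrite -(@deriveN _ _ _ _ p X) //; last exact: smooth_derivable fi Bp.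
by congr ('D_X _ p); apply/funext => q; rewrite cImJ.
Qed.

Lemma cderive_cst z p X : cderive X (fun=> z) p = 0.
Proof. by rewrite /cderive !derive_cst. Qed.

Section AtPoint.
Variables (B : set 'rV[R]_4) (f g : 'rV[R]_4 -> R[i]) (p X : 'rV[R]_4).
Hypotheses (oB : open B) (sf : smooth_cplx_on B f) (sg : smooth_cplx_on B g).
Hypothesis Bp : B p.

Let dfr := @smooth_derivable _ _ _ p X oB sf.1 Bp.
Let dfi := @smooth_derivable _ _ _ p X oB sf.2 Bp.
Let dgr := @smooth_derivable _ _ _ p X oB sg.1 Bp.
Let dgi := @smooth_derivable _ _ _ p X oB sg.2 Bp.

Lemma cderiveD : cderive X (fun q => f q + g q) p = cderive X f p + cderive X g p.
Proof.
apply: eq_ReIm; rewrite ?cReD ?cImD /=.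
  rewrite -(deriveD dfr dgr); congr ('D_X _ p).
  by apply/funext => q; rewrite cReD.
rewrite -(deriveD dfi dgi); congr ('D_X _ p).
by apply/funext => q; rewrite cImD.
Qed.

Lemma cderiveM : cderive X (fun q => f q * g q) p =
  cderive X f p * g p + f p * cderive X g p.
Proof.
apply: eq_ReIm; rewrite ?(cReD, cImD, cReM, cImM) /=.
  transitivity ('D_X ((fun q => complex.Re (f q)) * (fun q => complex.Re (g q)) -
    (fun q => complex.Im (f q)) * (fun q => complex.Im (g q))) p).
    by congr ('D_X _ p); apply/funext => q; rewrite cReM.
  rewrite (deriveB (derivableM dfr dgr) (derivableM dfi dgi)).
  rewrite (deriveM dfr dgr) (deriveM dfi dgi) /GRing.scale /=.
  move: ('D_X _ p) ('D_X _ p) ('D_X _ p) ('D_X _ p) => a b c d; ring.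
transitivity ('D_X ((fun q => complex.Re (f q)) * (fun q => complex.Im (g q)) +
    (fun q => complex.Im (f q)) * (fun q => complex.Re (g q))) p).
  by congr ('D_X _ p); apply/funext => q; rewrite cImM.
rewrite (deriveD (derivableM dfr dgi) (derivableM dfi dgr)).
rewrite (deriveM dfr dgi) (deriveM dfi dgr) /GRing.scale /=.
move: ('D_X _ p) ('D_X _ p) ('D_X _ p) ('D_X _ p) => a b c d; ring.
Qed.

Lemma cderiveE : cderive X f p = \sum_i (X 0 i)%:C * cpartial i f p.
Proof.
apply: eq_ReIm; rewrite /cderive /=.
  rewrite (smooth_derive X oB sf.1 Bp).
  rewrite (big_morph (@complex.Re R) (@cReD R) (erefl _)).
  by apply: eq_bigr => i _; rewrite cReM /= mul0r subr0.
rewrite (smooth_derive X oB sf.2 Bp).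
rewrite (big_morph (@complex.Im R) (@cImD R) (erefl _)).
by apply: eq_bigr => i _; rewrite cImM /= mul0r addr0.
Qed.

Lemma cpartialC i j : cpartial i (cpartial j f) p = cpartial j (cpartial i f) p.
Proof.
by apply: eq_ReIm; rewrite /=; [exact: partialC sf.1 Bp|exact: partialC sf.2 Bp].
Qed.

End AtPoint.

Lemma smooth_cplx_strict B f p : open B -> smooth_cplx_on B f -> B p ->
  forall e : R, 0 < e -> exists2 r : R, 0 < r & forall x y,
    `|p - x| < r -> `|p - y| < r ->
    normc (f y - f x - cderive (y - x) f p) <= e * `|y - x|.
Proof.
move=> oB [fr fi] Bp e e0; have e2 : 0 < e / 2%:R by rewrite divr_gt0.
have [r r0 Hr] := smooth_strict oB fr Bp e2.
have [s s0 Hs] := smooth_strict oB fi Bp e2.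
exists (Num.min r s); first by rewrite lt_min r0.
move=> x y; rewrite !lt_min => /andP[xr xs] /andP[yr ys].
apply: le_trans (normc_le_ReIm _) _.
rewrite !(cReD, cImD, cReN, cImN) /= (smooth_derive _ oB fr Bp) (smooth_derive _ oB fi Bp).
apply: le_trans (lerD (Hr _ _ xr yr) (Hs _ _ xs ys)) _.
by rewrite -mulrDl -splitr.
Qed.

Lemma cderive_scale f p X (h : R) B : open B -> smooth_cplx_on B f -> B p ->
  cderive (h *: X) f p = h%:C * cderive X f p.
Proof.
move=> oB sf Bp; rewrite !(cderiveE _ oB sf Bp) mulr_sumr; apply: eq_bigr => i _.
by rewrite !mxE mulrA -rmorphM.
Qed.

Lemma cderive_add f p X Y B : open B -> smooth_cplx_on B f -> B p ->
  cderive (X + Y) f p = cderive X f p + cderive Y f p.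
Proof.
move=> oB sf Bp; rewrite !(cderiveE _ oB sf Bp) -big_split /=; apply: eq_bigr => i _.
by rewrite !mxE -mulrDl -rmorphD.
Qed.

Lemma cderive_bounded f p B : open B -> smooth_cplx_on B f -> B p ->
  exists2 M : R, 0 < M & forall X, normc (cderive X f p) <= M * `|X|.
Proof.
move=> oB sf Bp.
exists (1 + \sum_i normc (cpartial i f p)).
  by rewrite ltr_pwDl // sumr_ge0 // => i _; exact: normc_ge0.
move=> X; rewrite (cderiveE _ oB sf Bp).
apply: le_trans (_ : \sum_i normc ((X 0 i)%:C * cpartial i f p) <= _).
  elim/big_ind2 : _ => [|a b c d ab cd|//].
    by rewrite /= expr0n addr0 sqrtr0.
  by apply: le_trans (le_normcD _ _) _; exact: lerD.
apply: le_trans (_ : \sum_i (normc (cpartial i f p) * `|X|) <= _).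
  apply: ler_sum => i _; rewrite ComplexField.Normc.normcM normc_real mulrC.
  by rewrite ler_wpM2l ?normc_ge0 //; exact: rV4_coord_le.
by rewrite -mulr_suml ler_wpM2r // lerDr.
Qed.

Lemma cderive_line f p X B : open B -> smooth_cplx_on B f -> B p ->
  forall e : R, 0 < e -> exists2 r : R, 0 < r & forall h : R, `|h| < r ->
    normc (f (p + h *: X) - f p - h%:C * cderive X f p) <= e * `|h|.
Proof.
move=> oB sf Bp e e0.
have X1 : 0 < 1 + `|X| by rewrite ltr_pwDl.
have [s s0 Hs] := smooth_cplx_strict oB sf Bp (divr_gt0 e0 X1).
exists (s / (1 + `|X|)); first exact: divr_gt0.
move=> h hr.
have hX : `|h *: X| < s.
  rewrite normrZ; apply: le_lt_trans (_ : `|h| * (1 + `|X|) < s).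
    by rewrite ler_wpM2l ?lerDr.
  by rewrite -ltr_pdivlMr.
have := Hs p (p + h *: X).
rewrite subrr normr0 opprD addrA subrr sub0r normrN => /(_ s0 hX).
rewrite [p + _ - p]addrAC subrr add0r (cderive_scale _ _ oB sf Bp) => H1.
apply: le_trans H1 _; rewrite normrZ mulrCA [leRHS]mulrC ler_wpM2l //.
by rewrite -mulrA ler_piMr ?(ltW e0) // mulrC ler_pdivrMr // mul1r lerDr.
Qed.

(** Uniqueness of the first-order term: subtract the expansion [cderive_line] of f and divide by a
    small h. *)
Lemma cderive_lim f p X l B : open B -> B p -> smooth_cplx_on B f ->
  (forall e : R, 0 < e -> exists2 r : R, 0 < r & forall h : R, `|h| < r ->
    normc (f (p + h *: X) - f p - h%:C * l) <= e * `|h|) ->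
  cderive X f p = l.
Proof.
move=> oB Bp sf H; apply/eqP; rewrite -subr_eq0; apply/eqP/normc_le0_eq0.
apply/ler_addgt0Pr => e e0; rewrite add0r.
have e2 : 0 < e / 2%:R by rewrite divr_gt0.
have [r r0 Hr] := H _ e2.
have [s s0 Hs] := cderive_line X oB sf Bp e2.
have m0 : 0 < Num.min r s by rewrite lt_min r0.
have [h h0 hm] : exists2 h, 0 < h & h < Num.min r s.
  exists (Num.min r s / 2%:R); first by rewrite divr_gt0.
  by rewrite ltr_pdivrMr // ltr_pMr // ltr1n.
have hr : `|h| < r by rewrite gtr0_norm // (lt_le_trans hm) // ge_min lexx.
have hs : `|h| < s by rewrite gtr0_norm // (lt_le_trans hm) // ge_min lexx orbT.
have H1 := Hs h hs; have H2 := Hr h hr.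
have : normc (h%:C * (cderive X f p - l)) <= e * h.
  have -> : h%:C * (cderive X f p - l) =
   (f (p + h *: X) - f p - h%:C * l) - (f (p + h *: X) - f p - h%:C * cderive X f p).
    by move: (f _) (f _) (cderive _ _ _) => u v w; ring.
  apply: le_trans (ler_normcB _ _) _; apply: le_trans (lerD H2 H1) _.
  by rewrite -mulrDl -splitr gtr0_norm.
rewrite ComplexField.Normc.normcM normc_real gtr0_norm // mulrC.
by rewrite ler_pM2r.
Qed.

(** Here g is only complex differentiable at one point, so smoothness of the composite is a
    hypothesis; for a transition map it holds because the other chart is itself smooth along
    [phi]. *)
Lemma cderive_comp (g : Cplx R -> Cplx R) l f p X B :
  open B -> B p -> smooth_cplx_on B f -> smooth_cplx_on B (g \o f) ->
  is_derive (f p : Cplx R) 1 g l -> cderive X (g \o f) p = l * cderive X f p.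
Proof.
move=> oB Bp sf sgf /Cplx_derive_epsP dg; apply: (cderive_lim oB) => // e e0.
have e2 : 0 < e / 2%:R by rewrite divr_gt0.
set a := cderive X f p.
have a1 : 0 < 1 + normc a by rewrite ltr_pwDl // normc_ge0.
have l1 : 0 < 1 + normc l by rewrite ltr_pwDl // normc_ge0.
have [s s0 Hs] := dg _ (divr_gt0 e2 a1).
have [r r0 Hr] := cderive_line X oB sf Bp (divr_gt0 e2 l1).
(* The expansion with error 1 only serves to bound the increment of f by |h| (1 + |a|), which the
   outer estimate for g consumes. *)
have [r' r'0 Hr'] := cderive_line X oB sf Bp ltr01.
exists (Num.min (Num.min r r') (s / (1 + normc a))).
  by rewrite !lt_min r0 r'0 divr_gt0.
move=> h; rewrite !lt_min -andbA => /and3P[/Hr hr /Hr' hr' hs].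
move: hr hr'; rewrite -/a; set D := f (p + h *: X) - f p => hr hr'.
have Da : normc D <= `|h| * (1 + normc a).
  have -> : D = (D - h%:C * a) + h%:C * a by rewrite subrK.
  apply: le_trans (le_normcD _ _) _; rewrite mulrDr lerD //.
    by move: hr'; rewrite mul1r mulr1.
  by rewrite ComplexField.Normc.normcM normc_real.
have := Hs (f (p + h *: X)); rewrite -/D => /(_ _).
have Ds : normc D < s by apply: le_lt_trans Da _; rewrite -ltr_pdivlMr.
move=> /(_ Ds) H.
have -> : (g \o f) (p + h *: X) - (g \o f) p - h%:C * (l * a) =
    (g (f (p + h *: X)) - g (f p) - l * D) + l * (D - h%:C * a).
  by rewrite /=; move: (g _) (g _) => u v; ring.
apply: le_trans (le_normcD _ _) _.
rewrite [e]splitr mulrDl; apply: lerD.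
  apply: le_trans H _; rewrite mulrAC ler_pdivrMr // -[leRHS]mulrA.
  by rewrite ler_wpM2l // ltW.
rewrite ComplexField.Normc.normcM.
apply: le_trans (ler_wpM2l (normc_ge0 _) hr) _.
rewrite mulrA ler_wpM2r // mulrC mulrAC ler_pdivrMr //.
by rewrite ler_wpM2l ?(ltW e2) // lerDr.
Qed.

End ComplexCalculus.

(** * The equations of a harmonic morphism in null coordinates *)

Section ComplexDirections.
Variable R : realType.
Implicit Types (f g : 'rV[R]_4 -> R[i]) (B : set 'rV[R]_4) (p : 'rV[R]_4).
Implicit Types (a b : 'I_4 -> R[i]).

(** Derivative along a complexified tangent vector. The coefficients are constant, so these
    operators commute. *)
Definition cdir a f p : R[i] := \sum_k a k * cpartial k f p.

Lemma smooth_cdir B a f : open B -> smooth_cplx_on B f ->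
  smooth_cplx_on B (cdir a f).
Proof.
move=> oB sf.
have H (s : seq 'I_4) : smooth_cplx_on B (fun p => \sum_(k <- s) a k * cpartial k f p).
  elim: s => [|k s IH].
    apply: (smooth_cplx_ext oB) (smooth_cplx_cst 0 oB) => p _.
    by rewrite big_nil.
  have sk := smooth_cplxM oB (smooth_cplx_cst (a k) oB) (smooth_cpartial k sf).
  apply: (smooth_cplx_ext oB) (smooth_cplxD oB sk IH) => p _.
  by rewrite big_cons.
exact: H.
Qed.

Lemma cdir_ext B a f g p : open B -> B p -> (forall p, B p -> f p = g p) ->
  cdir a f p = cdir a g p.
Proof.
move=> oB Bp fg; apply: eq_bigr => k _; congr (_ * _).
exact: cderive_ext oB Bp fg.
Qed.

Lemma cdir_cst a z p : cdir a (fun=> z) p = 0.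
Proof. by rewrite /cdir big1 // => k _; rewrite /cpartial cderive_cst mulr0. Qed.

Lemma cdir0 B a f p : open B -> B p -> (forall p, B p -> f p = 0) ->
  cdir a f p = 0.
Proof. by move=> oB Bp /(cdir_ext a oB Bp) ->; rewrite cdir_cst. Qed.

Lemma cdirD B a f g p : open B -> smooth_cplx_on B f -> smooth_cplx_on B g ->
  B p -> cdir a (fun q => f q + g q) p = cdir a f p + cdir a g p.
Proof.
move=> oB sf sg Bp; rewrite -big_split; apply: eq_bigr => k _ /=.
by rewrite -mulrDr /cpartial (cderiveD _ oB sf sg Bp).
Qed.

Lemma cdirM B a f g p : open B -> smooth_cplx_on B f -> smooth_cplx_on B g ->
  B p -> cdir a (fun q => f q * g q) p = cdir a f p * g p + f p * cdir a g p.
Proof.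
move=> oB sf sg Bp; rewrite /cdir mulr_sumr mulr_suml -big_split.
apply: eq_bigr => k _ /=.
rewrite /cpartial (cderiveM _ oB sf sg Bp); ring.
Qed.

Lemma cpartial_cdir B b f k p : open B -> smooth_cplx_on B f -> B p ->
  cpartial k (cdir b f) p = cdir b (cpartial k f) p.
Proof.
move=> oB sf Bp.
have H (s : seq 'I_4) :
  smooth_cplx_on B (fun p => \sum_(k <- s) b k * cpartial k f p) /\
  cpartial k (fun p => \sum_(l <- s) b l * cpartial l f p) p =
  \sum_(l <- s) b l * cpartial k (cpartial l f) p.
  elim: s => [|l s [IH1 IH2]].
    split.
      apply: (smooth_cplx_ext oB) (smooth_cplx_cst 0 oB) => q _.
      by rewrite big_nil.
    rewrite big_nil -[RHS](cderive_cst 0 p (delta_mx 0 k)).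
    by apply: (cderive_ext _ oB Bp) => q _; rewrite big_nil.
  have sl := smooth_cpartial l sf.
  have sk := smooth_cplxM oB (smooth_cplx_cst (b l) oB) sl.
  split.
    apply: (smooth_cplx_ext oB) (smooth_cplxD oB sk IH1) => q _.
    by rewrite big_cons.
  rewrite big_cons -IH2.
  have e1 := cderiveM (delta_mx 0 k) oB (smooth_cplx_cst (b l) oB) sl Bp.
  rewrite cderive_cst mul0r add0r in e1.
  rewrite -[X in X + _]e1 -(cderiveD _ oB sk IH1 Bp).
  by apply: (cderive_ext _ oB Bp) => q _; rewrite big_cons.
have [_ E] := H (index_enum 'I_4).
by rewrite E; apply: eq_bigr => l _; rewrite (cpartialC oB sf Bp).
Qed.

Lemma cdirC B a b f p : open B -> smooth_cplx_on B f -> B p ->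
  cdir a (cdir b f) p = cdir b (cdir a f) p.
Proof.
move=> oB sf Bp; rewrite {1 3}/cdir.
under eq_bigr => k _ do rewrite (cpartial_cdir b k oB sf Bp) mulr_sumr.
under [RHS]eq_bigr => k _ do rewrite (cpartial_cdir a k oB sf Bp) mulr_sumr.
rewrite exchange_big; apply: eq_bigr => k _; apply: eq_bigr => l _.
by rewrite (cpartialC oB sf Bp) mulrCA.
Qed.

End ComplexDirections.

(* For A = d_t + d_1, B = d_2 - i d_3, C = d_2 + i d_3, D = d_t - d_1 the
   harmonic morphism equations are Af Df = Bf Cf and ADf = CBf; the ratios are
   u = - Cf / Df and v = - Bf / Df. *)
Section NullRatios.
Variable R : realType.
Variables (f : 'rV[R]_4 -> R[i]) (B : set 'rV[R]_4) (oB : open B).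
Variable (sf : smooth_cplx_on B f).
Variables (vA vB vC vD : 'I_4 -> R[i]) (u v : 'rV[R]_4 -> R[i]).
Let a := cdir vA f. Let b := cdir vB f. Let c := cdir vC f. Let d := cdir vD f.
Hypothesis null : forall p, B p -> a p * d p = b p * c p.
Hypothesis wave : forall p, B p -> cdir vA d p = cdir vC b p.
Hypothesis d0 : forall p, B p -> d p != 0.
Hypothesis su : smooth_cplx_on B u.
Hypothesis cE : forall p, B p -> c p = - (u p * d p).
Hypothesis bE : forall p, B p -> b p = - (v p * d p).

Let sa : smooth_cplx_on B a := smooth_cdir vA oB sf.
Let sb : smooth_cplx_on B b := smooth_cdir vB oB sf.
Let sc : smooth_cplx_on B c := smooth_cdir vC oB sf.
Let sd : smooth_cplx_on B d := smooth_cdir vD oB sf.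

Let cdir_c (X : 'I_4 -> R[i]) p : B p ->
  cdir X c p = - (cdir X u p * d p + u p * cdir X d p).
Proof.
move=> Bp; rewrite -(cdirM _ oB su sd Bp) -[LHS]addr0.
rewrite -[X in _ + X](subrr (cdir X (fun q => u q * d q) p)) addrA.
rewrite -(cdirD _ oB sc (smooth_cplxM oB su sd) Bp).
rewrite (cdir0 _ oB Bp) ?sub0r // => q Bq.
by rewrite (cE Bq) addNr.
Qed.

Let cdir_null (X : 'I_4 -> R[i]) p : B p ->
  cdir X a p * d p + a p * cdir X d p = cdir X b p * c p + b p * cdir X c p.
Proof.
move=> Bp; rewrite -(cdirM _ oB sa sd Bp) -(cdirM _ oB sb sc Bp).
exact: cdir_ext oB Bp null.
Qed.

Let aE p : B p -> a p = u p * v p * d p.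
Proof.
move=> Bp; apply: (mulIf (d0 Bp)); rewrite (null Bp) (cE Bp) (bE Bp); ring.
Qed.

Let cdirfC (X Y : 'I_4 -> R[i]) p : B p ->
  cdir X (cdir Y f) p = cdir Y (cdir X f) p.
Proof. by move=> Bp; exact: cdirC oB sf Bp. Qed.

(** Differentiate Af Df = Bf Cf along D. The wave equation turns DAf into BCf, and DBf = BDf. With a
    = uvd, b = - vd, c = - ud all derivatives of d cancel, and d^2 (Bu + v Du) = 0 remains. *)
Lemma ratio_killB p : B p -> cdir vB u p + v p * cdir vD u p = 0.
Proof.
move=> Bp; apply: (mulIf (d0 Bp)); rewrite mul0r.
apply: (mulIf (d0 Bp)); rewrite mul0r.
have := cdir_null vD Bp.
have -> : cdir vD a p = cdir vB c p.
  by rewrite /a cdirfC // -/d wave // /b cdirfC.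
have -> : cdir vD b p = cdir vB d p by rewrite /b cdirfC.
rewrite (cdir_c vB Bp) (cdir_c vD Bp) (aE Bp) (bE Bp) (cE Bp).
move: (cdir _ _ _) (cdir _ _ _) (cdir _ _ _) (cdir _ _ _) (u p) (v p) (d p).
move=> Bu Bd Dd Du x y z /eqP; rewrite -subr_eq0 => /eqP E.
by apply: oppr_inj; rewrite oppr0 -[RHS]E; ring.
Qed.

(** The same along C: the wave equation turns CBf into ADf, and d^2 (Au + v Cu) = 0 remains. *)
Lemma ratio_killA p : B p -> cdir vA u p + v p * cdir vC u p = 0.
Proof.
move=> Bp; apply: (mulIf (d0 Bp)); rewrite mul0r.
apply: (mulIf (d0 Bp)); rewrite mul0r.
have := cdir_null vC Bp.
have -> : cdir vC a p = cdir vA c p by rewrite /a cdirfC.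
rewrite -wave //.
rewrite (cdir_c vA Bp) (cdir_c vC Bp) (aE Bp) (bE Bp) (cE Bp).
move: (cdir _ _ _) (cdir _ _ _) (cdir _ _ _) (cdir _ _ _) (u p) (v p) (d p).
move=> Bu Bd Dd Du x y z /eqP; rewrite -subr_eq0 => /eqP E.
by apply: oppr_inj; rewrite oppr0 -[RHS]E; ring.
Qed.

End NullRatios.

Section Dichotomy.
Variable R : realType.
Variables (f : 'rV[R]_4 -> R[i]) (B : set 'rV[R]_4) (oB : open B).
Variable (sf : smooth_cplx_on B f).
Variables (vA vB vC vD : 'I_4 -> R[i]) (u v : 'rV[R]_4 -> R[i]).
Let a := cdir vA f. Let b := cdir vB f. Let c := cdir vC f. Let d := cdir vD f.
Hypothesis null : forall p, B p -> a p * d p = b p * c p.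
Hypothesis wave : forall p, B p -> cdir vA d p = cdir vC b p.
Hypothesis d0 : forall p, B p -> d p != 0.
Hypotheses (su : smooth_cplx_on B u) (sv : smooth_cplx_on B v).
Hypothesis cE : forall p, B p -> c p = - (u p * d p).
Hypothesis bE : forall p, B p -> b p = - (v p * d p).

Let uB p : B p -> cdir vB u p + v p * cdir vD u p = 0.
Proof. exact: (ratio_killB oB sf null wave d0 su cE bE). Qed.

Let uA p : B p -> cdir vA u p + v p * cdir vC u p = 0.
Proof. exact: (ratio_killA oB sf null wave d0 su cE bE). Qed.

Let null' p : B p -> a p * d p = c p * b p.
Proof. by move=> Bp; rewrite null // mulrC. Qed.

Let wave' p : B p -> cdir vA d p = cdir vB c p.
Proof. by move=> Bp; rewrite wave // /b /c (cdirC _ _ oB sf Bp). Qed.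

(** The two equations are symmetric under exchanging B with C and u with v. The directions were left
    abstract so that the lemmas on u can be applied to v. *)
Let vC' p : B p -> cdir vC v p + u p * cdir vD v p = 0.
Proof. exact: (ratio_killB oB sf null' wave' d0 sv bE cE). Qed.

Let vA' p : B p -> cdir vA v p + u p * cdir vB v p = 0.
Proof. exact: (ratio_killA oB sf null' wave' d0 sv bE cE). Qed.

(* The two fields B + vD and A + vC annihilate u; so does their commutator,
   which is a multiple of C + uD by the factor (B + vD)v. *)
Lemma shear_product p : B p ->
  (cdir vC u p + u p * cdir vD u p) * (cdir vB v p + v p * cdir vD v p) = 0.
Proof.
move=> Bp.
have sX X := smooth_cdir X oB su.
have Q X Y Z : (forall q, B q -> cdir Y u q + v q * cdir Z u q = 0) ->
    cdir X (cdir Y u) p + (cdir X v p * cdir Z u p + v p * cdir X (cdir Z u) p) = 0.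
  move=> H; rewrite -(cdirM _ oB sv (sX _) Bp).
  rewrite -(cdirD _ oB (sX _) (smooth_cplxM oB sv (sX _)) Bp).
  exact: cdir0 oB Bp H.
(* These are the four derivatives in (A + vC)(B + vD)u - (B + vD)(A + vC)u. The second derivatives
   of u cancel, leaving (Av + v Cv) Du - (Bv + v Dv) Cu; the equations Av = - u Bv and Cv = - u Dv
   make this minus the claimed product. *)
have E1 := Q vA _ _ uB; have E2 := Q vC _ _ uB.
have E3 := Q vB _ _ uA; have E4 := Q vD _ _ uA.
have C X Y : cdir X (cdir Y u) p = cdir Y (cdir X u) p by exact: cdirC oB su Bp.
move: E1 E2 E3 E4 (vC' Bp) (vA' Bp).
rewrite (C vB vA) (C vB vC) (C vD vA) (C vD vC).
move: (cdir vA (cdir vB u) p) (cdir vA (cdir vD u) p) (cdir vC (cdir vB u) p).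
move: (cdir vC (cdir vD u) p) => CD AB AD CB.
move: (u p) (v p) (cdir vA v p) (cdir vB v p) (cdir vC v p) (cdir vD v p).
move: (cdir vC u p) (cdir vD u p) => Cu Du x y Av Bv Cv Dv E1 E2 E3 E4 E5 E6.
have Av_ : Av = - (x * Bv) by apply/eqP; rewrite -subr_eq0 opprK E6.
have Cv_ : Cv = - (x * Dv) by apply/eqP; rewrite -subr_eq0 opprK E5.
transitivity (- ((AB + (Av * Du + y * AD)) + y * (CB + (Cv * Du + y * CD)) -
  (AB + (Bv * Cu + y * CB)) - y * (AD + (Dv * Cu + y * CD)))).
  by rewrite Av_ Cv_; ring.
by rewrite E1 E2 E3 E4; ring.
Qed.

(** The fields A + vC, B + vD and C + uD span the kernel of df. The first two always kill u; once
    the third does, du is a multiple of df, and the factor is read off along D. *)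
Lemma dir_prop p : B p -> cdir vC u p + u p * cdir vD u p = 0 ->
  let r := cdir vD u p / d p in
  [/\ cdir vA u p = r * a p, cdir vB u p = r * b p,
      cdir vC u p = r * c p & cdir vD u p = r * d p].
Proof.
move=> Bp P r; have dp := d0 Bp.
have rd : r * d p = cdir vD u p by rewrite /r divfK.
have Cu : cdir vC u p = r * c p.
  by rewrite cE // mulrN mulrCA rd; apply/eqP; rewrite -subr_eq0 opprK P.
have Bu : cdir vB u p = r * b p.
  by rewrite bE // mulrN mulrCA rd; apply/eqP; rewrite -subr_eq0 opprK uB.
split=> //.
have -> : a p = u p * v p * d p.
  by apply: (mulIf dp); rewrite null // (cE Bp) (bE Bp); ring.
have /eqP := uA Bp; rewrite Cu (cE Bp) -subr_eq0 => /eqP E.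
apply/eqP; rewrite -subr_eq0 -[X in _ == X]E; apply/eqP; ring.
Qed.

End Dichotomy.

Local Notation i1 := (lift ord0 (0 : 'I_3)).
Local Notation i2 := (lift ord0 (1 : 'I_3)).
Local Notation i3 := (lift ord0 (2%:R : 'I_3)).

(** * Null directions and stereographic projection *)

Section Coordinates.
Variable R : realType.

Lemma sum4 (V : nmodType) (F : 'I_4 -> V) :
  \sum_i F i = F 0 + F i1 + F i2 + F i3.
Proof.
rewrite !big_ord_recl big_ord0 addr0 !addrA.
by congr (_ + F _ + F _ + F _); apply: val_inj.
Qed.

Lemma sum3 (V : nmodType) (F : 'I_3 -> V) :
  \sum_i F i = F 0 + F 1 + F 2%:R.
Proof.
rewrite !big_ord_recl big_ord0 addr0 !addrA.
by congr (F _ + F _ + F _); apply: val_inj.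
Qed.

Lemma row4_eq (X Y : 'rV[R]_4) : X 0 0 = Y 0 0 -> X 0 i1 = Y 0 i1 ->
  X 0 i2 = Y 0 i2 -> X 0 i3 = Y 0 i3 -> X = Y.
Proof.
move=> e0 e1 e2 e3; apply/rowP => j.
have : j \in [:: (0 : 'I_4); i1; i2; i3] by case: j => -[|[|[|[|]]]].
by rewrite !inE => /or4P[] /eqP ->.
Qed.

Lemma row4E (t x y z : R) : (row4 t x y z 0 0 = t) * (row4 t x y z 0 i1 = x) *
  (row4 t x y z 0 i2 = y) * (row4 t x y z 0 i3 = z).
Proof. by rewrite /row4 !mxE. Qed.

Lemma minkowskiE (X Y : 'rV[R]_4) : minkowski X Y =
  - (X 0 0 * Y 0 0) + (X 0 i1 * Y 0 i1 + X 0 i2 * Y 0 i2 + X 0 i3 * Y 0 i3).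
Proof. by rewrite /minkowski sum3. Qed.

Definition dirA (k : 'I_4) : R[i] := [:: 1; 1; 0; 0]`_k.
Definition dirB (k : 'I_4) : R[i] := [:: 0; 0; 1; - Complex 0 1]`_k.
Definition dirC (k : 'I_4) : R[i] := [:: 0; 0; 1; Complex 0 1]`_k.
Definition dirD (k : 'I_4) : R[i] := [:: 1; -1; 0; 0]`_k.

Lemma cdir_dirA f p : cdir dirA f p = cpartial 0 f p + cpartial i1 f p :> R[i].
Proof. by rewrite /cdir sum4 /dirA /= !mul1r !mul0r !addr0. Qed.

Lemma cdir_dirB f p :
  cdir dirB f p = cpartial i2 f p - Complex 0 1 * cpartial i3 f p :> R[i].
Proof. by rewrite /cdir sum4 /dirB /= !mul1r !mul0r !add0r mulNr. Qed.

Lemma cdir_dirC f p :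
  cdir dirC f p = cpartial i2 f p + Complex 0 1 * cpartial i3 f p :> R[i].
Proof. by rewrite /cdir sum4 /dirC /= !mul1r !mul0r !add0r. Qed.

Lemma cdir_dirD f p : cdir dirD f p = cpartial 0 f p - cpartial i1 f p :> R[i].
Proof. by rewrite /cdir sum4 /dirD /= mul1r mulN1r !mul0r !addr0. Qed.

Definition cross (U X : 'rV[R]_4) : 'rV[R]_4 :=
  row4 0 (U 0 i2 * X 0 i3 - U 0 i3 * X 0 i2)
         (U 0 i3 * X 0 i1 - U 0 i1 * X 0 i3)
         (U 0 i1 * X 0 i2 - U 0 i2 * X 0 i1).

Lemma JperpE (ell : ray_foliation R) p X :
  Jperp ell p X = cross (ray_dir ell p) X.
Proof. by []. Qed.

Local Notation n u := (complex.Re u ^+ 2 + complex.Im u ^+ 2).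

Lemma stereo_denom (u : R[i]) : 1 + n u != 0.
Proof. by rewrite lt0r_neq0 // ltr_pwDl // addr_ge0 // sqr_ge0. Qed.

Lemma sigma_invE (u : R[i]) : let U := sigma_inv (Some u : sphere R) in
  (U 0 0 = 0) * (U 0 i1 = (1 + n u)^-1 * (1 - n u)) *
  (U 0 i2 = (1 + n u)^-1 * (2 * complex.Re u)) *
  (U 0 i3 = (1 + n u)^-1 * (2 * complex.Im u)).
Proof. by rewrite /sigma_inv /= /row4 !mxE /= mulr0. Qed.

Lemma sigma_inv_unit (m : sphere R) :
  tcoord (sigma_inv m) = 0 /\ minkowski (sigma_inv m) (sigma_inv m) = 1.
Proof.
case: m => [u|]; rewrite /tcoord minkowskiE.
  rewrite !(sigma_invE u) mul0r oppr0 add0r; split=> //.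
  by have := stereo_denom u; move: (complex.Re u) (complex.Im u) => x y ?; field.
by rewrite /sigma_inv !row4E; split=> //; ring.
Qed.

Lemma gradient_of_dirs (g0 g1 g2 g3 : R[i]) (u v d : R[i]) :
  g0 + g1 = u * v * d -> g2 - Complex 0 1 * g3 = - (v * d) ->
  g2 + Complex 0 1 * g3 = - (u * d) -> g0 - g1 = d ->
  [/\ 2 * g0 = (u * v + 1) * d, 2 * g1 = (u * v - 1) * d,
      2 * g2 = - ((u + v) * d) & 2 * g3 = Complex 0 1 * ((u - v) * d)].
Proof.
move=> a b c e; split.
- by rewrite [RHS]mulrDl [1 * d]mul1r -a -[in RHS]e; ring.
- by rewrite [RHS]mulrBl [1 * d]mul1r -a -[in RHS]e; ring.
- by rewrite [(u + v) * d]mulrDl opprD -b -c; ring.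
- rewrite mulrBl -[u * d]opprK -[v * d]opprK -b -c.
  have i2E : (Complex 0 1 : R[i]) * Complex 0 1 = -1 by exact: sqr_i.
  transitivity (- (Complex 0 1 * Complex 0 1) * (2 * g3)); last by ring.
  by rewrite i2E opprK mul1r.
Qed.

(** Multiplied by 2 (1 + |u|^2), the sum becomes d times 2 (uv + |u|^2) - 2 u conj(u) - 2 v u, which
    is zero. *)
Lemma null_direction_killed (g0 g1 g2 g3 : R[i]) (u v d : R[i]) :
  [/\ 2 * g0 = (u * v + 1) * d, 2 * g1 = (u * v - 1) * d,
      2 * g2 = - ((u + v) * d) & 2 * g3 = Complex 0 1 * ((u - v) * d)] ->
  let U := sigma_inv (Some u : sphere R) in
  g0 + (U 0 i1)%:C * g1 + (U 0 i2)%:C * g2 + (U 0 i3)%:C * g3 = 0.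
Proof.
move=> [e0 e1 e2 e3]; cbv zeta; rewrite !(sigma_invE u).
have n0 := stereo_denom u.
have two0 : (2 : R[i]) != 0 by rewrite pnatr_eq0.
apply: (mulfI two0); rewrite mulr0 !mulrDr ![2 * (_ * _)]mulrCA e0 e1 e2 e3.
case: u v d n0 {e0 e1 e2 e3} => [p q] [r s] [x y] /= n0.
by apply: eq_ReIm; rewrite /=; field.
Qed.

(** For the spatial gradient g one has g x U = i (g + g0 U). Pairing with X, the two sides of the
    claim differ by i g0 times the product of X and U, which vanishes on the screen space. *)
Lemma cross_multiplies_by_i (g0 g1 g2 g3 : R[i]) (u v d : R[i]) (X : 'rV[R]_4) :
  [/\ 2 * g0 = (u * v + 1) * d, 2 * g1 = (u * v - 1) * d,
      2 * g2 = - ((u + v) * d) & 2 * g3 = Complex 0 1 * ((u - v) * d)] ->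
  let U := sigma_inv (Some u : sphere R) in
  let J := cross U X in
  X 0 i1 * U 0 i1 + X 0 i2 * U 0 i2 + X 0 i3 * U 0 i3 = 0 ->
  (J 0 i1)%:C * g1 + (J 0 i2)%:C * g2 + (J 0 i3)%:C * g3 =
  Complex 0 1 * ((X 0 i1)%:C * g1 + (X 0 i2)%:C * g2 + (X 0 i3)%:C * g3).
Proof.
move=> [e0 e1 e2 e3]; cbv zeta; set U := sigma_inv _; rewrite /cross !row4E => XU.
have two0 : (2 : R[i]) != 0 by rewrite pnatr_eq0.
apply: (mulfI two0).
have E a b c : 2 * (a * g1 + b * g2 + c * g3) = a * ((u * v - 1) * d) +
    b * (- ((u + v) * d)) + c * (Complex 0 1 * ((u - v) * d)).
  by rewrite -e1 -e2 -e3; ring.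
rewrite [RHS]mulrCA !E.
apply/eqP; rewrite -subr_eq0; apply/eqP.
transitivity (Complex 0 1 * ((u * v + 1) * d) *
  (X 0 i1 * U 0 i1 + X 0 i2 * U 0 i2 + X 0 i3 * U 0 i3)%:C); last first.
  by rewrite XU mulr0.
rewrite /U !(sigma_invE u); have n0 := stereo_denom u.
move: (X 0 i1) (X 0 i2) (X 0 i3) => X1 X2 X3.
case: u v d n0 {E U XU e0 e1 e2 e3} => [p q] [r s] [x y] /= n0.
by apply: eq_ReIm; rewrite /=; field.
Qed.

(* The differential at u of sigma_inv, applied to the tangent vector xi. *)
Definition dsigma (u xi : R[i]) : 'rV[R]_4 :=
  let k := 2 * (complex.Re u * complex.Re xi + complex.Im u * complex.Im xi) in
  row4 0 (- (2 * k) / (1 + n u) ^+ 2)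
         (2 * complex.Re xi / (1 + n u) - 2 * complex.Re u * k / (1 + n u) ^+ 2)
         (2 * complex.Im xi / (1 + n u) - 2 * complex.Im u * k / (1 + n u) ^+ 2).

(** Conformality of stereographic projection, with its orientation: multiplication by i becomes the
    positive rotation about the image point. *)
Lemma dsigma_i (u xi : R[i]) :
  dsigma u (Complex 0 1 * xi) = cross (sigma_inv (Some u : sphere R)) (dsigma u xi).
Proof.
have n0 := stereo_denom u.
apply: row4_eq; rewrite /cross /dsigma !row4E ?(sigma_invE u) //;
  case: u xi n0 => [p q] [r s] /= n0; by field.
Qed.

Lemma dsigma0 (u : R[i]) : dsigma u 0 = 0.
Proof.
by apply: row4_eq; rewrite /dsigma /= !row4E !mxE //; rewrite ?(mulr0, addr0, mul0r,
  oppr0, subr0).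
Qed.

End Coordinates.

Arguments dirA {R} k.
Arguments dirB {R} k.
Arguments dirC {R} k.
Arguments dirD {R} k.

(** * Harmonic morphisms in one chart, and the dichotomy between u and v *)

Section HarmonicCharts.
Variable R : realType.
Implicit Types (f g : 'rV[R]_4 -> R[i]) (B : set 'rV[R]_4) (p X : 'rV[R]_4).

Definition conj_fun f p : R[i] := conjc (f p).

Definition harmonic_at f p : Prop :=
  - cpartial 0 (cpartial 0 f) p
    + \sum_(i < 3) cpartial (lift ord0 i) (cpartial (lift ord0 i) f) p = 0
  /\
  - cpartial 0 f p ^+ 2 + \sum_(i < 3) cpartial (lift ord0 i) f p ^+ 2 = 0.

Lemma i_sqr : (Complex 0 1 : R[i]) * Complex 0 1 = -1.
Proof. exact: sqr_i. Qed.

Lemma harmonic_null f p : harmonic_at f p ->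
  cdir dirA f p * cdir dirD f p = cdir dirB f p * cdir dirC f p.
Proof.
move=> [_]; rewrite sum3 cdir_dirA cdir_dirB cdir_dirC cdir_dirD.
move: (cpartial 0 f p) (cpartial i1 f p) (cpartial i2 f p) (cpartial i3 f p).
move=> g0 g1 g2 g3 E.
transitivity (- (- g0 ^+ 2 + (g1 ^+ 2 + g2 ^+ 2 + g3 ^+ 2)) + g2 ^+ 2 + g3 ^+ 2).
  by ring.
rewrite E oppr0 add0r.
transitivity (g2 ^+ 2 - (Complex 0 1 * Complex 0 1) * g3 ^+ 2); last by ring.
by rewrite i_sqr mulN1r opprK.
Qed.

Lemma harmonic_wave f p B : open B -> smooth_cplx_on B f -> B p ->
  harmonic_at f p -> cdir dirA (cdir dirD f) p = cdir dirC (cdir dirB f) p.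
Proof.
move=> oB sf Bp [+ _].
rewrite sum3 cdir_dirA cdir_dirC !(cpartial_cdir _ _ oB sf Bp).
rewrite (cdir_dirD (cpartial 0 f)) (cdir_dirD (cpartial i1 f)).
rewrite (cdir_dirB (cpartial i2 f)) (cdir_dirB (cpartial i3 f)).
have := cpartialC oB sf Bp 0 i1; have := cpartialC oB sf Bp i2 i3.
generalize (cpartial 0 (cpartial 0 f) p) (cpartial i1 (cpartial i1 f) p)
  (cpartial i2 (cpartial i2 f) p) (cpartial i3 (cpartial i3 f) p)
  (cpartial 0 (cpartial i1 f) p) (cpartial i1 (cpartial 0 f) p)
  (cpartial i2 (cpartial i3 f) p) (cpartial i3 (cpartial i2 f) p).
move=> h00 h11 h22 h33 h01 h10 h23 h32 -> -> E.
rewrite mulrBr mulrA i_sqr.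
apply/eqP; rewrite -subr_eq0; apply/eqP; rewrite -[RHS]oppr0 -[in RHS]E; ring.
Qed.

Lemma smooth_neq0_open B f : open B -> smooth_cplx_on B f ->
  open (B `&` [set p | f p != 0]).
Proof.
move=> oB [sr si]; rewrite openE => p [Bp /= fp].
have nB := open_near oB Bp.
have [cr _] := sr [::] p Bp; have [ci _] := si [::] p Bp.
rewrite /= in cr ci.
have [r0|r0] := eqVneq (complex.Re (f p)) 0; last first.
  near=> q; split; first by near: q.
  have : complex.Re (f q) != 0 by near: q; exact: cvgr_neq0 cr r0.
  by apply: contra => /eqP ->.
have i0 : complex.Im (f p) != 0.
  apply: contra fp => /eqP i0; apply/eqP; exact: eq_ReIm.
near=> q; split; first by near: q.
have : complex.Im (f q) != 0 by near: q; exact: cvgr_neq0 ci i0.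
by apply: contra => /eqP ->.
Unshelve. all: by end_near. Qed.

Lemma cpartialJ f p B k : open B -> smooth_cplx_on B f -> B p ->
  cpartial k (conj_fun f) p = conjc (cpartial k f p).
Proof. by move=> oB sf Bp; exact: cderiveJ oB sf Bp. Qed.

Lemma harmonicJ f p B : open B -> smooth_cplx_on B f -> B p ->
  harmonic_at f p -> harmonic_at (conj_fun f) p.
Proof.
move=> oB sf Bp [E1 E2].
have E k : cpartial k (cpartial k (conj_fun f)) p = conjc (cpartial k (cpartial k f) p).
  rewrite -(cpartialJ _ oB (smooth_cpartial k sf) Bp).
  by apply: (cderive_ext _ oB Bp) => q Bq; exact: (cpartialJ k oB sf Bq).
split; rewrite sum3.
  rewrite !E; move: E1; rewrite sum3.
  generalize (cpartial 0 (cpartial 0 f) p) (cpartial i1 (cpartial i1 f) p)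
    (cpartial i2 (cpartial i2 f) p) (cpartial i3 (cpartial i3 f) p).
  move=> a b c d /(congr1 conjc); rewrite rmorph0 => <-.
  by rewrite !rmorphD rmorphN.
rewrite !(cpartialJ _ oB sf Bp); move: E2; rewrite sum3.
generalize (cpartial 0 f p) (cpartial i1 f p) (cpartial i2 f p) (cpartial i3 f p).
move=> a b c d /(congr1 conjc); rewrite rmorph0 => <-.
by rewrite !rmorphD rmorphN !rmorphXn.
Qed.

(** A and D are real while B and C are conjugate to each other, so conjugating f exchanges the roles
    of B and C, hence those of the two ratios. *)
Lemma cdirJ f p B : open B -> smooth_cplx_on B f -> B p ->
  [/\ cdir dirA (conj_fun f) p = conjc (cdir dirA f p),
      cdir dirB (conj_fun f) p = conjc (cdir dirC f p),
      cdir dirC (conj_fun f) p = conjc (cdir dirB f p) &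
      cdir dirD (conj_fun f) p = conjc (cdir dirD f p)].
Proof.
move=> oB sf Bp; rewrite !(cdir_dirA, cdir_dirB, cdir_dirC, cdir_dirD) !(cpartialJ _ oB sf Bp).
generalize (cpartial 0 f p) (cpartial i1 f p) (cpartial i2 f p) (cpartial i3 f p).
move=> [a a'] [b b'] [c c'] [d d'].
by split; apply: eq_ReIm; rewrite /=; ring.
Qed.

Definition ratio_u f p : R[i] := - cdir dirC f p / cdir dirD f p.
Definition ratio_v f p : R[i] := - cdir dirB f p / cdir dirD f p.

Let solve_dirs (a0 a1 a2 a3 b0 b1 b2 b3 r : R[i]) :
  [/\ a0 + a1 = r * (b0 + b1), a2 - Complex 0 1 * a3 = r * (b2 - Complex 0 1 * b3),
      a2 + Complex 0 1 * a3 = r * (b2 + Complex 0 1 * b3) & a0 - a1 = r * (b0 - b1)] ->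
  [/\ a0 = r * b0, a1 = r * b1, a2 = r * b2 & a3 = r * b3].
Proof.
move=> [a b c d].
have two0 : (2 : R[i]) != 0 by rewrite pnatr_eq0.
have in0 : (Complex 0 1 : R[i]) != 0 by rewrite eq_complex /= oner_eq0 andbF.
split; apply: (mulfI two0).
- transitivity ((a0 + a1) + (a0 - a1)); first by ring.
  by rewrite a d; ring.
- transitivity ((a0 + a1) - (a0 - a1)); first by ring.
  by rewrite a d; ring.
- transitivity ((a2 - Complex 0 1 * a3) + (a2 + Complex 0 1 * a3)); first by ring.
  by rewrite b c; ring.
- apply: (mulfI in0).
  transitivity ((a2 + Complex 0 1 * a3) - (a2 - Complex 0 1 * a3)); first by ring.
  by rewrite b c; ring.
Qed.

Lemma cpartial_of_dirs f g p r :
  [/\ cdir dirA g p = r * cdir dirA f p, cdir dirB g p = r * cdir dirB f p,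
      cdir dirC g p = r * cdir dirC f p & cdir dirD g p = r * cdir dirD f p] ->
  forall k, cpartial k g p = r * cpartial k f p.
Proof.
rewrite !(cdir_dirA, cdir_dirB, cdir_dirC, cdir_dirD) => /solve_dirs [e0 e1 e2 e3] k.
have : k \in [:: (0 : 'I_4); i1; i2; i3].
  by case: k => -[|[|[|[|]]]].
rewrite !inE => /or4P[] /eqP ->; [exact: e0|exact: e1|exact: e2|exact: e3].
Qed.

(* Either du is a complex multiple of df for u = ratio_u f, or u is infinite
   throughout B. For conj_fun f the ratio u is the conjugate of ratio_v f. *)
Definition aligned f B : Prop :=
  (forall p, B p -> cdir dirD f p != 0 /\
     exists r, forall k, cpartial k (ratio_u f) p = r * cpartial k f p) \/
  (forall p, B p -> cdir dirD f p = 0 /\ cdir dirB f p = 0).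

Lemma smooth_ratio_u f B : open B -> smooth_cplx_on B f ->
  (forall p, B p -> cdir dirD f p != 0) -> smooth_cplx_on B (ratio_u f).
Proof.
move=> oB sf d0; apply: (smooth_cplxM oB).
  exact: smooth_cplxN oB (smooth_cdir _ oB sf).
exact: smooth_cplxV oB d0 (smooth_cdir _ oB sf).
Qed.

Lemma smooth_ratio_v f B : open B -> smooth_cplx_on B f ->
  (forall p, B p -> cdir dirD f p != 0) -> smooth_cplx_on B (ratio_v f).
Proof.
move=> oB sf d0; apply: (smooth_cplxM oB).
  exact: smooth_cplxN oB (smooth_cdir _ oB sf).
exact: smooth_cplxV oB d0 (smooth_cdir _ oB sf).
Qed.

Lemma ratio_uE f p : cdir dirD f p != 0 ->
  cdir dirC f p = - (ratio_u f p * cdir dirD f p).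
Proof. by move=> d0; rewrite /ratio_u divfK // opprK. Qed.

Lemma ratio_vE f p : cdir dirD f p != 0 ->
  cdir dirB f p = - (ratio_v f p * cdir dirD f p).
Proof. by move=> d0; rewrite /ratio_v divfK // opprK. Qed.

Lemma ratio_uJ f p B : open B -> smooth_cplx_on B f -> B p ->
  ratio_u (conj_fun f) p = conjc (ratio_v f p).
Proof.
move=> oB sf Bp; have [_ _ c d] := cdirJ oB sf Bp.
by rewrite /ratio_u /ratio_v c d rmorphM rmorphN fmorphV.
Qed.

(* By shear_product, du is a multiple of df near any point where dv is not, and
   conversely; if Df = 0 identically, one of Bf and Cf vanishes on an open set. *)
Lemma aligned_dense f O : open O -> O !=set0 -> smooth_cplx_on O f ->
  (forall p, O p -> harmonic_at f p) ->
  exists O', [/\ open O', O' !=set0, O' `<=` O & aligned f O' \/ aligned (conj_fun f) O'].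
Proof.
move=> oO [x0 Ox0] sf hf.
have [dz|] := pselect (forall p, O p -> cdir dirD f p = 0).
  have bc p : O p -> cdir dirB f p * cdir dirC f p = 0.
    by move=> Op; rewrite -harmonic_null ?dz ?mulr0 //; exact: hf.
  (* Now Bf Cf = 0 on O. If Bf vanishes throughout, u is infinite for f; otherwise Cf = 0 where Bf
     is nonzero, which is the infinite case for the conjugate of f. *)
  have [bz|] := pselect (forall p, O p -> cdir dirB f p = 0).
    by exists O; split => //; [exists x0|left; right; move=> p Op; split; auto].
  move=> /existsNP[p0 /not_implyP[Op0 /eqP bp0]].
  exists (O `&` [set p | cdir dirB f p != 0]); split.
  - exact: smooth_neq0_open oO (smooth_cdir _ oO sf).
  - by exists p0.
  - by move=> ? [].
  - right; right; move=> p [Op /= bp]; have [_ -> _ ->] := cdirJ oO sf Op.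
    rewrite dz // conjc0; split=> //.
    by have /eqP := bc p Op; rewrite mulf_eq0 (negPf bp) /= => /eqP ->; rewrite conjc0.
move=> /existsNP[p0 /not_implyP[Op0 /eqP dp0]].
pose P := O `&` [set p | cdir dirD f p != 0].
have oP : open P by exact: smooth_neq0_open oO (smooth_cdir _ oO sf).
have PO : P `<=` O by move=> ? [].
have sfP : smooth_cplx_on P f by exact: smooth_cplx_sub PO sf.
have d0 p : P p -> cdir dirD f p != 0 by case.
have su := smooth_ratio_u oP sfP d0; have sv := smooth_ratio_v oP sfP d0.
have null p (Pp : P p) := harmonic_null (hf p (PO p Pp)).
have wave p (Pp : P p) := harmonic_wave oP sfP Pp (hf p (PO p Pp)).
have uE p (Pp : P p) := ratio_uE (d0 p Pp).
have vE p (Pp : P p) := ratio_vE (d0 p Pp).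
pose s p := cdir dirC (ratio_u f) p + ratio_u f p * cdir dirD (ratio_u f) p.
have ss : smooth_cplx_on P s.
  exact: (smooth_cplxD oP (smooth_cdir _ oP su)
    (smooth_cplxM oP su (smooth_cdir _ oP su))).
have [sz|] := pselect (forall p, P p -> s p = 0).
  exists P; split=> //; first by exists p0.
  left; left; move=> p Pp; split; first exact: d0.
  exists (cdir dirD (ratio_u f) p / cdir dirD f p); apply: cpartial_of_dirs.
  exact: (dir_prop oP sfP null wave d0 su uE vE Pp (sz p Pp)).
move=> /existsNP[q0 /not_implyP[Pq0 /eqP sq0]].
pose Q := P `&` [set p | s p != 0].
have oQ : open Q by exact: smooth_neq0_open oP ss.
exists Q; split=> //; [by exists q0|by move=> ? [/PO]|].
right; left; move=> p [Pp sp].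
have [_ _ _ ->] := cdirJ oP sfP Pp; rewrite conjc_eq0; split; first exact: d0.
have := shear_product oP sfP null wave d0 su sv uE vE Pp.
move=> /eqP; rewrite mulf_eq0 -/(s p) (negPf sp) /= => /eqP vz.
have null' q : P q -> cdir dirA f q * cdir dirD f q = cdir dirC f q * cdir dirB f q.
  by move=> Pq; rewrite mulrC [RHS]mulrC mulrC null.
have wave' q : P q -> cdir dirA (cdir dirD f) q = cdir dirB (cdir dirC f) q.
  by move=> Pq; rewrite wave // (cdirC _ _ oP sfP Pq).
(* Applied with B and C exchanged, hence the reordering of the four equations below. *)
have [a b c d] := dir_prop oP sfP null' wave' d0 sv vE uE Pp vz.
have E := cpartial_of_dirs (And4 a c b d).
exists (conjc (cdir dirD (ratio_v f) p / cdir dirD f p)) => k; rewrite (cpartialJ _ oP sfP Pp).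
transitivity (conjc (cpartial k (ratio_v f) p)).
  rewrite -(cpartialJ _ oP sv Pp); apply: (cderive_ext _ oP Pp) => q Pq.
  exact: ratio_uJ oP sfP Pq.
by rewrite E rmorphM.
Qed.

End HarmonicCharts.

Local Notation n u := (complex.Re u ^+ 2 + complex.Im u ^+ 2).

(** * The null direction attached to u, and its differential *)

Section NullDirection.
Variable R : realType.
Implicit Types (f g : 'rV[R]_4 -> R[i]) (B : set 'rV[R]_4) (p X : 'rV[R]_4).

Definition null_ratio f p : sphere R :=
  if cdir dirD f p == 0 then None else Some (ratio_u f p).

(* df(d/dt + sigma_inv x) is proportional to (v - conj x)(u - x): df kills the null
   direction of x = u, and the one of x = conj v, which is null_dir (conj_fun f). *)
Definition null_dir f p : 'rV[R]_4 := sigma_inv (null_ratio f p).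

(** The ratio is homogeneous of degree 0 in df. Since a change of chart multiplies df by a nonzero
    number, the null direction is well defined on the surface. *)
Lemma null_dir_scale f g p (r : R[i]) : r != 0 ->
  (forall k, cpartial k g p = r * cpartial k f p) -> null_dir g p = null_dir f p.
Proof.
move=> r0 E.
have Ed a : cdir a g p = r * cdir a f p.
  by rewrite mulr_sumr; apply: eq_bigr => k _; rewrite E mulrCA.
rewrite /null_dir /null_ratio /ratio_u !Ed mulf_eq0 (negPf r0) /=.
case: eqP => // /eqP d0; congr (sigma_inv (Some _)).
by rewrite -mulrN -mulf_div divff // mul1r.
Qed.

Lemma cderive4 f p X B : open B -> smooth_cplx_on B f -> B p ->
  cderive X f p = (X 0 0)%:C * cpartial 0 f p + (X 0 i1)%:C * cpartial i1 f p +
    (X 0 i2)%:C * cpartial i2 f p + (X 0 i3)%:C * cpartial i3 f p.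
Proof. by move=> oB sf Bp; rewrite (cderiveE _ oB sf Bp) sum4. Qed.

Lemma null_dir_finite f p : cdir dirD f p != 0 ->
  null_dir f p = sigma_inv (Some (ratio_u f p) : sphere R).
Proof. by move=> d0; rewrite /null_dir /null_ratio (negPf d0). Qed.

Lemma null_dir_infinite f p : cdir dirD f p = 0 -> null_dir f p = row4 0 (-1) 0 0.
Proof. by move=> d0; rewrite /null_dir /null_ratio d0 eqxx. Qed.

Lemma null_dir_gradient f p : harmonic_at f p -> cdir dirD f p != 0 ->
  [/\ 2 * cpartial 0 f p = (ratio_u f p * ratio_v f p + 1) * cdir dirD f p,
      2 * cpartial i1 f p = (ratio_u f p * ratio_v f p - 1) * cdir dirD f p,
      2 * cpartial i2 f p = - ((ratio_u f p + ratio_v f p) * cdir dirD f p) &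
      2 * cpartial i3 f p =
        Complex 0 1 * ((ratio_u f p - ratio_v f p) * cdir dirD f p)].
Proof.
move=> /harmonic_null nf d0; apply: gradient_of_dirs.
- rewrite -cdir_dirA; apply: (mulIf d0); rewrite nf {1}(ratio_vE d0) {1}(ratio_uE d0).
  by generalize (ratio_u f p) (ratio_v f p) (cdir dirD f p) => u v d; ring.
- by rewrite -cdir_dirB; exact: ratio_vE.
- by rewrite -cdir_dirC; exact: ratio_uE.
- by rewrite -cdir_dirD.
Qed.

Section Aligned.
Variables (f : 'rV[R]_4 -> R[i]) (B : set 'rV[R]_4) (oB : open B).
Hypothesis sf : smooth_cplx_on B f.
Hypothesis hf : forall p, B p -> harmonic_at f p.
Hypothesis al : aligned f B.

Lemma null_dir_smooth j : smooth_on B (fun p => null_dir f p 0 j).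
Proof.
case: al => H.
  have [sr si] := smooth_ratio_u oB sf (fun p Bp => (H p Bp).1).
  set r := fun p => complex.Re (ratio_u f p) in sr.
  set i := fun p => complex.Im (ratio_u f p) in si.
  have sn : smooth_on B (fun p => r p * r p + i p * i p).
    exact: (smooth_onD oB (smooth_onM oB sr sr) (smooth_onM oB si si)).
  have s1 := smooth_onD oB (smooth_on_cst 1 oB) sn.
  have sV : smooth_on B (fun p => (1 + (r p * r p + i p * i p))^-1).
    apply: (smooth_onV oB) s1 => p _.
    by have := stereo_denom (ratio_u f p); rewrite !expr2.
  have E p : B p -> null_dir f p = sigma_inv (Some (ratio_u f p) : sphere R).
    by move=> /H[d0 _]; exact: null_dir_finite.
  have : j \in [:: (0 : 'I_4); i1; i2; i3] by case: j => -[|[|[|[|]]]].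
  rewrite !inE => /or4P[] /eqP ->.
  - apply: (smooth_on_ext oB) (smooth_on_cst 0 oB) => p /E ->.
    by rewrite sigma_invE.
  - apply: (smooth_on_ext oB)
      (smooth_onM oB sV (smooth_onB oB (smooth_on_cst 1 oB) sn)) => p /E ->.
    by rewrite sigma_invE !expr2.
  - apply: (smooth_on_ext oB)
      (smooth_onM oB sV (smooth_onM oB (smooth_on_cst 2 oB) sr)) => p /E ->.
    by rewrite sigma_invE !expr2.
  - apply: (smooth_on_ext oB)
      (smooth_onM oB sV (smooth_onM oB (smooth_on_cst 2 oB) si)) => p /E ->.
    by rewrite sigma_invE !expr2.
apply: (smooth_on_ext oB) (smooth_on_cst ((row4 0 (-1) 0 0 : 'rV[R]_4) 0 j) oB).
by move=> p /H[d0 _]; rewrite null_dir_infinite.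
Qed.

Lemma null_dir_killed p : B p ->
  cderive (delta_mx 0 0 + null_dir f p) f p = 0.
Proof.
move=> Bp; rewrite (cderive4 _ oB sf Bp).
have W0 : (delta_mx 0 0 + null_dir f p) 0 0 = 1.
  have [] := sigma_inv_unit (null_ratio f p).
  by rewrite /tcoord !mxE eqxx /= /null_dir => -> _; rewrite addr0.
have W k : (delta_mx 0 0 + null_dir f p) 0 (lift ord0 k) = null_dir f p 0 (lift ord0 k).
  by rewrite !mxE eqxx /= add0r.
rewrite W0 !W mul1r; case: al => H.
  have [d0 _] := H p Bp; rewrite null_dir_finite //.
  exact: null_direction_killed (null_dir_gradient (hf Bp) d0).
have [d0 b0] := H p Bp; rewrite null_dir_infinite // !row4E.
by rewrite !mul0r !addr0 -[RHS]d0 cdir_dirD rmorphN1 mulN1r.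
Qed.

Lemma null_dir_linear p X : B p -> X 0 0 = 0 -> minkowski X (null_dir f p) = 0 ->
  cderive (cross (null_dir f p) X) f p = Complex 0 1 * cderive X f p.
Proof.
move=> Bp X0 XU; rewrite !(cderive4 _ oB sf Bp) X0.
rewrite minkowskiE X0 mul0r oppr0 add0r in XU.
have -> : cross (null_dir f p) X 0 0 = 0 by rewrite row4E.
rewrite !mul0r !add0r; case: al => H.
  have [d0 _] := H p Bp; rewrite null_dir_finite // in XU *.
  exact: cross_multiplies_by_i (null_dir_gradient (hf Bp) d0) XU.
(* At infinity U = - e_1, so X lies in the plane of e_2 and e_3, and Bf = 0 reads f_2 = i f_3. *)
have [d0 b0] := H p Bp; rewrite null_dir_infinite // in XU *.
move: XU; rewrite /cross !row4E !mulr0 !addr0 mulrN1 => /eqP; rewrite oppr_eq0 => /eqP X1.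
rewrite X1 !(mul0r, mulr0, subr0, add0r, sub0r, mulN1r, opprK).
have /eqP := b0; rewrite cdir_dirB subr_eq0 => /eqP ->.
generalize (cpartial i3 f p) (X 0 i2) (X 0 i3) => -[s t] x y.
by apply: eq_ReIm; rewrite /=; ring.
Qed.

Lemma null_dir_derivable p X : B p -> derivable (null_dir f) p X.
Proof.
move=> Bp; apply/derivable_mxP => i j; rewrite ord1.
exact: smooth_derivable oB (null_dir_smooth j) Bp.
Qed.

Lemma null_dir_derive_row p X : B p ->
  'D_X (null_dir f) p = \row_j 'D_X (fun q => null_dir f q 0 j) p.
Proof.
move=> Bp; have dU := @null_dir_derivable p X Bp.
by rewrite (derive_mx dU); apply/rowP => j; rewrite !mxE.
Qed.

(** The differential of U factors through df, and the factor turns i into the rotation: the first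
    fact gives constancy along the null line, both together give shear-freeness. For finite u the
    factor is z |-> dsigma u (r z), where du = r df; for infinite u it is 0. *)
Lemma null_dir_derive p : B p -> exists dU : R[i] -> 'rV[R]_4,
  [/\ dU 0 = 0, forall z, dU z 0 0 = 0,
      forall z, dU (Complex 0 1 * z) = cross (null_dir f p) (dU z) &
      forall X, 'D_X (null_dir f) p = dU (cderive X f p)].
Proof.
move=> Bp.
have D X := null_dir_derive_row X Bp.
have nB := open_near oB Bp.
case: al => H; last first.
  exists (fun=> 0); split=> //; first by move=> z; rewrite mxE.
    by move=> z; rewrite /cross !mxE !mulr0 subrr; apply: row4_eq; rewrite row4E ?mxE.
  move=> X; rewrite D; apply/rowP => j; rewrite !mxE.
  rewrite -[RHS](derive_cst ((row4 0 (-1) 0 0 : 'rV[R]_4) 0 j) p X).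
  apply: near_eq_derive; near=> q.
  have [|d0 _] := H q; first by near: q.
  by rewrite null_dir_infinite.
have [d0 [r E]] := H p Bp.
have su := smooth_ratio_u oB sf (fun p Bp => (H p Bp).1).
exists (fun z => dsigma (ratio_u f p) (r * z)); split.
- by rewrite mulr0 dsigma0.
- by move=> z; rewrite row4E.
- by move=> z; rewrite mulrCA dsigma_i null_dir_finite.
move=> X.
have -> : r * cderive X f p = cderive X (ratio_u f) p.
  rewrite !(cderiveE _ oB _ Bp) // mulr_sumr; apply: eq_bigr => k _.
  by rewrite E mulrCA.
set u := ratio_u f.
have dr := @smooth_derivable _ _ _ _ X oB su.1 Bp.
have di := @smooth_derivable _ _ _ _ X oB su.2 Bp.
set rr := fun q => complex.Re (u q) in dr; set ii := fun q => complex.Im (u q) in di.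
have isr : is_derive p X rr (complex.Re (cderive X u p)) by exact: derivableP.
have isi : is_derive p X ii (complex.Im (cderive X u p)) by exact: derivableP.
have n0 := stereo_denom (u p).
pose N q := 1 + (rr q * rr q + ii q * ii q).
have N0 : N p != 0 by rewrite /N -!expr2.
set x := complex.Re (cderive X u p) in isr *; set y := complex.Im (cderive X u p) in isi *.
have isN0 := is_deriveD (is_derive_cst (1 : R) p X)
  (is_deriveD (is_deriveM isr isr) (is_deriveM isi isi)).
have isN : is_derive p X N (2 * (rr p * x + ii p * y)).
  apply: is_derive_eq isN0 _.
  by rewrite /GRing.scale /=; generalize (rr p) (ii p) => a b; ring.
have isV : is_derive p X (fun q => (N q)^-1) (- (N p) ^- 2 *: (2 * (rr p * x + ii p * y))).
  have [dN EN] := isN; split; first exact: (derivableV N0 dN).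
  by rewrite (deriveV N0 dN) EN.
(* Every coordinate of [sigma_inv] is a numerator h over N = 1 + |u|^2; this is the quotient rule
   for all of them. *)
have isM h dh : is_derive p X h dh ->
    is_derive p X (fun q => (N q)^-1 * h q)
      ((N p)^-1 * dh - h p * (2 * (rr p * x + ii p * y)) / (N p) ^+ 2).
  move=> hh; apply: is_derive_eq (is_deriveM isV hh) _.
  by rewrite /GRing.scale /=; ring.
have UE j (h : 'rV[R]_4 -> R) :
  (forall q, (sigma_inv (Some (u q) : sphere R)) 0 j = (N q)^-1 * h q) ->
  {near p, (fun q => (N q)^-1 * h q) =1 (fun q => null_dir f q 0 j)}.
  move=> hh; near=> q.
  have [|dq _] := H q; first by near: q.
  by rewrite null_dir_finite // -hh.
have fin j h dh : is_derive p X h dh ->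
  (forall q, (sigma_inv (Some (u q) : sphere R)) 0 j = (N q)^-1 * h q) ->
  'D_X (fun q => null_dir f q 0 j) p =
   (N p)^-1 * dh - h p * (2 * (rr p * x + ii p * y)) / (N p) ^+ 2.
  move=> hh hE; rewrite -(near_eq_derive X (UE _ _ hE)).
  by have [_ ->] := isM _ _ hh.
rewrite D /dsigma -/u -/x -/y; clearbody x y.
apply: row4_eq; rewrite row4E mxE.
- rewrite (fin 0 (cst 0) 0) //; first by rewrite mulr0 mul0r mul0r subr0.
  by move=> q; rewrite sigma_invE mulr0.
- have is1 : is_derive p X (fun q => 1 - (rr q * rr q + ii q * ii q))
      (- (2 * (rr p * x + ii p * y))).
    apply: is_derive_eq (is_deriveB (is_derive_cst (1 : R) p X)
      (is_deriveD (is_deriveM isr isr) (is_deriveM isi isi))) _.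
    by rewrite /GRing.scale /=; generalize (rr p) (ii p) => a b; ring.
  rewrite (fin i1 _ _ is1); last by move=> q; rewrite sigma_invE /N !expr2.
  move: N0; rewrite /N /rr /ii -!expr2.
  generalize (complex.Re (u p)) (complex.Im (u p)) => a b.
  by move: x y {isr isi isN isN0 isV isM fin is1} => x y N0; field.
- have is1 : is_derive p X (fun q => 2 * rr q) (2 * x).
    exact: (is_deriveZ 2 isr).
  rewrite (fin i2 _ _ is1); last by move=> q; rewrite sigma_invE /N !expr2.
  move: N0; rewrite /N /rr /ii -!expr2.
  generalize (complex.Re (u p)) (complex.Im (u p)) => a b.
  by move: x y {isr isi isN isN0 isV isM fin is1} => x y N0; field.
- have is1 : is_derive p X (fun q => 2 * ii q) (2 * y).
    exact: (is_deriveZ 2 isi).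
  rewrite (fin i3 _ _ is1); last by move=> q; rewrite sigma_invE /N !expr2.
  move: N0; rewrite /N /rr /ii -!expr2.
  generalize (complex.Re (u p)) (complex.Im (u p)) => a b.
  by move: x y {isr isi isN isN0 isV isM fin is1} => x y N0; field.
Unshelve. all: by end_near. Qed.

End Aligned.
End NullDirection.

(** * Local factorization through a submersion *)

Section FixedPoint.
Variable R : realType.

(** A solution is a fixed point of x |-> y - K x. This map halves distances, and it preserves the
    closed ball of radius r because K p0 = 0 and y is within r/2 of p0. *)
Lemma contraction_solve (V : completeNormedModType R) (K : V -> V) (p0 : V) (r : R) :
  0 < r -> K p0 = 0 ->
  (forall x y, `|p0 - x| <= r -> `|p0 - y| <= r -> `|K x - K y| <= `|x - y| / 2) ->
  forall y, `|p0 - y| <= r / 2 -> exists2 x, `|p0 - x| <= r & x + K x = y.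
Proof.
move=> r0 Kp0 HK y yr.
have p0r : `|p0 - p0| <= r by rewrite subrr normr0 ltW.
pose D : set V := closed_ball_ (@Num.norm R V) p0 r.
have TD : {homo (fun x => y - K x) : x / D x >-> D x}.
  move=> x Dx; rewrite /D /closed_ball_ /=.
  have -> : p0 - (y - K x) = (p0 - y) + (K x - K p0).
    by rewrite Kp0 subr0 opprD opprK addrA.
  apply: le_trans (ler_normD _ _) _.
  rewrite [r]splitr lerD //; apply: le_trans (HK _ _ Dx p0r) _.
  by rewrite ler_pM2r // distrC.
have [|||x Dx xE] := @banach_fixed_point R V D (mkfun_fun TD).
- exists (2^-1)%:nng; split => /=; first by rewrite invf_lt1 // ltr1n.
  move=> [a b] [/= Da Db].
  have E : y - K a - (y - K b) = K b - K a by rewrite opprB addrC addrA subrK.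
  rewrite /mkfun E.
  apply: le_trans (HK _ _ Db Da) _; by rewrite mulrC distrC.
- exact: closed_closed_ball_.
- by exists p0.
- by exists x => //; rewrite {1}xE /= /mkfun subrK.
Qed.

End FixedPoint.

HB.instance Definition _ (R : realType) (m n : nat) :=
  Complete.on 'M[R]_(m, n).

Section LocalFactorization.
Variable R : realType.
Variables (f u : 'rV[R]_4 -> R[i]) (B : set 'rV[R]_4) (p0 : 'rV[R]_4).
Hypotheses (oB : open B) (sf : smooth_cplx_on B f) (su : smooth_cplx_on B u).
Hypothesis Bp0 : B p0.
Hypothesis f_submersive : forall z, exists X, cderive X f p0 = z.
Hypothesis u_aligned :
  forall p, B p -> exists r, forall k, cpartial k u p = r * cpartial k f p.

Let l X : R[i] := cderive X f p0.

Let lD X Y : l (X + Y) = l X + l Y.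
Proof. exact: cderive_add oB sf Bp0. Qed.

Let lZ (h : R) X : l (h *: X) = h%:C * l X.
Proof. exact: cderive_scale oB sf Bp0. Qed.

Let lN X : l (- X) = - l X.
Proof. by rewrite -scaleN1r lZ rmorphN1 mulN1r. Qed.

Let lB X Y : l (X - Y) = l X - l Y.
Proof. by rewrite lD lN. Qed.

Lemma aligned_derive p : B p ->
  exists r, forall X, cderive X u p = r * cderive X f p.
Proof.
move=> Bp; have [r E] := u_aligned Bp; exists r => X.
rewrite (cderiveE _ oB su Bp) (cderiveE _ oB sf Bp) mulr_sumr.
by apply: eq_bigr => k _; rewrite E mulrCA.
Qed.

Let right_inverse : exists (L : R[i] -> 'rV[R]_4) (C : R),
  [/\ 0 < C, forall z, l (L z) = z, forall z w, L (z - w) = L z - L w &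
      forall z, `|L z| <= C * normc z].
Proof.
have [X1 E1] := f_submersive 1; have [X2 E2] := f_submersive (Complex 0 1).
exists (fun z => complex.Re z *: X1 + complex.Im z *: X2), (1 + (`|X1| + `|X2|)).
split=> [|z|z w|z].
- by rewrite ltr_pwDl // addr_ge0.
- rewrite lD !lZ /l E1 E2; case: z => a b; simpc.
  by apply: eq_ReIm; rewrite /=; ring.
- by rewrite !(cReD, cReN, cImD, cImN) !scalerBl opprD addrACA.
apply: le_trans (ler_normD _ _) _; rewrite !normrZ.
apply: le_trans (_ : normc z * `|X1| + normc z * `|X2| <= _).
  by rewrite lerD // ler_wpM2r //; [exact: Re_le_normc|exact: Im_le_normc].
by rewrite -mulrDr mulrC ler_wpM2r ?normc_ge0 // lerDr.
Qed.

(* With L a right inverse of l = df(p0), the map G x = x + L(f x - f p0 - l(x - p0))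
   has derivative 1 at p0 and l (G x - p0) = f x - f p0: it straightens f. *)
Let straighten : exists (r C : R) (G H : 'rV[R]_4 -> 'rV[R]_4) (L : R[i] -> 'rV[R]_4),
  [/\ [/\ 0 < r, 0 < C & G p0 = p0],
      forall x, `|p0 - x| <= r -> [/\ B x, l (G x - p0) = f x - f p0 &
         `|p0 - G x| <= 2 * `|p0 - x|],
      forall y, `|p0 - y| <= r / 2 -> `|p0 - H y| <= r /\ G (H y) = y,
      forall x y, `|p0 - x| <= r -> `|p0 - y| <= r -> `|x - y| <= 2 * `|G x - G y| &
      forall z w, [/\ l (L z) = z, L (z - w) = L z - L w & `|L z| <= C * normc z]].
Proof.
have [L [C [C0 lL LB LC]]] := right_inverse.
(* L costs a factor C, so this precision in the strict estimate for f makes K half-Lipschitz. *)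
have C2 : 0 < (2 * C)^-1 by rewrite invr_gt0 mulr_gt0.
have [s s0 Hs] := smooth_cplx_strict oB sf Bp0 C2.
have [t t0 Ht] := rV4_nbhs_ball (open_near oB Bp0).
pose r := Num.min s t / 2.
have st0 : 0 < Num.min s t by rewrite lt_min s0.
have r0 : 0 < r by rewrite divr_gt0.
have rst : r < Num.min s t by rewrite ltr_pdivrMr // ltr_pMr // ltr1n.
have rs : r < s by apply: lt_le_trans rst _; rewrite ge_min lexx.
have rt : r < t by apply: lt_le_trans rst _; rewrite ge_min lexx orbT.
clearbody r.
pose K x := L (f x - f p0 - l (x - p0)).
have HK x y : `|p0 - x| <= r -> `|p0 - y| <= r -> `|K x - K y| <= `|x - y| / 2.
  move=> xr yr; rewrite /K -LB.
  have -> : f x - f p0 - l (x - p0) - (f y - f p0 - l (y - p0)) =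
      f x - f y - l (x - y).
    rewrite !lB; generalize (f x) (f y) (f p0) (l x) (l y) (l p0).
    by move=> a b c d e g; ring.
  apply: le_trans (LC _) _.
  have := Hs y x (le_lt_trans yr rs) (le_lt_trans xr rs).
  rewrite -(ler_pM2l C0) => H; apply: le_trans H _.
  by rewrite le_eqVlt; apply/orP; left; apply/eqP; field; rewrite gt_eqF.
have Kp0 : K p0 = 0.
  have l0 : l 0 = 0 by have := lB 0 0; rewrite !subrr.
  have L0 : L 0 = 0 by have := LB 0 0; rewrite !subrr.
  by rewrite /K !subrr l0 subrr L0.
have Hex y : exists x, `|p0 - y| <= r / 2 -> `|p0 - x| <= r /\ x + K x = y.
  have [yr|yr] := pselect (`|p0 - y| <= r / 2); last by exists 0.
  by have [x xr xE] := @contraction_solve R 'rV[R]_4 K p0 r r0 Kp0 HK y yr; exists x.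
have [H HH] := choice Hex.
have p0r : `|p0 - p0| <= r by rewrite subrr normr0 ltW.
exists r, C, (fun x => x + K x), H, L; split=> //.
- by split=> //; rewrite Kp0 addr0.
- move=> x xr; split.
  + exact: Ht (le_lt_trans xr rt).
  + by rewrite addrAC lD /K lL [LHS]addrC subrK.
  + rewrite opprD addrA; apply: le_trans (ler_normB _ _) _.
    have := HK _ _ xr p0r; rewrite Kp0 subr0 distrC => h.
    by have := normr_ge0 (p0 - x); lra.
- move=> x y xr yr /=; have h2 := HK _ _ xr yr.
  have h1 : `|x - y| <= `|x + K x - (y + K y)| + `|K x - K y|.
    have {1}-> : x - y = (x + K x - (y + K y)) - (K x - K y).
      by generalize (K x) (K y) => a b; apply/rowP => j; rewrite !mxE; ring.
    exact: ler_normB.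
  have key (u1 u2 u3 : R) : u3 <= u1 + u2 -> u2 <= u3 / 2 -> u3 <= 2 * u1 by lra.
  exact: key h1 h2.
Qed.

(** The slope is controlled only relative to [0, 1]. Precomposing with the clamp [c], which is
    1-Lipschitz, gives real functions with zero derivative on the whole line, one for Re and one for
    Im. *)
Lemma zero_slope_cst (h : R -> R[i]) :
  (forall s, 0 <= s <= 1 -> forall e : R, 0 < e -> exists2 d : R, 0 < d &
    forall t, 0 <= t <= 1 -> `|t - s| < d -> normc (h t - h s) <= e * `|t - s|) ->
  h 0 = h 1.
Proof.
move=> H.
pose c (s : R) := Num.min (Num.max s 0) 1.
have c01 s : 0 <= c s <= 1.
  by rewrite /c le_min ge_min lexx orbT le_max lexx orbT ler01.
have cL s t : `|c s - c t| <= `|s - t|.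
  have n1 := ler_norm (s - t); have n2 := ler_norm (t - s).
  rewrite distrC in n2; rewrite /c /Order.min /Order.max.
  case: (ltP s 0) => a1; case: (ltP t 0) => a2; case: (ltP s 1) => a3;
    case: (ltP t 1) => a4; rewrite ?ltr01 ler_norml; apply/andP; split; lra.
have D (k : R[i] -> R) : (forall z w, `|k z - k w| <= normc (z - w)) ->
    k (h (c 0)) = k (h (c 1)).
  move=> kL; apply: (@is_derive_0_is_cst R (fun s => k (h (c s)))) => s.
  suff D0 : (fun t : R => t^-1 *: (((fun s => k (h (c s))) \o shift s) (t *: 1)
      - k (h (c s)))) @ 0^' --> (0 : R).
    by split; [apply/cvg_ex; exists 0|exact: cvg_lim].
  apply/cvgrPdist_le => e e0.
  have [d d0 Hd] := H _ (c01 s) e e0.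
  near=> t.
  have t0 : t != 0 by near: t; exact: nbhs_dnbhs_neq.
  have td : `|t| < d by near: t; exact: dnbhs0_lt.
  rewrite sub0r normrN /= normrZ normfV mulrC ler_pdivrMr ?normr_gt0 //.
  rewrite [t *: 1]mulr1; apply: le_trans (kL _ _) _.
  have ct : `|c (t + s) - c s| <= `|t| by have := cL (t + s) s; rewrite addrK.
  apply: le_trans (Hd _ (c01 _) (le_lt_trans ct td)) _.
  by rewrite ler_wpM2l // ltW.
have c0 : c 0 = 0 by rewrite /c maxxx min_l // ler01.
have c1 : c 1 = 1 by rewrite /c max_l ?ler01 // minxx.
move: D; rewrite c0 c1 => D; apply: eq_ReIm; apply: D => z w.
  by rewrite -cReN -cReD; exact: Re_le_normc.
by rewrite -cImN -cImD; exact: Im_le_normc.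
Unshelve. all: by end_near. Qed.

(** Two quarters of e make e/2; the missing factor 2 is spent on the Lipschitz constant of [H]. *)
Let chain_bound (a b c k : R[i]) (e m : R) : 0 < e -> 0 <= m ->
  normc (c - b) <= e / 4 / (1 + normc a) * m -> normc (k - a * b) <= e / 4 * m ->
  normc (k - a * c) <= e / 2 * m.
Proof.
move=> e0 m0 h2 h1; have a1 : 0 < 1 + normc a by rewrite ltr_pwDl // normc_ge0.
have e1 : 0 < e / 4 by rewrite divr_gt0.
have -> : k - a * c = (k - a * b) - a * (c - b) by ring.
apply: le_trans (ler_normcB _ _) _; rewrite ComplexField.Normc.normcM.
have h3 : normc a * normc (c - b) <= e / 4 * m.
  apply: le_trans (ler_wpM2l (normc_ge0 a) h2) _.
  rewrite mulrA ler_wpM2r // mulrC mulrAC ler_pdivrMr //.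
  by rewrite ler_wpM2l ?(ltW e1) // lerDr.
apply: le_trans (lerD h1 h3) _.
by rewrite -mulrDl ler_wpM2r //; lra.
Qed.

(** In the straightened coordinate, g = u o H has differential a l with a complex number a depending
    on the point. Hence g is constant along the kernel of l, and its restriction to the slice p0 +
    L(z - f p0) is a function of z with complex derivative a, because l L = 1. *)
Lemma local_factorization : exists (e d : R) (rho : R[i] -> R[i]),
  [/\ 0 < e, 0 < d,
      forall p, `|p0 - p| < e ->
        [/\ B p, normc (f p - f p0) < d & u p = rho (f p)] &
      forall z, normc (z - f p0) < d -> derivable (rho : Cplx R -> Cplx R) z 1].
Proof.
have [r [C [G [H [L [[r0 C0 Gp0] HG HH Ginj HL]]]]]] := straighten.
pose g y := u (H y).
have Hlip y y' : `|p0 - y| <= r / 2 -> `|p0 - y'| <= r / 2 ->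
    `|H y - H y'| <= 2 * `|y - y'|.
  move=> /HH[yr yE] /HH[y'r y'E]; have := Ginj _ _ yr y'r; by rewrite yE y'E.
have gder y : `|p0 - y| <= r / 2 -> exists a : R[i], forall e : R, 0 < e ->
    exists2 d : R, 0 < d & forall y', `|p0 - y'| <= r / 2 -> `|y' - y| < d ->
      normc (g y' - g y - a * l (y' - y)) <= e * `|y' - y|.
  move=> yr; have [xr xE] := HH _ yr; have [Bx lx _] := HG _ xr.
  have [a aE] := aligned_derive Bx; exists a => e e0.
  have a1 : 0 < 1 + normc a by rewrite ltr_pwDl // normc_ge0.
  have e1 : 0 < e / 4 by rewrite divr_gt0.
  have e2 : 0 < e / 4 / (1 + normc a) by rewrite divr_gt0.
  have [s s0 Hs] := smooth_cplx_strict oB su Bx e1.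
  have [t t0 Ht] := smooth_cplx_strict oB sf Bx e2.
  exists (Num.min s t / 2); first by rewrite divr_gt0 // lt_min s0.
  move=> y' y'r; rewrite ltr_pdivlMr // => yd.
  have [x'r x'E] := HH _ y'r; have [Bx' lx' _] := HG _ x'r.
  have hl := Hlip _ _ y'r yr.
  have hst : `|H y - H y'| < Num.min s t.
    by rewrite distrC; apply: le_lt_trans hl _; rewrite mulrC.
  have hs : `|H y - H y'| < s by apply: lt_le_trans hst _; rewrite ge_min lexx.
  have ht : `|H y - H y'| < t by apply: lt_le_trans hst _; rewrite ge_min lexx orbT.
  have := Hs (H y) (H y'); rewrite subrr normr0 => /(_ s0 hs).
  have := Ht (H y) (H y'); rewrite subrr normr0 => /(_ t0 ht).
  have <- : f (H y') - f (H y) = l (y' - y).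
    have -> : y' - y = (y' - p0) - (y - p0) by rewrite opprB addrA subrK.
    rewrite lB; move: lx lx'; rewrite xE x'E => -> ->.
    by generalize (f (H y)) (f (H y')) (f p0) => ? ? ?; ring.
  rewrite -/(g y) -/(g y') aE.
  move=> h2 h1; apply: le_trans (chain_bound e0 (normr_ge0 _) h2 h1) _.
  have key (x1 x2 : R) : x1 <= 2 * x2 -> e / 2 * x1 <= e * x2.
    by move=> x12; rewrite -mulrA ler_pM2l //; lra.
  by apply: key; rewrite distrC [leRHS]mulrC distrC mulrC.
have gfib y y' : `|p0 - y| <= r / 2 -> `|p0 - y'| <= r / 2 -> l (y' - y) = 0 ->
    g y = g y'.
  (* The ball is convex, so the segment between the two points stays in it, and g has zero slope
     along it. *)
  move=> yr y'r ly.
  have segr s : 0 <= s <= 1 -> `|p0 - (y + s *: (y' - y))| <= r / 2.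
    move=> /andP[s0 s1].
    have -> : p0 - (y + s *: (y' - y)) = (1 - s) *: (p0 - y) + s *: (p0 - y').
      by apply/rowP => j; rewrite !mxE; ring.
    apply: le_trans (ler_normD _ _) _; rewrite !normrZ (ger0_norm s0).
    rewrite ger0_norm ?subr_ge0 //.
    have -> : r / 2 = (1 - s) * (r / 2) + s * (r / 2) by ring.
    by rewrite lerD // ler_wpM2l // subr_ge0.
  have := @zero_slope_cst (fun s => g (y + s *: (y' - y))).
  rewrite scale0r addr0 scale1r [y + (y' - y)]addrC subrK; apply=> s s01 e e0.
  have [a Ha] := gder _ (segr _ s01).
  have k0 : 0 < 1 + `|y' - y| by rewrite ltr_pwDl.
  have [d d0 Hd] := Ha _ (divr_gt0 e0 k0).
  exists (d / (1 + `|y' - y|)); first by rewrite divr_gt0.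
  move=> t t01 ts.
  have E : y + t *: (y' - y) - (y + s *: (y' - y)) = (t - s) *: (y' - y).
    by apply/rowP => j; rewrite !mxE; ring.
  have := Hd _ (segr _ t01); rewrite E lZ ly !mulr0 subr0 normrZ => hd.
  apply: le_trans (hd _) _.
    apply: le_lt_trans (_ : `|t - s| * (1 + `|y' - y|) < d).
      by rewrite ler_wpM2l // lerDr.
    by rewrite -ltr_pdivlMr.
  rewrite mulrCA [leRHS]mulrC ler_wpM2l // -mulrA ler_piMr ?(ltW e0) //.
  by rewrite mulrC ler_pdivrMr // mul1r lerDr.
have [M M0 HM] := cderive_bounded oB sf Bp0.
(* This keeps the slice over the disc of radius d inside the ball of radius r/2 on which [H] inverts
   [G]. *)
pose d := r / 2 / C.
have d0 : 0 < d by rewrite !divr_gt0.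
have zr z : normc (z - f p0) < d -> `|p0 - (p0 + L (z - f p0))| <= r / 2.
  rewrite opprD addrA subrr sub0r normrN => zd.
  have [_ _ Lz] := HL (z - f p0) 0; apply: le_trans Lz _.
  by rewrite mulrC -ler_pdivlMr // ltW.
(* Since G at most doubles distances to p0, the first bound puts G p within r/2, and the second
   gives |f p - f p0| = |l (G p - p0)| < d. *)
pose e := Num.min (r / 4) (d / (2 * M)).
have e0 : 0 < e by rewrite lt_min !divr_gt0 // mulr_gt0.
exists e, d, (fun z => g (p0 + L (z - f p0))); split=> // [p pe|z zd].
  have pr4 : `|p0 - p| < r / 4 by apply: lt_le_trans pe _; rewrite ge_min lexx.
  have pdM : `|p0 - p| < d / (2 * M).
    by apply: lt_le_trans pe _; rewrite ge_min lexx orbT.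
  have pr : `|p0 - p| <= r by lra.
  have [Bp lp Gp] := HG _ pr.
  have Gpr : `|p0 - G p| <= r / 2 by lra.
  have fd : normc (f p - f p0) < d.
    rewrite -lp; apply: le_lt_trans (HM _) _; rewrite distrC.
    apply: le_lt_trans (_ : M * (2 * `|p0 - p|) < d).
      by rewrite ler_wpM2l // ltW.
    by rewrite mulrCA mulrA mulrC -ltr_pdivlMr // mulr_gt0.
  split=> //.
  (* G p and the slice point over f p have the same image under l, so g agrees on them; and H (G p)
     = p by injectivity of G. *)
  rewrite -(gfib (G p)) //; last 2 first.
  - exact: zr.
  - have [lL _ _] := HL (f p - f p0) 0.
    have -> : p0 + L (f p - f p0) - G p = L (f p - f p0) - (G p - p0).
      by rewrite opprB [RHS]addrCA addrA.
    by rewrite lB lL lp subrr.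
  rewrite /g; congr u; have [HGr HGE] := HH _ Gpr.
  apply/eqP; rewrite -subr_eq0 -normr_le0.
  by apply: le_trans (Ginj _ _ pr HGr) _; rewrite HGE subrr normr0 mulr0.
have [a Ha] := gder _ (zr _ zd).
suff : is_derive (z : Cplx R) 1
    ((fun z => g (p0 + L (z - f p0))) : Cplx R -> Cplx R) a by case.
apply/Cplx_derive_epsP => eps eps0.
have [t t0 Ht] := Ha _ (divr_gt0 eps0 C0).
have dz : 0 < d - normc (z - f p0) by rewrite subr_gt0.
exists (Num.min (t / C) (d - normc (z - f p0))); first by rewrite lt_min dz divr_gt0.
move=> w; rewrite lt_min => /andP[wt wd].
have wfd : normc (w - f p0) < d.
  have -> : w - f p0 = (w - z) + (z - f p0) by rewrite addrA subrK.
  by apply: le_lt_trans (le_normcD _ _) _; rewrite -ltrBrDr.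
have [lL LBE LC] := HL (w - z) 0.
have E : p0 + L (w - f p0) - (p0 + L (z - f p0)) = L (w - z).
  rewrite opprD addrACA subrr add0r.
  have [_ <- _] := HL (w - f p0) (z - f p0).
  by congr L; rewrite opprB addrA subrK.
have := Ht _ (zr _ wfd); rewrite E lL => h.
apply: le_trans (h _) _.
  by apply: le_lt_trans LC _; rewrite mulrC -ltr_pdivlMr.
apply: le_trans (ler_wpM2l (ltW (divr_gt0 eps0 C0)) LC) _.
by rewrite mulrA divfK // gt_eqF.
Qed.

End LocalFactorization.

(** * Constancy of the direction and of f along null lines *)

Section LineConstancy.
Variable R : realType.

Let le_sum2 (F : 'I_4 -> 'I_4 -> R) i j : (forall i j, 0 <= F i j) ->
  F i j <= \sum_i \sum_j F i j.
Proof.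
move=> F0; rewrite (bigD1 i) //= (bigD1 j) //= -addrA lerDl addr_ge0 ?sumr_ge0 //.
by move=> k _; rewrite sumr_ge0.
Qed.

Let le_sum1 (F : 'I_4 -> R) j : (forall j, 0 <= F j) -> F j <= \sum_j F j.
Proof. by move=> F0; rewrite (bigD1 j) //= lerDl sumr_ge0. Qed.

Lemma continuous_linear_path (p v : 'rV[R]_4) : continuous (fun s : R => p + s *: v).
Proof.
move=> s; apply: (@cvgD _ _ _ (nbhs s) _ (cst p) (fun s => s *: v)).
  exact: cvg_cst.
exact: scalel_continuous.
Qed.

(* A Gronwall argument: the slope of U along the line is controlled by the
   variation of U itself. *)
Lemma line_constant (U : 'I_4 -> 'rV[R]_4 -> R) (B : set 'rV[R]_4)
    (p v : 'rV[R]_4) : open B -> (forall j, smooth_on B (U j)) -> B p ->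
  (forall q j, B q ->
    'D_v (U j) q = \sum_i (U i p - U i q) * partial i (U j) q) ->
  exists2 e : R, 0 < e & forall s : R, `|s| <= e ->
    B (p + s *: v) /\ forall j, U j (p + s *: v) = U j p.
Proof.
move=> oB sU Bp U_slope.
pose C := 1 + \sum_i \sum_j `|partial i (U j) p|.
have C0 : 0 < C.
  by rewrite ltr_pwDl // sumr_ge0 // => i _; rewrite sumr_ge0.
have nearC : \forall q \near p, B q /\ forall i j, `|partial i (U j) q| <= C.
  have nij i j : \forall q \near p, `|partial i (U j) q| <= C.
    have [cij _] := sU j [:: i] p Bp.
    have nh : \forall q \near p, `|partial i (U j) p - partial i (U j) q| <= 1.
      by move/cvgrPdist_le : cij => /(_ 1 ltr01).
    near=> q; have h : `|partial i (U j) p - partial i (U j) q| <= 1 by near: q.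
    have hC : 1 + `|partial i (U j) p| <= C.
      rewrite lerD2l.
      exact: (@le_sum2 (fun i j => `|partial i (U j) p|) i j (fun _ _ => normr_ge0 _)).
    apply: le_trans hC; rewrite addrC -lerBlDl.
    by apply: le_trans h; rewrite distrC; exact: lerB_dist.
  near=> q; split; first by near: q; exact: open_near.
  move=> i; move: i; near: q.
  have nj i : \forall q \near p, forall j, `|partial i (U j) q| <= C.
    near=> q => j; move: j; near: q; apply: filter_forall => j; exact: nij.
  by apply: filter_forall => i; exact: nj.
have [r r0 Hr] := rV4_nbhs_ball nearC.
have w1 : 0 < 1 + `|v| by rewrite ltr_pwDl.
(* The first bound keeps the segment where all partial derivatives are at most C; the second makes d
   times 5 C less than 1, so that the inequality m c <= d (5 C) m c at a maximum c of the variation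
   forces m c = 0. *)
pose d := Num.min (r / (1 + `|v|)) (5 * C)^-1 / 2.
have m0 : 0 < Num.min (r / (1 + `|v|)) (5 * C)^-1.
  by rewrite lt_min divr_gt0 // invr_gt0 mulr_gt0.
have d0 : 0 < d by rewrite divr_gt0.
have dm : d < Num.min (r / (1 + `|v|)) (5 * C)^-1.
  by rewrite ltr_pdivrMr // ltr_pMr // ltr1n.
have dr : d < r / (1 + `|v|) by apply: lt_le_trans dm _; rewrite ge_min lexx.
have dC : d * (5 * C) < 1.
  rewrite -ltr_pdivlMr ?mulr_gt0 // div1r.
  by apply: lt_le_trans dm _; rewrite ge_min lexx orbT.
clearbody d.
have inr s : `|s| <= d -> B (p + s *: v) /\
    forall i j, `|partial i (U j) (p + s *: v)| <= C.
  move=> sd; apply: Hr; rewrite opprD addrA subrr sub0r normrN normrZ.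
  apply: le_lt_trans (_ : d * (1 + `|v|) < r); last by rewrite -ltr_pdivlMr.
  by apply: ler_pM => //; rewrite lerDr.
have scale1 (s h : R) : 0 <= s <= 1 -> `|h| <= d -> `|s * h| <= d.
  move=> /andP[s0 s1] hd; rewrite normrM (ger0_norm s0).
  by apply: le_trans hd; rewrite ler_piMl.
pose m s := \sum_j `|U j (p + s *: v) - U j p|.
have mcont : {within `[- d, d], continuous m}.
  apply: continuous_in_subspaceT => s; rewrite inE /= in_itv /= => sd.
  have [Bs _] : _ /\ _ := inr s (etrans (ler_norml _ _) sd).
  have cV j : `|U j (p + t *: v) - U j p| @[t --> s] --> `|U j (p + s *: v) - U j p|.
    apply: cvg_norm; apply: cvgB; last exact: cvg_cst.
    have dU := @smooth_derivable _ B (U j) _ (v) oB (sU j) Bs.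
    exact: (is_derive_continuous (is_derive_line dU)).
  rewrite /m; have -> : (fun s => \sum_j `|U j (p + s *: v) - U j p|) =
    (fun s => `|U 0 (p + s *: v) - U 0 p| +
      `|U (lift ord0 0) (p + s *: v) - U (lift ord0 0) p| +
      `|U (lift ord0 1) (p + s *: v) - U (lift ord0 1) p| +
      `|U (lift ord0 2%:R) (p + s *: v) - U (lift ord0 2%:R) p|).
    by apply/funext => t; rewrite sum4.
  exact: cvgD (cvgD (cvgD (cV _) (cV _)) (cV _)) (cV _).
have dd : - d <= d by rewrite ge0_cp // ltW.
have [c cd cmax] := EVT_max dd mcont.
have cd' : `|c| <= d by move: cd; rewrite in_itv /= ler_norml.
have slope j q s : `|s| <= d -> q = p + s *: v -> `|'D_(v) (U j) q| <= C * m c.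
  move=> sd ->; have [Bs Cs] := inr _ sd; rewrite (U_slope _ _ Bs).
  apply: le_trans (ler_norm_sum _ _ _) _.
  apply: le_trans (_ : C * m s <= _); last first.
    by rewrite ler_pM2l //; apply: cmax; rewrite in_itv /= -ler_norml.
  rewrite /m mulr_sumr; apply: ler_sum => i _.
  by rewrite normrM mulrC distrC ler_wpM2r.
have mc0 : m c = 0.
  have H j : `|U j (p + c *: v) - U j p| <= d * (C * m c).
    have [s s01|s s01 ->] := @MVT_line R _ (U j) p (v) c.
      have [Bs _] := inr _ (scale1 _ _ s01 cd').
      exact: (@smooth_derivable _ B (U j) _ (v) oB (sU j) Bs).
    rewrite normrM ler_pM //; apply: slope (scale1 _ _ s01 cd') _; by [].
  have : m c <= (d * (5 * C)) * m c.
    rewrite {1}/m sum4.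
    have m0' : 0 <= m c by rewrite sumr_ge0.
    have h : 0 <= d * (C * m c) by rewrite !mulr_ge0 // ltW.
    have -> : d * (5 * C) * m c = 5 * (d * (C * m c)) by ring.
    have key (a1 a2 a3 a4 x : R) : 0 <= x -> a1 <= x -> a2 <= x -> a3 <= x ->
      a4 <= x -> a1 + a2 + a3 + a4 <= 5 * x by lra.
    exact: key h (H _) (H _) (H _) (H _).
  have m0' : 0 <= m c by rewrite sumr_ge0.
  have [->//|mn0] := eqVneq (m c) 0.
  by rewrite ler_pMl ?lt_def ?mn0 // leNgt dC.
exists d => // s sd; have [Bs _] := inr _ sd; split=> // j.
apply/eqP; rewrite -subr_eq0 -normr_le0.
have : m s <= 0 by rewrite -mc0; apply: cmax; rewrite in_itv /= -ler_norml.
apply: le_trans.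
exact: (@le_sum1 (fun j => `|U j (p + s *: v) - U j p|) j (fun _ => normr_ge0 _)).
Unshelve. all: by end_near. Qed.

End LineConstancy.

Section AlongNullLines.
Variable R : realType.
Variables (f : 'rV[R]_4 -> R[i]) (B : set 'rV[R]_4) (oB : open B).
Hypothesis sf : smooth_cplx_on B f.
Hypothesis hf : forall p, B p -> harmonic_at f p.
Hypothesis al : aligned f B.

Let U j q : R := null_dir f q 0 j.
Let sU j : smooth_on B (U j) := null_dir_smooth oB sf al j.
Let w p : 'rV[R]_4 := delta_mx 0 0 + null_dir f p.

Let wE p i : w p 0 i = (delta_mx 0 0 : 'rV[R]_4) 0 i + U i p.
Proof. exact: mxE. Qed.

Let U_killed p j : B p -> 'D_(w p) (U j) p = 0.
Proof.
move=> Bp; have [dU [dU0 _ _ dUE]] := null_dir_derive oB sf al Bp.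
have := dUE (w p); rewrite (null_dir_killed oB sf hf al Bp) dU0.
rewrite (null_dir_derive_row oB sf al (w p) Bp) => /rowP /(_ j).
by rewrite !mxE.
Qed.

(** At q the field is constant along its own null vector w q, so the derivative along w p only sees
    w p - w q = U p - U q. *)
Let U_slope p q j : B q ->
  'D_(w p) (U j) q = \sum_i (U i p - U i q) * partial i (U j) q.
Proof.
move=> Bq.
have E := etrans (esym (@smooth_derive _ B (U j) q (w q) oB (sU j) Bq)) (U_killed j Bq).
apply: (etrans (@smooth_derive _ B (U j) q (w p) oB (sU j) Bq)).
apply: (etrans (esym (subr0 _))); rewrite -[X in _ - X = _]E -sumrB.
by apply: eq_bigr => i _; rewrite !wE -mulrBl opprD addrACA subrr add0r.
Qed.

(** Once U is constant on the segment, w p is the null vector at each of its points; df kills it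
    there, so f is constant too. *)
Lemma null_dir_line p : B p -> exists2 e : R, 0 < e & forall s : R, `|s| < e ->
  [/\ B (p + s *: w p), null_dir f (p + s *: w p) = null_dir f p &
      f (p + s *: w p) = f p].
Proof.
move=> Bp.
have [d d0 Hd] := line_constant oB sU Bp (fun q j => @U_slope p q j).
have inr s (sd : `|s| <= d) : B (p + s *: w p) by have [] := Hd s sd.
have scale1 (s h : R) : 0 <= s <= 1 -> `|h| <= d -> `|s * h| <= d.
  move=> /andP[s0 s1] hd; rewrite normrM (ger0_norm s0).
  by apply: le_trans hd; rewrite ler_piMl.
have Uc s : `|s| <= d -> null_dir f (p + s *: w p) = null_dir f p.
  by move=> sd; apply/rowP => j; have [_ /(_ j)] := Hd s sd.
exists d; first exact: d0.
move=> s /ltW sd; have Bs := inr _ sd; split; [exact: Bs|exact: Uc|].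
have kill t : `|t| <= d -> cderive (w p) f (p + t *: w p) = 0.
  move=> td; have := null_dir_killed oB sf hf al (inr _ td); by rewrite (Uc _ td).
apply: eq_ReIm; apply/eqP; rewrite -subr_eq0; apply/eqP.
  have [t t01|t t01 ->] := @MVT_line R _ (fun q => complex.Re (f q)) p (w p) s.
    exact: smooth_derivable oB sf.1 (inr _ (scale1 _ _ t01 sd)).
  have := kill _ (scale1 _ _ t01 sd) => /(congr1 (@complex.Re R)) /= ->.
  by rewrite mulr0.
have [t t01|t t01 ->] := @MVT_line R _ (fun q => complex.Im (f q)) p (w p) s.
  exact: smooth_derivable oB sf.2 (inr _ (scale1 _ _ t01 sd)).
have := kill _ (scale1 _ _ t01 sd) => /(congr1 (@complex.Im R)) /= ->.
by rewrite mulr0.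
Qed.

End AlongNullLines.

(** * Null lines and fibre components *)

Section ConnectedPredicates.
Variable T : topologicalType.

(** P is locally constant on C, so the part of C where it holds is relatively clopen. The open sets
    required are interiors of P or its negation enlarged by the complement of C. *)
Lemma connected_pred (C : set T) (P : T -> Prop) (x0 : T) :
  connected C -> C x0 -> P x0 ->
  (forall x, C x -> P x -> \forall y \near x, C y -> P y) ->
  (forall x, C x -> ~ P x -> \forall y \near x, C y -> ~ P y) ->
  forall x, C x -> P x.
Proof.
move=> cC Cx0 Px0 HP HN x Cx.
suff : C `&` [set x | P x] = C by move=> /seteqP[_ /(_ _ Cx)] [].
apply: cC; first by exists x0.
  exists [set x | P x \/ ~ C x]^°; first exact: open_interior.
  apply/seteqP; split=> y [Cy].
    move=> /= Py; split=> //; have := HP y Cy Py; apply: filterS => z Hz.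
    by have [Cz|nCz] := pselect (C z); [left; exact: Hz|right].
  by move=> /interior_subset [].
exists (~` [set x | ~ P x \/ ~ C x]^°); first exact/open_closedC/open_interior.
apply/seteqP; split=> y [Cy].
  by move=> /= Py; split=> // /interior_subset [].
move=> nI; split=> //=; apply: contrapT => nP; apply: nI.
have := HN y Cy nP; apply: filterS => z Hz.
by have [Cz|nCz] := pselect (C z); [left; exact: Hz|right].
Qed.

End ConnectedPredicates.

Section Leaves.
Variables (R : realType) (N : riemann_surface R).
Variables (A : set 'rV[R]_4) (U : 'rV[R]_4 -> 'rV[R]_4) (phi : 'rV[R]_4 -> N).
Hypothesis U_unit : forall p, A p -> tcoord (U p) = 0 /\ minkowski (U p) (U p) = 1.
Hypothesis U_cont : forall p, A p -> {for p, continuous U}.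

Let w p : 'rV[R]_4 := delta_mx 0 0 + U p.

Hypothesis along_line : forall p, A p -> exists2 e : R, 0 < e &
  forall s : R, `|s| < e ->
  [/\ A (p + s *: w p), U (p + s *: w p) = U p & phi (p + s *: w p) = phi p].
Hypothesis along_fibre : forall p, A p -> exists2 e : R, 0 < e &
  forall q, `|p - q| < e -> phi q = phi p -> U q = U p.

Let line p : set 'rV[R]_4 := [set q | exists s : R, q = p + s *: w p].

(** The line may leave A and return where U points elsewhere; only the piece through p is a leaf. *)
Definition leaf p : set 'rV[R]_4 := connected_component (A `&` line p) p.

Let w_t p : A p -> w p 0 0 = 1.
Proof.
move=> Ap; have [U0 _] := U_unit Ap.
by rewrite !mxE eqxx -[U p 0 0]/(tcoord (U p)) U0 addr0.
Qed.

Lemma leaf_sub p q : leaf p q -> A q.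
Proof. by move=> /connected_component_sub []. Qed.

Lemma leaf_refl p : A p -> leaf p p.
Proof.
move=> Ap; apply: connected_component_refl; split=> //.
by exists 0; rewrite scale0r addr0.
Qed.

(** Connectedness. Where U x = U p, the null line at x is the given line, so [along_line] propagates
    both equalities and also their failure in [phi]. Where U x differs from U p, the null line at x
    is another one, and continuity of U is used instead. *)
Lemma leaf_const p q : leaf p q -> U q = U p /\ phi q = phi p.
Proof.
move=> Lq; have Ap : A p.
  apply: contrapT => nA; move: Lq; rewrite /leaf connected_component_out //.
  by move=> [].
pose P q := U q = U p /\ phi q = phi p.
have near_line x : leaf p x -> U x = U p ->
    \forall y \near x, leaf p y -> U y = U p /\ phi y = phi x.
  move=> Lx Ux; have [e e0 He] := along_line (leaf_sub Lx).
  have : \forall y \near x, `|x - y| < e.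
    by apply/nbhs_ballP; exists e => // y; rewrite rV4_ball.
  apply: filterS => y xy Ly.
  have [_ [s xE]] := connected_component_sub Lx.
  have [_ [t yE]] := connected_component_sub Ly.
  have wx : w x = w p by rewrite /w Ux.
  have yx : y = x + (t - s) *: w x.
    by rewrite wx yE xE -addrA -scalerDl [s + _]addrC subrK.
  (* The time component of w is 1, so the parameter distance is at most the distance of the
     points. *)
  have ts : `|t - s| < e.
    apply: le_lt_trans xy; have := rV4_coord_le (x - y) 0.
    rewrite yx opprD addrA subrr sub0r mxE mxE wx w_t //.
    rewrite mulr1 normrN.
    exact.
  by have [_ Uy py] := He _ ts; rewrite yx Uy py Ux.
apply: (@connected_pred _ (leaf p) P p) Lq => //.
- exact: component_connected.
- exact: leaf_refl.
- move=> x Lx [Ux px]; apply: filterS (near_line _ Lx Ux) => y Hy /Hy [Uy py].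
  by split=> //; rewrite py px.
move=> x Lx nP; have [Ux|Ux] := eqVneq (U x) (U p).
  apply: filterS (near_line _ Lx Ux) => y Hy /Hy [Uy py] [_ py'].
  by apply: nP; split=> //; rewrite -py py'.
have cU := U_cont (leaf_sub Lx).
have d0 : U x - U p != 0 by rewrite subr_eq0.
have : \forall y \near x, U y - U p != 0.
  have cc : U y - U p @[y --> x] --> U x - U p.
    by apply: (@cvgB _ _ _ (nbhs x) _ U (cst (U p))); [exact: cU|exact: cvg_cst].
  exact: cvgr_neq0 cc d0.
by apply: filterS => y yp _ [Uy _]; move: yp; rewrite Uy subrr eqxx.
Qed.

Lemma leaf_eq p q : leaf p q -> leaf q = leaf p.
Proof.
move=> Lq; have [Uq _] := leaf_const Lq; rewrite /leaf.
have [_ [s qE]] := connected_component_sub Lq.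
have -> : line q = line p.
  have wq : w q = w p by rewrite /w Uq.
  rewrite /line wq qE; apply/seteqP; split=> x [t ->].
    by exists (s + t); rewrite scalerDl addrA.
  by exists (t - s); rewrite -addrA -scalerDl [s + _]addrC subrK.
by rewrite (same_connected_component Lq).
Qed.

Lemma leaf_null_piece p : A p -> open_null_piece (w p) (leaf p).
Proof.
move=> Ap; have [U0 UU] := U_unit Ap.
have wt := w_t Ap.
split.
- by apply: contra_eq_neq wt => ->; rewrite mxE eq_sym oner_eq0.
- have wi (i : 'I_3) : w p 0 (lift ord0 i) = U p 0 (lift ord0 i).
    by rewrite !mxE eqxx /= add0r.
  move: UU; rewrite !minkowskiE wt !wi; rewrite /tcoord in U0.
  rewrite U0 mul0r oppr0 add0r => ->; by rewrite mulr1 addNr.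
exists p, [set s | leaf p (p + s *: w p)]; split.
- rewrite openE => s /= Ls; have [e e0 He] := along_line (leaf_sub Ls).
  have [Us _] := leaf_const Ls.
  have ws : w (p + s *: w p) = w p by rewrite /w Us.
  rewrite /interior; apply/nbhs_ballP; exists e => // t st.
  rewrite /= -(leaf_eq Ls).
  pose I := [set t : R | `|t| < e].
  have cI : connected I.
    apply/connected_intervalP => a b /= ae be z /andP[az zb].
    move: ae be; rewrite /I /= !ltr_norml => /andP[? ?] /andP[? ?].
    by apply/andP; split; [apply: lt_le_trans az|apply: le_lt_trans zb _].
  set x := p + s *: w p in Ls He Us ws *.
  have cJ : connected [set x + t *: w x | t in I].
    apply: connected_continuous_connected => //.
    by apply: continuous_subspaceT => u; exact: continuous_linear_path.
  apply: (connected_component_max _ _ cJ).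
  + by exists 0; rewrite /I /= ?normr0 // scale0r addr0.
  + move=> y [u Iu <-]; split; first by have [] := He _ Iu.
    by exists u.
  + exists (t - s).
      rewrite /I /=; move: st; rewrite -ball_normE /= distrC; exact.
    by rewrite ws /x -addrA -scalerDl [s + _]addrC subrK.
- apply/connected_intervalP.
  (* The parameter is recovered as a difference of times, so the parameter set is a continuous image
     of the connected leaf. *)
  have -> : [set s | leaf p (p + s *: w p)] =
      [set q 0 0 - p 0 0 | q in leaf p].
    apply/seteqP; split=> [s Ls|s [q Lq <-]] /=.
      exists (p + s *: w p) => //.
      by rewrite mxE mxE wt mulr1 [p 0 0 + s]addrC addrK.
    have [_ [t qE]] := connected_component_sub Lq.
    suff -> : p + (q 0 0 - p 0 0) *: w p = q by [].
    by rewrite qE mxE mxE wt mulr1 [p 0 0 + t]addrC addrK.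
  apply: connected_continuous_connected; first exact: component_connected.
  apply: continuous_subspaceT => q.
  apply: (@cvgB _ _ _ (nbhs q) _ (fun q : 'rV[R]_4 => q 0 0) (cst (p 0 0))).
    exact: coord_continuous.
  exact: cvg_cst.
- by exists 0; rewrite /= scale0r addr0; exact: leaf_refl.
apply/seteqP; split=> [q Lq|q [s Ls <-]//].
have [_ [s qE]] := connected_component_sub Lq.
by exists s => //=; rewrite -qE.
Qed.

Definition null_line_foliation : ray_foliation R := RayFoliation (leaf @` A) U.

Lemma null_line_foliationP : smooth_field_on A U ->
  null_foliation_on A null_line_foliation.
Proof.
move=> sU; split=> //=.
- apply/seteqP; split=> [q [_ [p Ap <-]] /leaf_sub//|p Ap].
  by exists (leaf p); [exists p|exact: leaf_refl].
- by move=> _ _ [p Ap <-] [q Aq <-] [x [/leaf_eq <- /leaf_eq <-]].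
move=> _ [p Ap <-]; exists (w p); split; first exact: leaf_null_piece.
move=> q Lq; exists 1; have [Uq _] := leaf_const Lq.
by rewrite scale1r /tangent_field /= Uq.
Qed.

(** By [along_fibre] and connectedness U is constant on the component, so the leaves through its
    points are parallel; each is connected and inside one fibre, so it does not leave the
    component. *)
Lemma fibre_component_leaves p : A p -> exists S : set (set 'rV[R]_4),
  [/\ S `<=` leaves null_line_foliation, parallel_leaves S &
      fibre_component A phi p = \bigcup_(L in S) L].
Proof.
move=> Ap; set F := fibre_component A phi p.
have Fp : F p by apply: connected_component_refl.
have FA q : F q -> A q /\ phi q = phi p by move=> /connected_component_sub.
have FU q : F q -> U q = U p.
  move=> Fq.
  apply: (@connected_pred _ F (fun q => U q = U p) p) Fq => //.
  - exact: component_connected.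
  - move=> x Fx Ux; have [Ax px] := FA _ Fx; have [e e0 He] := along_fibre Ax.
    have : \forall y \near x, `|x - y| < e.
      by apply/nbhs_ballP; exists e => // y; rewrite rV4_ball.
    apply: filterS => y xy /FA [_ py]; rewrite -Ux; apply: He => //.
    by rewrite py px.
  move=> x Fx Ux; have [Ax px] := FA _ Fx; have [e e0 He] := along_fibre Ax.
  have : \forall y \near x, `|x - y| < e.
    by apply/nbhs_ballP; exists e => // y; rewrite rV4_ball.
  apply: filterS => y xy /FA [_ py] Uy; apply: Ux; rewrite -Uy.
  by apply/esym/He => //; rewrite py px.
exists (leaf @` F); split.
- by move=> _ [q /FA[Aq _] <-]; exists q.
- exists (w p) => _ [q Fq <-].
  have -> : w p = w q by rewrite /w FU.
  by apply: leaf_null_piece; have [] := FA _ Fq.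
apply/seteqP; split=> [q Fq|q [_ [x Fx <-]] Lq].
  by exists (leaf q); [exists q|apply: leaf_refl; have [] := FA _ Fq].
rewrite /F /fibre_component (same_connected_component Fx).
have [Ax px] := FA _ Fx.
suff sub : leaf x `<=` connected_component (A `&` phi @^-1` [set phi p]) x.
  exact: sub.
apply: connected_component_max; first exact: leaf_refl.
  move=> y Ly; split; first exact: leaf_sub Ly.
  by have [_ py] := leaf_const Ly; rewrite /= py px.
exact: component_connected.
Qed.

End Leaves.

(** * The congruence of a harmonic morphism *)

Section Holomorphic.
Variable R : realType.
Implicit Types (g h : Cplx R -> Cplx R) (z : Cplx R).

Lemma Cplx_derivable_epsP g z : derivable g z 1 <-> exists l : R[i],
  forall e : R, 0 < e -> exists2 r : R, 0 < r & forall w, normc (w - z) < r ->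
    normc (g w - g z - l * (w - z)) <= e * normc (w - z).
Proof.
split=> [/derivableP dg|[l H]].
  by exists ('D_1 g z); apply/Cplx_derive_epsP.
by have [] : is_derive z 1 g l by apply/Cplx_derive_epsP.
Qed.

Lemma Cplx_derivable_bound g z : derivable g z 1 ->
  exists K r : R, [/\ 0 < K, 0 < r &
    forall w, normc (w - z) < r -> normc (g w - g z) <= K * normc (w - z)].
Proof.
move=> /Cplx_derivable_epsP [l /(_ 1 ltr01)[r r0 Hr]].
exists (1 + normc l), r; split=> //; first by rewrite ltr_pwDl // normc_ge0.
move=> w /Hr h.
have -> : g w - g z = (g w - g z - l * (w - z)) + l * (w - z) by rewrite subrK.
apply: le_trans (le_normcD _ _) _.
by rewrite mulrDl lerD // ComplexField.Normc.normcM.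
Qed.

Lemma Cplx_derivable_comp g h z : derivable h z 1 -> derivable g (h z) 1 ->
  derivable (g \o h) z 1.
Proof.
move=> dh; have [K [s [K0 s0 HK]]] := Cplx_derivable_bound dh.
move: dh => /Cplx_derivable_epsP [m Hm] /Cplx_derivable_epsP [l Hl].
apply/Cplx_derivable_epsP; exists (l * m) => e e0.
have e2 : 0 < e / 2 by rewrite divr_gt0.
have l1 : 0 < 1 + normc l by rewrite ltr_pwDl // normc_ge0.
have [r r0 Hr] := Hm _ (divr_gt0 e2 l1).
have [t t0 Ht] := Hl _ (divr_gt0 e2 K0).
exists (Num.min (Num.min r s) (t / K)); first by rewrite !lt_min r0 s0 divr_gt0.
move=> w; rewrite !lt_min -andbA => /and3P[/Hr hr /HK hK wt].
have Dt : normc (h w - h z) < t.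
  by apply: le_lt_trans hK _; rewrite mulrC -ltr_pdivlMr.
have ht := Ht _ Dt.
have -> : (g \o h) w - (g \o h) z - l * m * (w - z) =
    (g (h w) - g (h z) - l * (h w - h z)) + l * (h w - h z - m * (w - z)).
  by rewrite /=; generalize (g (h w)) (g (h z)) (h w) (h z) => a b c d; ring.
apply: le_trans (le_normcD _ _) _.
rewrite [e]splitr mulrDl; apply: lerD.
  apply: le_trans ht _.
  apply: le_trans (ler_wpM2l (ltW (divr_gt0 e2 K0)) hK) _.
  by rewrite mulrA divfK // gt_eqF.
rewrite ComplexField.Normc.normcM.
apply: le_trans (ler_wpM2l (normc_ge0 _) hr) _.
rewrite mulrA ler_wpM2r ?normc_ge0 // mulrC mulrAC ler_pdivrMr //.
by rewrite ler_wpM2l ?(ltW e2) // lerDr.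
Qed.

Lemma Cplx_derivable_continuous g z : derivable g z 1 -> {for z, continuous g}.
Proof.
move=> /Cplx_derivable_bound [K [r [K0 r0 HK]]] P /Cplx_nbhs_normc [t t0 HP].
apply/Cplx_nbhs_normc; exists (Num.min r (t / K)); first by rewrite lt_min r0 divr_gt0.
move=> w; rewrite lt_min normc_distC => /andP[/HK h wt]; apply: HP.
by rewrite normc_distC; apply: le_lt_trans h _; rewrite mulrC -ltr_pdivlMr.
Qed.

(** The remainder of 1/w at a is exactly (w - a)^2 / (a^2 w), and |w| >= |a|/2 near a. *)
Lemma Cplx_derivableV g z : g z != 0 -> derivable g z 1 ->
  derivable ((fun w => (g w)^-1) : Cplx R -> Cplx R) z 1.
Proof.
move=> g0 dg; apply: (@Cplx_derivable_comp (fun w => w^-1) g z dg).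
set a := g z in g0 *; apply/Cplx_derivable_epsP; exists (- (a * a)^-1) => e e0.
have na0 : 0 < normc a.
  rewrite lt_def normc_ge0 andbT; apply: contra g0 => /eqP.
  by move=> /ComplexField.Normc.eq0_normc ->.
have n3 : 0 < e * (normc a * normc a * (normc a / 2)) by rewrite !mulr_gt0 // invr_gt0.
exists (Num.min (normc a / 2) (e * (normc a * normc a * (normc a / 2)))).
  by rewrite lt_min n3 divr_gt0.
move=> w; rewrite lt_min => /andP[w1 w2].
have wa : normc a / 2 <= normc w.
  have : normc a <= normc (w - a) + normc w.
    rewrite -[in leLHS](subrK w a) -[normc (w - a)]normc_distC; exact: le_normcD.
  lra.
have w0 : w != 0.
  apply/eqP => w0; move: wa; rewrite w0 ComplexField.Normc.normc0; lra.
have -> : w^-1 - a^-1 - - (a * a)^-1 * (w - a) = (w - a) * (w - a) / (a * a * w).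
  by field; rewrite g0 w0.
rewrite !(ComplexField.Normc.normcM, ComplexField.Normc.normcV) -mulrA mulrC.
rewrite ler_wpM2r ?normc_ge0 //.
have p0 : 0 < normc a * normc a * normc w.
  by rewrite !mulr_gt0 //; apply: lt_le_trans wa; rewrite divr_gt0.
rewrite ler_pdivrMr //; apply: le_trans (ltW w2) _.
rewrite ler_pM2l // ler_pM2l // mulr_gt0 //.
Qed.

Lemma Cplx_derivable_conj g z : derivable g (conjc z) 1 ->
  derivable ((fun w => conjc (g (conjc w))) : Cplx R -> Cplx R) z 1.
Proof.
move=> /derivableP dg; set l := 'D_1 g _ in dg.
suff : is_derive z 1 ((fun w => conjc (g (conjc w))) : Cplx R -> Cplx R) (conjc l).
  by case.
apply/Cplx_derive_epsP => e e0.
have [r r0 Hr] := (Cplx_derive_epsP _ _ _).1 dg e e0; exists r => // w wz.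
have E : conjc w - conjc z = conjc (w - z) by rewrite rmorphB.
have := Hr (conjc w); rewrite E normc_conj => /(_ wz).
have conjE (a b c : R[i]) : conjc a - conjc b - conjc l * c =
    conjc (a - b - l * conjc c) by rewrite !rmorphB rmorphM /= conjcK.
by rewrite conjE normc_conj.
Qed.

Lemma Cplx_derivable_scale (a : R[i]) g z : derivable g z 1 ->
  derivable ((fun w => a * g w) : Cplx R -> Cplx R) z 1.
Proof.
move=> dg; apply: (@Cplx_derivable_comp (fun w => a * w) g z dg).
apply/Cplx_derivable_epsP; exists a => e e0; exists 1 => // w _.
by rewrite -!mulrBr subrr mulr0 ComplexField.Normc.normc0 mulr_ge0 ?normc_ge0 // ltW.
Qed.

Variable N : riemann_surface R.

Lemma holomorphic_Some (c : chart R N) g (V : set N) : rs_atlas c ->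
  V `<=` cdom c -> (forall y, V y -> derivable g (cmap c y) 1) ->
  holomorphic_to_sphere V (fun y => Some (g (cmap c y)) : sphere R).
Proof.
move=> ac Vc dg.
have comp d y : rs_atlas d -> V y -> cdom d y ->
    derivable (g \o (cmap c \o cinv d)) (cmap d y) 1.
  move=> ad Vy dy.
  have [_ dt] := rs_compatible ac ad (Vc _ Vy) dy.
  have dgy : derivable g (cmap c (cinv d (cmap d y))) 1.
    rewrite (cmapK dy); exact: (dg y Vy).
  exact: (@Cplx_derivable_comp g (cmap c \o cinv d) _ dt dgy).
split=> [y Vy|d ad y [Vy _] dy|d ad y [Vy /= ny] dy].
- have h1 := cmap_cont (Vc y Vy); have h2 := Cplx_derivable_continuous (dg y Vy).
  exact: (continuous_comp (continuous_comp h1 h2)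
    (@one_point_compactification_some_continuous (Cplx R) _)).
- exact: comp.
have gn0 : (g \o (cmap c \o cinv d)) (cmap d y) != 0.
  by apply/eqP => /= g0; apply: ny; rewrite -g0 (cmapK dy).
exact: (Cplx_derivableV gn0 (comp d y ad Vy dy)).
Qed.

Lemma holomorphic_None (V : set N) :
  holomorphic_to_sphere V (fun=> None : sphere R).
Proof.
split=> [y _|d ad y [_ []]//|d ad y _ dy]; first exact: cst_continuous.
exact: derivable_cst.
Qed.

End Holomorphic.

(** * Gluing the local null directions into one field on an open dense set *)

Section Congruence.
Variables (R : realType) (N : riemann_surface R).
Variables (A : set 'rV[R]_4) (phi : 'rV[R]_4 -> N).
Hypotheses (A_open : open A) (phi_smooth : smooth_map_on A phi)
  (phi_submersive : submersive_on A phi)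
  (phi_harmonic : harmonic_morphism_on A phi).

(* [b = false] is the conjugate complex structure on N. *)
Definition chart_fun (b : bool) (c : chart R N) : 'rV[R]_4 -> R[i] :=
  if b then cmap c \o phi else conj_fun (cmap c \o phi).

Let dom (c : chart R N) : set 'rV[R]_4 := A `&` phi @^-1` cdom c.

Lemma chart_domain_open c : open (dom c).
Proof.
rewrite openE => p [Ap cp].
have cphi := phi_smooth.1 p Ap.
have nA := open_near A_open Ap.
have nc : \forall q \near p, cdom c (phi q).
  by apply: cphi; apply: open_nbhs_nbhs; split=> //; exact: cdom_open.
by rewrite /interior; near=> q; split; near: q.
Unshelve. all: by end_near. Qed.

Lemma chart_fun_smooth b c : rs_atlas c -> smooth_cplx_on (dom c) (chart_fun b c).
Proof.
move=> ac; have s := phi_smooth.2 c ac; case: b; first exact: s.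
exact: (smooth_cplxJ (@chart_domain_open c) s).
Qed.

Lemma chart_fun_harmonic b c p : rs_atlas c -> dom c p -> harmonic_at (chart_fun b c) p.
Proof.
move=> ac /[dup] dp [Ap cp]; have h := phi_harmonic Ap ac cp; case: b; first exact: h.
exact: (harmonicJ (@chart_domain_open c) (chart_fun_smooth true ac) dp h).
Qed.

Lemma chart_funJ c p X : rs_atlas c -> dom c p ->
  cderive X (chart_fun false c) p = conjc (cderive X (cmap c \o phi) p).
Proof.
by move=> ac dp; exact: (cderiveJ _ (@chart_domain_open c) (chart_fun_smooth true ac) dp).
Qed.

Lemma chart_fun_submersive b c p z : rs_atlas c -> dom c p ->
  exists X, cderive X (chart_fun b c) p = z.
Proof.
move=> ac /[dup] dp [Ap cp]; case: b; first exact: (phi_submersive Ap ac cp z).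
have [X E] := phi_submersive Ap ac cp (conjc z).
by exists X; rewrite chart_funJ // E conjcK.
Qed.

(** Chain rule for the transition map. Its derivative r is nonzero, since otherwise the differential
    of [phi] in the chart d would vanish, against submersivity. *)
Lemma chart_change c d p : rs_atlas c -> rs_atlas d -> dom c p -> dom d p ->
  exists2 r : R[i], r != 0 & forall X,
    cderive X (cmap d \o phi) p = r * cderive X (cmap c \o phi) p.
Proof.
move=> ac ad cp dp.
have oB : open (dom c `&` dom d).
  exact: (openI (@chart_domain_open c) (@chart_domain_open d)).
have Bp : (dom c `&` dom d) p by [].
have [dt _] := rs_compatible ac ad cp.2 dp.2.
pose r : R[i] := 'D_(1 : Cplx R) (cmap d \o cinv c) (cmap c (phi p)).
have dt' : is_derive (cmap c (phi p)) (1 : Cplx R) (cmap d \o cinv c) r.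
  exact: derivableP.
have sc : smooth_cplx_on (dom c `&` dom d) (cmap c \o phi).
  by apply: smooth_cplx_sub (chart_fun_smooth true ac) => ? [].
have sd : smooth_cplx_on (dom c `&` dom d) (cmap d \o phi).
  by apply: smooth_cplx_sub (chart_fun_smooth true ad) => ? [].
have E q : (dom c `&` dom d) q ->
    (cmap d \o phi) q = ((cmap d \o cinv c) \o (cmap c \o phi)) q.
  by move=> [[_ cq] _] /=; rewrite cmapK.
have rE X : cderive X (cmap d \o phi) p = r * cderive X (cmap c \o phi) p.
  rewrite (cderive_ext X oB Bp E).
  apply: (cderive_comp _ oB Bp sc) dt'.
  exact: smooth_cplx_ext oB E sd.
exists r => //; apply/eqP => r0.
have [X XE] := phi_submersive dp.1 ad dp.2 1.
by move: XE; rewrite rE r0 mul0r => /eqP; rewrite eq_sym oner_eq0.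
Qed.

Let null_dir_chart b c d p : rs_atlas c -> rs_atlas d -> dom c p -> dom d p ->
  null_dir (chart_fun b d) p = null_dir (chart_fun b c) p.
Proof.
move=> ac ad cp dp; have [r r0 E] := chart_change ac ad cp dp.
case: b.
  by apply: (null_dir_scale r0) => k; exact: E.
have r0' : conjc r != 0 by rewrite conjc_eq0.
apply: (null_dir_scale r0') => k; rewrite /cpartial !chart_funJ // E.
by rewrite rmorphM.
Qed.

Definition aligned_at b : set 'rV[R]_4 := [set p | exists c B,
  [/\ rs_atlas c, open B, B p, B `<=` A `&` phi @^-1` cdom c &
      aligned (chart_fun b c) B]].

(* Both structures may be aligned at a point; the first one is preferred, and
   the interior makes this choice locally constant. *)
Definition congruence_domain : set 'rV[R]_4 :=
  aligned_at true `|` (aligned_at false `&` (~` aligned_at true)^°).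

Lemma some_chart (q : N) : {c : chart R N | rs_atlas c /\ cdom c q}.
Proof.
by apply: constructive_indefinite_description; have [c ac cq] := rs_cover q; exists c.
Qed.

(** The chart is picked arbitrarily at each point; by [null_dir_chart] the result does not depend on
    it. *)
Definition congruence_dir p : 'rV[R]_4 :=
  null_dir (chart_fun `[< aligned_at true p >] (sval (some_chart (phi p)))) p.

Let aligned_at_open b : open (aligned_at b).
Proof.
rewrite openE => p [c [B [ac oB Bp BA al]]].
by apply: filterS (open_near oB Bp) => q Bq; exists c, B.
Qed.

Lemma congruence_domain_sub : congruence_domain `<=` A.
Proof. by move=> p [[c [B [_ _ Bp BA _]]]|[[c [B [_ _ Bp BA _]]] _]]; case: (BA _ Bp). Qed.

Lemma congruence_domain_open : open congruence_domain.
Proof.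
apply: openU; first exact: aligned_at_open.
by apply: openI; [exact: aligned_at_open|exact: open_interior].
Qed.

Lemma congruence_domain_dense : A `<=` closure congruence_domain.
Proof.
move=> p Ap W Wp; have [c ac cp] := rs_cover (phi p).
pose O := dom c `&` W^°.
have oO : open O by exact: (openI (@chart_domain_open c) (@open_interior _ W)).
have Op : O p by split.
have OW : O `<=` W by move=> q [_ /interior_subset].
have Oc : O `<=` dom c by move=> q [].
have [||Q [Q_open [q Qq] QO al]] :=
    aligned_dense (f := chart_fun true c) oO (ex_intro _ p Op).
- exact: smooth_cplx_sub Oc (chart_fun_smooth true ac).
- by move=> q /Oc; exact: chart_fun_harmonic.
have goodQ b : aligned (chart_fun b c) Q -> Q `<=` aligned_at b.
  by move=> alb x Qx; exists c, Q; split=> // y /QO /Oc.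
case: al => al.
  by exists q; split; [left; exact: goodQ al _ Qq|exact/OW/QO].
(* Only the conjugate structure is aligned on Q. Either the preferred one is aligned somewhere in Q,
   or Q avoids it entirely and, being open, lies in the interior of its complement. *)
have [[x [Qx Tx]]|nT] := pselect (exists x, Q x /\ aligned_at true x).
  by exists x; split; [left|exact/OW/QO].
exists q; split; last exact/OW/QO.
right; split; first exact: (goodQ false al) Qq.
apply: filterS (open_near Q_open Qq) => x Qx Tx; apply: nT.
by exists x.
Qed.

(** Near each point the glued field comes from one chart and one structure. All properties below are
    local and pass through this description. *)
Lemma congruence_local p : congruence_domain p -> exists b c B,
  [/\ [/\ rs_atlas c, open B & B p], B `<=` congruence_domain,
      B `<=` A `&` phi @^-1` cdom c, aligned (chart_fun b c) B &
      forall q, B q -> congruence_dir q = null_dir (chart_fun b c) q].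
Proof.
have ch q : rs_atlas (sval (some_chart (phi q))) /\ cdom (sval (some_chart (phi q))) (phi q).
  exact: svalP (some_chart (phi q)).
move=> [[c [B [ac oB Bp BA al]]]|[[c [B [ac oB Bp BA al]]] nT]].
  exists true, c, B; have BT : B `<=` aligned_at true by move=> q Bq; exists c, B.
  split; [by split|by move=> q /BT; left|exact: BA|exact: al|move=> q Bq].
  have [ac' cq'] := ch q; have [Aq cq] := BA _ Bq.
  rewrite /congruence_dir; have -> : `[< aligned_at true q >] = true.
    by apply/asboolP; exact: BT.
  exact: null_dir_chart.
exists false, c, (B `&` (~` aligned_at true)^°).
have oB' : open (B `&` (~` aligned_at true)^°) by apply: openI => //; exact: open_interior.
split; first by split.
- by move=> q [Bq nTq]; right; split; [exists c, B|exact: nTq].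
- by move=> q [/BA].
- by case: al => al; [left|right] => q [Bq _]; exact: al.
move=> q [Bq nTq]; have [ac' cq'] := ch q; have [Aq cq] := BA _ Bq.
rewrite /congruence_dir; have -> : `[< aligned_at true q >] = false.
  by apply/asboolPn; exact: (interior_subset nTq).
exact: null_dir_chart.
Qed.

End Congruence.

Section NullRatioFactorization.
Variables (R : realType) (f : 'rV[R]_4 -> R[i]) (B : set 'rV[R]_4).

Lemma null_ratio_factor p0 : open B -> smooth_cplx_on B f -> aligned f B ->
  B p0 -> (forall z, exists X, cderive X f p0 = z) ->
  (forall p, B p -> cdir dirD f p = 0) \/
  exists (e d : R) (rho : R[i] -> R[i]),
  [/\ 0 < e, 0 < d,
      forall p, `|p0 - p| < e -> [/\ B p, normc (f p - f p0) < d &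
         null_ratio f p = Some (rho (f p))] &
      forall z, normc (z - f p0) < d -> derivable (rho : Cplx R -> Cplx R) z 1].
Proof.
move=> oB sf [H|H] Bp0 sub; last by left=> p /H [].
right; have su := smooth_ratio_u oB sf (fun p Bp => (H p Bp).1).
have [e [d [rho [e0 d0 Hp Hz]]]] :=
  local_factorization oB sf su Bp0 sub (fun p Bp => (H p Bp).2).
exists e, d, rho; split=> // p pe; have [Bp fd uE] := Hp p pe; split=> //.
by have [dn0 _] := H p Bp; rewrite /null_ratio (negPf dn0) uE.
Qed.

End NullRatioFactorization.

(** * Shear-freeness, fibres and representation *)

Section CongruenceProperties.
Variables (R : realType) (N : riemann_surface R).
Variables (A : set 'rV[R]_4) (phi : 'rV[R]_4 -> N).
Hypotheses (A_open : open A) (phi_smooth : smooth_map_on A phi)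
  (phi_submersive : submersive_on A phi)
  (phi_harmonic : harmonic_morphism_on A phi).

Let A0 := congruence_domain A phi.
Let U := congruence_dir A phi.

Let local p (A0p : A0 p) :=
  congruence_local A_open phi_smooth phi_submersive A0p.

Let smooth_local b c B : rs_atlas c -> B `<=` A `&` phi @^-1` cdom c ->
  smooth_cplx_on B (chart_fun phi b c).
Proof.
by move=> ac BA; exact: smooth_cplx_sub BA (chart_fun_smooth A_open phi_smooth b ac).
Qed.

Let harmonic_local b c B : rs_atlas c -> B `<=` A `&` phi @^-1` cdom c ->
  forall p, B p -> harmonic_at (chart_fun phi b c) p.
Proof.
move=> ac BA p Bp.
exact: (chart_fun_harmonic A_open phi_smooth phi_harmonic b ac (BA p Bp)).
Qed.

Let submersive_local b c p : rs_atlas c -> A p -> cdom c (phi p) ->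
  forall z, exists X, cderive X (chart_fun phi b c) p = z.
Proof.
move=> ac Ap cp z.
exact: (chart_fun_submersive A_open phi_smooth phi_submersive b z ac (conj Ap cp)).
Qed.

Lemma chart_fun_inj b c p q : cdom c (phi p) -> cdom c (phi q) ->
  chart_fun phi b c q = chart_fun phi b c p -> phi q = phi p.
Proof.
move=> cp cq E; rewrite -(cmapK cp) -(cmapK cq); congr (cinv c).
by case: b E => //; exact: (can_inj (@conjcK R)).
Qed.

Lemma congruence_unit p : A0 p -> tcoord (U p) = 0 /\ minkowski (U p) (U p) = 1.
Proof. by move=> _; exact: sigma_inv_unit. Qed.

Lemma congruence_smooth : smooth_field_on A0 U.
Proof.
move=> j; apply: smooth_on_local => p /local.
move=> [b [c [B [[ac oB Bp] BA0 BA al UE]]]]; exists B; split=> //.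
have s := null_dir_smooth oB (smooth_local b ac BA) al j.
by apply: smooth_on_ext oB _ s => q Bq; rewrite /U UE.
Qed.

Lemma congruence_continuous p : A0 p -> {for p, continuous U}.
Proof.
move=> A0p; suff : U q @[q --> p] --> U p by [].
apply/(@cvgrPdist_le _ _ _ (nbhs p)) => e e0.
have c j : \forall q \near p, `|U p 0 j - U q 0 j| <= e.
  have [cj _] := congruence_smooth j [::] A0p.
  by move/cvgrPdist_le : cj => /(_ e e0).
have cj : \forall q \near p, forall j, `|U p 0 j - U q 0 j| <= e.
  by near=> q => j; move: j; near: q; apply: filter_forall => j; exact: c.
apply: filterS cj => q Hq; apply: rV4_norm_le => j; rewrite !mxE; exact: Hq.
Unshelve. all: by end_near. Qed.

Lemma congruence_along_line p : A0 p -> exists2 e : R, 0 < e &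
  forall s : R, `|s| < e ->
  [/\ A0 (p + s *: (delta_mx 0 0 + U p)), U (p + s *: (delta_mx 0 0 + U p)) = U p &
      phi (p + s *: (delta_mx 0 0 + U p)) = phi p].
Proof.
move=> /local [b [c [B [[ac oB Bp] BA0 BA al UE]]]].
have [e e0 He] :=
  null_dir_line oB (smooth_local b ac BA) (harmonic_local b ac BA) al Bp.
exists e; first exact: e0.
move=> s /He; rewrite /U (UE p Bp) => -[Bs Us fs].
split; [exact: BA0|by rewrite UE|].
exact: chart_fun_inj (BA _ Bp).2 (BA _ Bs).2 fs.
Qed.

(** Locally u is either rho(f), hence determined by [phi], or identically infinite. *)
Lemma congruence_along_fibre p : A0 p -> exists2 e : R, 0 < e &
  forall q, `|p - q| < e -> phi q = phi p -> U q = U p.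
Proof.
move=> /local [b [c [B [[ac oB Bp] BA0 BA al UE]]]].
have fE q : phi q = phi p -> chart_fun phi b c q = chart_fun phi b c p.
  by move=> E; rewrite /chart_fun; case: b {al UE}; rewrite /conj_fun /= E.
have [D0|[e [d [rho [e0 d0 He Hd]]]]] := null_ratio_factor oB
    (smooth_local b ac BA) al Bp (submersive_local b ac (BA _ Bp).1 (BA _ Bp).2).
  have [e e0 He] := rV4_nbhs_ball (open_near oB Bp).
  exists e; first exact: e0.
  move=> q /He Bq _; rewrite /U (UE q Bq) (UE p Bp).
  by rewrite (null_dir_infinite (D0 q Bq)) (null_dir_infinite (D0 p Bp)).
exists e; first exact: e0.
move=> q /He[Bq _ rq] /fE fq; rewrite /U (UE q Bq) (UE p Bp) /null_dir rq fq.
by have [|_ _ ->] := He p; first by rewrite subrr normr0.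
Qed.

Definition null_congruence : ray_foliation R := null_line_foliation A0 U.

Lemma null_congruence_foliation : null_foliation_on A0 null_congruence.
Proof.
exact: null_line_foliationP congruence_unit congruence_continuous
  congruence_along_line congruence_smooth.
Qed.

Let local_linear b c B p X : rs_atlas c -> open B -> B p ->
  B `<=` A `&` phi @^-1` cdom c -> aligned (chart_fun phi b c) B ->
  U p = null_dir (chart_fun phi b c) p -> in_Sigma null_congruence p X ->
  cderive (Jperp null_congruence p X) (chart_fun phi b c) p =
  Complex 0 1 * cderive X (chart_fun phi b c) p.
Proof.
move=> ac oB Bp BA al UE [X0 XU]; rewrite JperpE /= -/U UE.
apply: (null_dir_linear oB (smooth_local b ac BA) (harmonic_local b ac BA) al Bp X0).
by rewrite -UE.
Qed.

(** Both derivatives of w are values of dU, which have no time component, so the projection does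
    nothing; then dU (df (JX)) = dU (i df X) = J dU (df X). *)
Lemma null_congruence_shear_free : shear_free_ray_congruence A0 null_congruence.
Proof.
split; first exact: null_congruence_foliation.
move=> p X A0p SX.
have [b [c [B [[ac oB Bp] BA0 BA al UE]]]] := local A0p.
have sf := smooth_local b ac BA.
have [dU [dU0 dUt dUi dUE]] := null_dir_derive oB sf al Bp.
have nE Y : nabla Y (tangent_field null_congruence) p =
    dU (cderive Y (chart_fun phi b c) p).
  rewrite -dUE /nabla.
  transitivity ('D_Y (cst (delta_mx 0 0 : 'rV[R]_4) + null_dir (chart_fun phi b c)) p).
    apply: near_eq_derive; near=> q; rewrite /tangent_field /=.
    by rewrite /U (UE q) //; near: q; exact: open_near.
  by rewrite deriveD ?derive_cst ?add0r //; exact: null_dir_derivable oB sf al _ _ Bp.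
have proj z : Sigma_proj null_congruence p (dU z) = dU z.
  by rewrite /Sigma_proj /tcoord dUt scale0r subr0.
rewrite !nE !proj (local_linear ac oB Bp BA al (UE p Bp) SX) dUi JperpE /= /U.
by rewrite (UE p Bp).
Unshelve. all: by end_near. Qed.

Lemma null_congruence_fibres p : A0 p -> exists S : set (set 'rV[R]_4),
  [/\ S `<=` leaves null_congruence, parallel_leaves S &
      fibre_component A0 phi p = \bigcup_(L in S) L].
Proof.
exact: fibre_component_leaves congruence_unit congruence_continuous
  congruence_along_line congruence_along_fibre p.
Qed.

Lemma null_congruence_represented p : A0 p ->
  exists (A1 : set 'rV[R]_4) (V : set N) (rho : N -> sphere R),
    [/\ [/\ open A1, A1 p & A1 `<=` A0],
        open V /\ phi @` A1 `<=` V,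
        represents_on A1 null_congruence (rho \o phi) &
        (Sigma_linear A1 phi null_congruence /\ holomorphic_to_sphere V rho) \/
        (Sigma_antilinear A1 phi null_congruence /\
         antiholomorphic_to_sphere V rho)].
Proof.
move=> A0p; have [b [c [B [[ac oB Bp] BA0 BA al UE]]]] := local A0p.
have linear q d X : B q -> rs_atlas d -> cdom d (phi q) ->
    in_Sigma null_congruence q X ->
    cderive (Jperp null_congruence q X) (cmap d \o phi) q =
    (if b then Complex 0 1 else - Complex 0 1) * cderive X (cmap d \o phi) q.
  move=> Bq ad dq SX; have [Aq cq] := BA _ Bq.
  have [r r0 rE] := chart_change A_open phi_smooth phi_submersive ac ad
    (conj Aq cq) (conj Aq dq).
  rewrite !rE mulrCA; congr (_ * _).
  have := local_linear ac oB Bq BA al (UE q Bq) SX.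
  case: b {al UE} => // E; apply: (can_inj (@conjcK R)).
  have conjE (z : R[i]) : conjc (- Complex 0 1 * z) = Complex 0 1 * conjc z.
    by case: z => x y; apply: eq_ReIm; rewrite /=; ring.
  rewrite conjE -(chart_funJ A_open phi_smooth X ac (conj Aq cq)) -E.
  by rewrite (chart_funJ A_open phi_smooth _ ac (conj Aq cq)).
have Slin (A1 : set 'rV[R]_4) : A1 `<=` B ->
    (if b then Sigma_linear A1 phi null_congruence
     else Sigma_antilinear A1 phi null_congruence).
  move=> A1B; case: b {al UE} linear => linear q A1q d ad dq X SX.
    by rewrite (linear q d X (A1B _ A1q)).
  by rewrite (linear q d X (A1B _ A1q)) // mulNr.
pose f := chart_fun phi b c.
have [D0|[e [d [rho [e0 d0 He Hd]]]]] := null_ratio_factor oB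
    (smooth_local b ac BA) al Bp (submersive_local b ac (BA _ Bp).1 (BA _ Bp).2).
  exists B, (cdom c), (fun=> None); split=> //.
  - by split; [exact: cdom_open|move=> _ [q Bq <-]; have [] := BA _ Bq].
  - move=> q Bq /=; rewrite /U (UE q Bq) null_dir_infinite //; exact: D0.
  - have := Slin B (@subset_refl _ B); case: b {al UE linear Slin D0 f} => S; [left|right].
      by split=> //; exact: holomorphic_None.
    by split=> //; exact: (@holomorphic_None R N (cdom c)).
(* The factorization is through f, which is the chart or its conjugate; [cj] passes between the
   two. *)
pose cj (z : R[i]) : R[i] := if b then z else conjc z.
have fE q : f q = cj (cmap c (phi q)) by rewrite /f /chart_fun /cj; case: (b).
pose V : set N := cdom c `&` [set y | normc (cmap c y - cmap c (phi p)) < d].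
(* The convention is U = sigma_inv (i mu), so mu = - i u. For the conjugate structure it is conj mu
   that is holomorphic in the chart. *)
pose g (z : Cplx R) : Cplx R := - Complex 0 1 * rho (cj z).
have cjB z w : normc (cj z - cj w) = normc (z - w).
  by rewrite /cj; case: (b) => //; rewrite -rmorphB normc_conj.
have oV : open V.
  rewrite openE => y [cy yd]; rewrite /interior.
  have n1 : \near y, cdom c y.
    by apply: open_nbhs_nbhs; split=> //; exact: cdom_open.
  have n2 : \forall x \near y, normc (cmap c x - cmap c (phi p)) < d.
    suff n3 : nbhs (cmap c y) [set z : Cplx R | normc (z - cmap c (phi p)) < d].
      exact: (cmap_cont cy n3).
    apply/Cplx_nbhs_normc.
    exists (d - normc (cmap c y - cmap c (phi p))); first by rewrite subr_gt0.
    move=> w yw /=.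
    have -> : w - cmap c (phi p) = (w - cmap c y) + (cmap c y - cmap c (phi p)).
      by rewrite addrA subrK.
    by apply: le_lt_trans (le_normcD _ _) _; rewrite -ltrBrDr normc_distC.
  by near=> x; split; near: x.
exists (ball p e), V, (fun y => Some (g (cmap c y))); split.
- split; [exact: ball_open|exact: ballxx|].
  by move=> q /rV4_ball /He [/BA0].
- split=> // _ [q /rV4_ball /He [Bq fd _] <-]; split; first by have [] := BA _ Bq.
  by move: fd; rewrite -/f !fE cjB.
- move=> q /rV4_ball /He [Bq _ rq] /=; rewrite /U (UE q Bq) /null_dir rq -/f fE.
  rewrite /sphere_mulI /= /g; congr (sigma_inv (Some _)).
  by rewrite mulrA mulrN (sqr_i R : Complex 0 1 * Complex 0 1 = -1) opprK mul1r.
have rhod y : V y -> derivable (rho : Cplx R -> Cplx R) (cj (cmap c y)) 1.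
  by move=> [_ yd]; apply: Hd; rewrite -/f fE cjB.
have pB : ball p e `<=` B by move=> q /rV4_ball /He [].
have := Slin _ pB; rewrite /g; move: rhod; rewrite /cj.
case: (b) => rhod S; [left|right]; split=> //.
  apply: (@holomorphic_Some R N c (fun z => - Complex 0 1 * rho z) V ac).
    by move=> y [].
  by move=> y Vy; apply: Cplx_derivable_scale; exact: rhod.
apply: (@holomorphic_Some R N c
  (fun z => conjc (- Complex 0 1 * rho (conjc z))) V ac); first by move=> y [].
move=> y Vy; apply: (@Cplx_derivable_conj R (fun w => - Complex 0 1 * rho w)).
by apply: Cplx_derivable_scale; exact: rhod.
Unshelve. all: by end_near. Qed.

End CongruenceProperties.

Theorem theoremS8p5 (R : realType) (N : riemann_surface R)
    (A : set (M4 R)) (phi : M4 R -> N)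
    (A_open : open A)
    (phi_smooth : smooth_map_on A phi)
    (phi_submersive : submersive_on A phi)
    (phi_harmonic_morphism : harmonic_morphism_on A phi) :
  exists (A0 : set (M4 R)) (ell : ray_foliation R),
    [/\ [/\ open A0, A0 `<=` A & A `<=` closure A0],
        shear_free_ray_congruence A0 ell,
        forall p, A0 p ->
          exists S : set (set (M4 R)),
            [/\ S `<=` leaves ell,
                parallel_leaves S &
                fibre_component A0 phi p = \bigcup_(L in S) L] &
        forall p, A0 p ->
          exists (A1 : set (M4 R)) (V : set N) (rho : N -> sphere R),
            [/\ [/\ open A1, A1 p & A1 `<=` A0],
                open V /\ phi @` A1 `<=` V,
                represents_on A1 ell (rho \o phi) &
                (Sigma_linear A1 phi ell /\ holomorphic_to_sphere V rho) \/
                (Sigma_antilinear A1 phi ell /\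
                 antiholomorphic_to_sphere V rho)]].
Proof.
exists (congruence_domain A phi), (null_congruence A phi); split.
- split; first exact: congruence_domain_open.
    exact: congruence_domain_sub.
  exact: congruence_domain_dense A_open phi_smooth phi_harmonic_morphism.
- exact: null_congruence_shear_free A_open phi_smooth phi_submersive
    phi_harmonic_morphism.
- exact: null_congruence_fibres A_open phi_smooth phi_submersive
    phi_harmonic_morphism.
exact: null_congruence_represented A_open phi_smooth phi_submersive
  phi_harmonic_morphism.
Qed.
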